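(* Let $E(0,\infty)$ be a symmetric function space such that $E(0,\infty)\cap L_\infty(0,\infty)\subsetneqq C_0(0,\infty)$. Then there exists a symmetric KB-function space $F(0,\infty)$ containing $E(0,\infty)$. If, in addition, the space $$E(0,1):=\Big\{f\in L_1(0,1): g:=f \text{ on }(0,1),\ g:=0 \text{ elsewhere, satisfies } g\in E(0,\infty)\Big\},\quad \|f\|_{E(0,1)}=\|g\|_{E(0,\infty)},$$ satisfies $E(0,1)\neq L_1(0,1)$, then $F(0,\infty)$ can be chosen to be a reflexive symmetric space.
   Context: $S(0,\infty)$ is the algebra of Lebesgue measurable functions $f$ on $(0,\infty)$ with $m(\{|f|>s\})<\infty$ for some $s>0$; $\mu(f)$ is the decreasing rearrangement of $|f|$, $\mu(t;f)=\inf\{s\ge0:m(\{|f|>s\})\le t\}$. A symmetric function space is a linear subspace $E$ of $S(0,\infty)$ with a complete norm such that $f\in S(0,\infty)$, $g\in E$, $\mu(f)\le\mu(g)$ imply $f\in E$, $\|f\|_E\le\|g\|_E$. $C_0(0,\infty)=\{f\in L_\infty(0,\infty):\lim_{t\to\infty}\mu(t;f)=0\}$. A symmetric space has the Fatou property if every upwards directed net $(f_\beta)$ of nonnegative elements with $\sup\|f_\beta\|<\infty$ has a supremum $f$ in the space with $f_\beta\uparrow f$ and $\|f\|=\sup\|f_\beta\|$; its norm is order continuous if $\|f_\alpha\|\to0$ whenever $f_\alpha\downarrow0$; a KB-space is a symmetric space with the Fatou property and order continuous norm. *)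

(* Defs.v *)
From HB Require Import structures.
From mathcomp Require Import all_boot all_order all_algebra.
From mathcomp Require Import all_classical all_reals all_analysis.
Import Order.TTheory GRing.Theory Num.Theory.
Import numFieldNormedType.Exports.

Set Implicit Arguments.
Unset Strict Implicit.
Unset Printing Implicit Defensive.

Local Open Scope classical_set_scope.
Local Open Scope ring_scope.

Section SymmetricSpaces.
Variable R : realType.

(* Functions on (0,oo) are represented by functions R -> R; only their
   values on (0,oo) matter (all notions below are insensitive to the rest). *)
Definition pos_half : set R := `]0, +oo[%classic.

Definition distrib (f : R -> R) (s : R) : \bar R :=
  (@lebesgue_measure R) [set x | 0 < x /\ s < `|f x|].

Definition S0 : set (R -> R) :=
  [set f | measurable_fun pos_half f /\
           exists s, 0 < s /\ (distrib f s < +oo)%E].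

Definition rearr (f : R -> R) (t : R) : \bar R :=
  ereal_inf [set s%:E | s in [set s : R | 0 <= s /\ (distrib f s <= t%:E)%E]].

Definition rearr_le (f g : R -> R) : Prop :=
  forall t, 0 < t -> (rearr f t <= rearr g t)%E.

Definition ae_le (f g : R -> R) : Prop :=
  (@lebesgue_measure R) [set x | 0 < x /\ g x < f x] = 0%E.
Definition ae_zero (f : R -> R) : Prop :=
  (@lebesgue_measure R) [set x | 0 < x /\ f x != 0] = 0%E.

Definition Linf : set (R -> R) :=
  [set f | measurable_fun pos_half f /\ exists M, distrib f M = 0%E].
Definition C0 : set (R -> R) :=
  [set f | Linf f /\
     forall e, 0 < e -> exists T, forall t, T <= t -> (rearr f t <= e%:E)%E].

Definition unit_itv : set R := `]0, 1[%classic.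
Definition L1_01 : set (R -> R) :=
  [set f | (@lebesgue_measure R).-integrable unit_itv (EFin \o f)].
Definition extend01 (f : R -> R) : R -> R :=
  fun x => if (0 < x) && (x < 1) then f x else 0.
Definition E01 (E : set (R -> R)) : set (R -> R) :=
  [set f | L1_01 f /\ E (extend01 f)].

Definition symmetric_space (E : set (R -> R)) (N : (R -> R) -> R) : Prop :=
  [/\ E `<=` S0,
      E (fun _ => 0) /\
      (forall f g, E f -> E g -> E (f \+ g)) /\
      (forall (a : R) f, E f -> E (fun x => a * f x)),
      (forall f, E f -> 0 <= N f /\ (N f = 0 <-> ae_zero f)) /\
      (forall f g, E f -> E g -> N (f \+ g) <= N f + N g) /\
      (forall (a : R) f, E f -> N (fun x => a * f x) = `|a| * N f),
      (forall u : nat -> R -> R, (forall n, E (u n)) ->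
         (forall e, 0 < e -> exists n0, forall m n, (n0 <= m)%N -> (n0 <= n)%N ->
              N (u m \- u n) < e) ->
         exists f, E f /\
           (forall e, 0 < e -> exists n0, forall n, (n0 <= n)%N -> N (u n \- f) < e))
    & (forall f g, S0 f -> E g -> rearr_le f g -> E f /\ N f <= N g)].

Definition fatou (E : set (R -> R)) (N : (R -> R) -> R) : Prop :=
  forall D : set (R -> R),
    D `<=` E -> D !=set0 ->
    (forall g, D g -> ae_le (fun _ => 0) g) ->
    (forall g h, D g -> D h -> exists k, D k /\ ae_le g k /\ ae_le h k) ->
    (exists M, forall g, D g -> N g <= M) ->
    exists f, [/\ E f,
      (forall g, D g -> ae_le g f),
      (forall h, E h -> (forall g, D g -> ae_le g h) -> ae_le f h),
      (forall g, D g -> N g <= N f)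
    & (forall M, (forall g, D g -> N g <= M) -> N f <= M)].

Definition order_continuous (E : set (R -> R)) (N : (R -> R) -> R) : Prop :=
  forall D : set (R -> R),
    D `<=` E -> D !=set0 ->
    (forall g h, D g -> D h -> exists k, D k /\ ae_le k g /\ ae_le k h) ->
    (forall g, D g -> ae_le (fun _ => 0) g) ->
    (forall h, E h -> (forall g, D g -> ae_le h g) -> ae_le h (fun _ => 0)) ->
    forall e, 0 < e -> exists g, D g /\ forall h, D h -> ae_le h g -> N h < e.

Definition KB_space (E : set (R -> R)) (N : (R -> R) -> R) : Prop :=
  [/\ symmetric_space E N, fatou E N & order_continuous E N].

Definition dual_elt (E : set (R -> R)) (N : (R -> R) -> R)
    (phi : (R -> R) -> R) : Prop :=
  (forall f g (a : R), E f -> E g -> phi (f \+ (fun x => a * g x)) = phi f + a * phi g)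
  /\ exists C, forall f, E f -> `|phi f| <= C * N f.

Definition dual_bound (E : set (R -> R)) (N : (R -> R) -> R)
    (phi : (R -> R) -> R) (M : R) : Prop :=
  0 <= M /\ forall f, E f -> `|phi f| <= M * N f.

Definition bidual_elt (E : set (R -> R)) (N : (R -> R) -> R)
    (Phi : ((R -> R) -> R) -> R) : Prop :=
  (forall phi psi (a : R), dual_elt E N phi -> dual_elt E N psi ->
      Phi (fun f => phi f + a * psi f) = Phi phi + a * Phi psi)
  /\ exists C, forall phi M, dual_elt E N phi -> dual_bound E N phi M ->
      `|Phi phi| <= C * M.

Definition reflexive_space (E : set (R -> R)) (N : (R -> R) -> R) : Prop :=
  forall Phi, bidual_elt E N Phi ->
    exists f, E f /\ forall phi, dual_elt E N phi -> Phi phi = phi f.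

End SymmetricSpaces.

(* Main.v *)
(** [E] is embedded into the [l^2]-sum [F] of the functionals [f |-> d_n K(t_n, f)], where
    [K(t, f)] is the integral of the decreasing rearrangement of [f] over [(0, t)], that is
    the supremum of [int g |f|] over all [0 <= g <= 1] with [int g <= t].
    Averaging over cyclic permutations of the cells of [(0, t)] gives [K(t, f) <= t |f|_E / phi(t)]
    with [phi] the fundamental function of [E]. As [C_0] is not contained in [E], [phi] is
    unbounded, so one can take [t_n] and [phi(t_n)] large with [d_n = 1 / t_n]: then [F] contains
    [E] and, the sum over [n] being an [l^2]-sum, [F] is a KB-space. If moreover
    [E(0,1) <> L_1(0,1)], then [phi(t) / t] is unbounded near 0 and one adds infinitely many terms
    with [t_n] and [t_n / phi(t_n)] small and [d_n = 1]; these make the unit ball of [F] uniformly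
    integrable. Functionals and second-order functionals are then represented by densities, and
    the tails of functionals vanish because of the uniform convexity of [l^2]. *)

Require Import Defs.
From HB Require Import structures.
From mathcomp Require Import all_boot all_order all_algebra.
From mathcomp Require Import all_classical all_reals all_analysis.
From mathcomp Require Import measurable_realfun lra.
Import Order.TTheory GRing.Theory Num.Theory.
Import numFieldNormedType.Exports.

Set Implicit Arguments.
Unset Strict Implicit.
Unset Printing Implicit Defensive.

Local Open Scope classical_set_scope.
Local Open Scope ring_scope.

(** * Pairings and gauges *)

(** Every norm here is a [gauge], a supremum of integrals of g |f| over a set of weights g. This
    covers the l^2-sum too, because its dual unit ball may be restricted to finite sequences. The
    triangle inequality and the Fatou property are then proved once, and rearrangement invariance
    only needs the supremum defining K(t, g) to be attained. Three conditions on the parameters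
    shape F. The bound d_n min(t_n, 1) <= 2^-n puts bounded integrable functions into F. That d_n
    t_n >= 1 infinitely often excludes functions with a set {|f| > s}, s > 0, of infinite measure,
    on which K(t, .) is not order continuous. That d_n >= 1 infinitely often gives K(r, f) <= e
    |f|_F for small r, uniformly in f. A bounded functional on a dual space need not be countably
    additive. The uniform bound makes the functionals with density exp(-x) s_k tend to 0 in norm
    when bounded s_k tend to 0, so that Radon-Nikodym applies; vanishing tails make such functionals
    norm dense in the dual. The weight exp(-x) is positive and carries bounded functions both into F
    and into its dual. *)

Notation mes f := (measurable_fun (@pos_half _) (f : _ -> _)).

#[global] Instance ae_lebesgue_filter (R : realType) :
  Filter (nbhs (almost_everywhere (@lebesgue_measure R))).
Proof.
exact: (@ae_filter_ringOfSetsType _ (measurableTypeR R) _ (@lebesgue_measure R)).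
Qed.

Section Pairing.
Variable R : realType.
Local Notation mu := (@lebesgue_measure R).
Local Notation D := (@pos_half R).
Implicit Types (f g h : R -> R) (G : set (R -> R)).

Lemma pos_halfE (x : R) : D x = (0 < x) :> Prop.
Proof. by rewrite /pos_half /= in_itv /= andbT. Qed.

Lemma measurable_pos_half : measurable D.
Proof. exact: measurable_itv. Qed.
Hint Resolve measurable_pos_half : core.

Lemma mes_norm f : mes f -> mes (fun x => `|f x|).
Proof. by move=> mf; apply: measurableT_comp. Qed.

Lemma mesZ (a : R) f : mes f -> mes (fun x => a * f x).
Proof. by move=> mf; apply: measurable_funM => //; exact: measurable_cst. Qed.

Lemma measurable_pos_half_lt f g : mes f -> mes g ->
  measurable (D `&` [set x | f x < g x]).
Proof.
move=> mf mg.
have /(_ measurable_pos_half [set true]) := measurable_fun_ltr mf mg.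
exact.
Qed.

Lemma measurable_pos_half_le f g : mes f -> mes g ->
  measurable (D `&` [set x | f x <= g x]).
Proof.
move=> mf mg.
have /(_ measurable_pos_half [set true]) := measurable_fun_ler mf mg.
exact.
Qed.

Definition levelset f (s : R) : set R := D `&` [set x | s < `|f x|].

Lemma distribE f s : distrib f s = mu (levelset f s).
Proof.
by congr (mu _); apply/seteqP; split => x /=; rewrite /levelset /= pos_halfE.
Qed.

Lemma measurable_levelset f s : mes f -> measurable (levelset f s).
Proof.
by move=> mf; apply: measurable_pos_half_lt; [exact: measurable_cst|exact: mes_norm].
Qed.

Definition pairing g f : \bar R := (\int[mu]_(x in D) (g x * `|f x|)%:E)%E.

Definition weight g := mes g /\ forall x, 0 <= g x.

Lemma mes_pairing g f : mes g -> mes f ->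
  measurable_fun D (fun x => (g x * `|f x|)%:E).
Proof.
move=> mg mf; apply/measurable_EFinP; apply: measurable_funM => //.
exact: mes_norm.
Qed.

Lemma pairing_integrand_ge0 g f x : weight g -> (0 <= (g x * `|f x|)%:E)%E.
Proof. by move=> [_ g0]; rewrite lee_fin mulr_ge0. Qed.

Lemma pairing_ge0 g f : weight g -> (0 <= pairing g f)%E.
Proof. by move=> wg; apply: integral_ge0 => x _; exact: pairing_integrand_ge0. Qed.

Definition ae_abs_le f h := {ae mu, forall x, D x -> `|f x| <= `|h x|}.

Lemma pairing_le g f h : weight g -> mes f -> mes h -> ae_abs_le f h ->
  (pairing g f <= pairing g h)%E.
Proof.
move=> wg mf mh fh; have [mg g0] := wg.
apply: ae_ge0_le_integral => //; do ?[by move=> *; exact: pairing_integrand_ge0];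
  do ?exact: mes_pairing.
move: fh; apply: filterS => x /[apply] ?.
by rewrite lee_fin ler_wpM2l.
Qed.

Lemma pairingD g f h : weight g -> mes f -> mes h ->
  (pairing g (f \+ h)%R <= pairing g f + pairing g h)%E.
Proof.
move=> wg mf mh; have [mg g0] := wg.
rewrite /pairing -ge0_integralD//; do ?[by move=> *; exact: pairing_integrand_ge0];
  do ?exact: mes_pairing.
apply: ge0_le_integral => //; do ?[by move=> *; exact: pairing_integrand_ge0].
- by apply: mes_pairing => //; exact: measurable_funD.
- by apply: emeasurable_funD; exact: mes_pairing.
- by move=> x _; rewrite -EFinD lee_fin -mulrDr ler_wpM2l// ler_normD.
Qed.

Lemma pairingZ g f (a : R) : weight g -> mes f ->
  pairing g (fun x => a * f x) = (`|a|%:E * pairing g f)%E.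
Proof.
move=> wg mf; rewrite /pairing -ge0_integralZl_EFin//.
- by apply: eq_integral => x _; rewrite normrM -EFinM mulrCA.
- by move=> *; exact: pairing_integrand_ge0.
- by apply: mes_pairing => //; case: wg.
Qed.

Lemma pairing_sum (I : Type) (s : seq I) (g : I -> R -> R) (c : I -> R) f :
  (forall i, 0 <= c i) -> (forall i, weight (g i)) -> mes f ->
  pairing (fun x => \sum_(i <- s) c i * g i x) f =
  (\sum_(i <- s) (c i)%:E * pairing (g i) f)%E.
Proof.
move=> c0 wg mf; have mg i : measurable_fun D (fun x => (g i x * `|f x|)%:E).
  by apply: mes_pairing => //; case: (wg i).
rewrite /pairing.
transitivity (\int[mu]_(x in D)
    (\sum_(i <- s) ((c i)%:E * (g i x * `|f x|)%:E)))%E.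
  apply: eq_integral => x _; rewrite mulr_suml -sumEFin; apply: eq_bigr => i _.
  by rewrite -EFinM mulrA.
rewrite ge0_integral_sum//; last 2 first.
- move=> i; apply: measurable_funeM; exact: mg.
- by move=> i x _; apply: mule_ge0; rewrite ?lee_fin//; exact: pairing_integrand_ge0.
apply: eq_bigr => i _; rewrite ge0_integralZl_EFin//; last exact: mg.
by move=> x _; exact: pairing_integrand_ge0.
Qed.

Lemma limn_einf_le (u : (\bar R)^nat) (c : \bar R) (k0 : nat) :
  (forall k, (k0 <= k)%N -> (u k <= c)%E) -> (limn_einf u <= c)%E.
Proof.
move=> uc; rewrite limn_einf_lim; apply: lime_le; first exact: is_cvg_einfs.
near=> k; apply: (@le_trans _ _ (u k)); last by apply: uc; near: k; exists k0.
by apply: ereal_inf_lbound; exists k => /=.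
Unshelve. all: by end_near. Qed.

Lemma limn_einf_ge (u : (\bar R)^nat) (c : \bar R) :
  (forall k, (c <= u k)%E) -> (c <= limn_einf u)%E.
Proof.
move=> uc; rewrite limn_einf_lim; apply: lime_ge; first exact: is_cvg_einfs.
by near=> k; apply: le_ereal_inf_tmp => _ [j _ <-].
Unshelve. all: by end_near. Qed.

(** The bound is only asked from [k0] on, since along a Cauchy sequence it is known only
    eventually. *)
Lemma pairing_fatou g (u : nat -> R -> R) f (c : \bar R) (k0 : nat) :
  weight g -> (forall k, mes (u k)) -> mes f ->
  {ae mu, forall x, D x -> u ^~ x @ \oo --> f x} ->
  (forall k, (k0 <= k)%N -> (pairing g (u k) <= c)%E) ->
  (pairing g f <= c)%E.
Proof.
move=> wg mu' mf uf uc; have [mg g0] := wg.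
apply: (@le_trans _ _ (\int[mu]_(x in D)
    limn_einf (fun k => (g x * `|u k x|)%:E))%E).
  apply: ae_ge0_le_integral => //; do ?[by move=> *; exact: pairing_integrand_ge0].
  - exact: mes_pairing.
  - by move=> x _; apply: limn_einf_ge => k; exact: pairing_integrand_ge0.
  - under eq_fun do rewrite /limn_einf.
    apply: measurableT_comp => //; apply: measurable_fun_limn_esup => n.
    by apply: measurableT_comp => //; exact: mes_pairing.
  move: uf; apply: filterS => x /[apply] ux.
  have /cvg_limn_einf_sup[-> _] // :
    (fun k => (g x * `|u k x|)%:E) @ \oo --> (g x * `|f x|)%:E.
  apply: cvg_EFin; first exact: nearW.
  by apply: cvgMr; exact: cvg_norm.
apply: (le_trans (fatou _ _ _ _)) => //.
- by move=> n; exact: mes_pairing.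
- by move=> n x _; exact: pairing_integrand_ge0.
- exact: (limn_einf_le uc).
Qed.

Definition gauge G f : \bar R := ereal_sup [set pairing g f | g in G].

Lemma gauge_leP G f (c : \bar R) :
  (gauge G f <= c)%E <-> forall g, G g -> (pairing g f <= c)%E.
Proof.
split=> [fc g Gg|fc]; last by apply: ge_ereal_sup => _ [g Gg <-]; exact: fc.
by apply: le_trans fc; apply: ereal_sup_ubound; exists g.
Qed.

Lemma pairing_gauge G g f : G g -> (pairing g f <= gauge G f)%E.
Proof. by move=> Gg; apply: ereal_sup_ubound; exists g. Qed.

Definition weights G := [/\ G `<=` weight & G !=set0].

Lemma gauge_ge0 G f : weights G -> (0 <= gauge G f)%E.
Proof.
by move=> [wG [g Gg]]; apply: le_trans (pairing_gauge f Gg); exact/pairing_ge0/wG.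
Qed.

Lemma gauge_le G f h : weights G -> mes f -> mes h -> ae_abs_le f h ->
  (gauge G f <= gauge G h)%E.
Proof.
move=> [wG _] mf mh fh; apply/gauge_leP => g Gg.
by apply: le_trans (pairing_gauge h Gg); apply: pairing_le => //; exact: wG.
Qed.

Lemma gaugeD G f h : weights G -> mes f -> mes h ->
  (gauge G (f \+ h)%R <= gauge G f + gauge G h)%E.
Proof.
move=> [wG _] mf mh; apply/gauge_leP => g Gg.
apply: (le_trans (pairingD _ _ _)) => //; first exact: wG.
by apply: leeD; exact: pairing_gauge.
Qed.

Lemma gaugeZ_le G f (a : R) : weights G -> mes f ->
  (gauge G (fun x => (a * f x)%R) <= `|a|%:E * gauge G f)%E.
Proof.
move=> [wG _] mf; apply/gauge_leP => g Gg.
rewrite pairingZ//; last exact: wG.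
by apply: lee_wpmul2l; [rewrite lee_fin|exact: pairing_gauge].
Qed.

Lemma gaugeZ G f (a : R) : weights G -> mes f ->
  gauge G (fun x => a * f x) = (`|a|%:E * gauge G f)%E.
Proof.
move=> wG mf; apply/eqP; rewrite eq_le gaugeZ_le//=.
have [->|a0] := eqVneq a 0; first by rewrite normr0 mul0e gauge_ge0.
(* The reverse inequality is the same bound for [a^-1], applied to [a * f]. *)
have := gaugeZ_le (a^-1) wG (mesZ a mf).
under [X in gauge G X]eq_fun do rewrite mulrA mulVf// mul1r.
move=> /(lee_wpmul2l (ltac:(rewrite lee_fin; exact: normr_ge0) : (0 <= `|a|%:E)%E)).
by rewrite muleA -EFinM -normrM divff// normr1 mul1e.
Qed.

Lemma gauge_fatou G (u : nat -> R -> R) f (c : \bar R) (k0 : nat) :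
  weights G -> (forall k, mes (u k)) -> mes f ->
  {ae mu, forall x, D x -> u ^~ x @ \oo --> f x} ->
  (forall k, (k0 <= k)%N -> (gauge G (u k) <= c)%E) ->
  (gauge G f <= c)%E.
Proof.
move=> [wG _] mu' mf uf uc; apply/gauge_leP => g Gg.
apply: (@pairing_fatou g u f c k0) => //; first exact: wG.
by move=> k /uc; apply: le_trans; exact: pairing_gauge.
Qed.

End Pairing.

#[local] Hint Extern 0 (measurable (@pos_half _)) => exact: measurable_pos_half : core.

(** * The layer cake inequality *)

Section LayerCake.
Variable R : realType.
Local Notation mu := (@lebesgue_measure R).
Local Notation D := (@pos_half R).
Implicit Types (f g h : R -> R).

(** Extension by zero, so that Tonelli can be used on the whole plane. *)
Definition zext (h : R -> R) (x : R) : R := if 0 < x then h x else 0.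

Lemma measurable_zext h : mes h -> measurable_fun setT (zext h).
Proof.
move=> mh; apply: measurable_fun_if => //=.
- by apply: measurable_fun_ltr => //; exact: measurable_cst.
- rewrite [X in measurable_fun X](_ : _ = D)//.
  by apply/seteqP; split=> [x [_]|x] /=; rewrite pos_halfE.
Qed.

Lemma zext_ge0 h x : (forall x, 0 <= h x) -> 0 <= zext h x.
Proof. by move=> h0; rewrite /zext; case: ifP. Qed.

Lemma integral_zext h :
  (\int[mu]_(x in D) (h x)%:E = \int[mu]_x (zext h x)%:E)%E.
Proof.
rewrite integral_mkcond; apply: eq_integral => x _; rewrite patchE /zext.
have -> : (x \in D) = (0 < x) by apply/idP/idP; rewrite inE pos_halfE.
by case: ifP.
Qed.

Let under_graph (h : R -> R) : set (R * R) :=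
  [set z | 0 < z.2 /\ z.2 < zext h z.1].

Let measurable_under_graph h : mes h -> measurable (under_graph h).
Proof.
move=> mh.
have m2 : measurable_fun setT (fun z : R * R => z.2) by exact: measurable_snd.
have m1 : measurable_fun setT (fun z : R * R => zext h z.1).
  by apply: (measurableT_comp (measurable_zext mh)); exact: measurable_fst.
have m0 : measurable_fun setT (fun z : R * R => 0 : R) by exact: measurable_cst.
have /(_ measurableT [set true]) := measurable_and
  (measurable_fun_ltr m0 m2) (measurable_fun_ltr m2 m1).
by rewrite setTI /=; move=> /(_ I); congr (measurable _); apply/seteqP;
  split => z /=; [case/andP|case=> -> ->].
Qed.

Let mu_under_graph2 h x : 0 <= zext h x ->
  (\int[mu]_s (\1_(under_graph h) (x, s))%:E = (zext h x)%:E)%E.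
Proof.
move=> h0; rewrite (_ : (fun s => _) = EFin \o \1_(`]0, (zext h x)[%classic)).
  rewrite integral_indic//= setIT lebesgue_measure_itv/= lte_fin.
  by case: ltgtP h0 => // [_ _|<-]//; rewrite oppr0 adde0.
apply/funext => s /=; congr (_%:E); rewrite !indicE; congr (nat_of_bool _)%:R.
by apply/idP/idP; rewrite !inE /= in_itv/= => /andP.
Qed.

Let mu_under_graph1 h s : mes h ->
  (\int[mu]_x (\1_(under_graph h) (x, s))%:E =
   if (0 < s)%R then mu (D `&` [set x | (s < h x)%R]) else 0)%E.
Proof.
move=> mh; case: ifPn => s0; last first.
  rewrite integral0_eq// => x _; rewrite indicE memNset//= => -[/=].
  by rewrite (negbTE s0).
transitivity (\int[mu]_x (\1_(D `&` [set x | (s < h x)%R]) x)%:E)%E; last first.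
  rewrite integral_indic ?setIT//.
  by apply: measurable_pos_half_lt => //; exact: measurable_cst.
apply: eq_integral => x _; rewrite !indicE; congr (nat_of_bool _)%:R%:E.
apply/idP/idP; rewrite !inE /under_graph /= /zext pos_halfE.
  case: ifPn => [x0 [_ ?] //|_ [s0' s1]].
  by have := lt_trans s0' s1; rewrite ltxx.
by move=> [-> sh].
Qed.

(** By Tonelli on the region under the graph, each integral is the integral over s > 0 of the
    measures of the superlevel sets, which are compared level by level. *)
Lemma le_integral_of_le_measure_superlevel (h k : R -> R) :
  mes h -> mes k -> (forall x, 0 <= h x) -> (forall x, 0 <= k x) ->
  (forall s, 0 < s -> (mu (D `&` [set x | (s < h x)%R])
                       <= mu (D `&` [set x | (s < k x)%R]))%E) ->
  (\int[mu]_(x in D) (h x)%:E <= \int[mu]_(x in D) (k x)%:E)%E.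
Proof.
move=> mh mk h0 k0 hk.
have layer g : mes g -> (forall x, 0 <= g x) ->
    (\int[mu]_(x in D) (g x)%:E =
     \int[mu]_s \int[mu]_x (\1_(under_graph g) (x, s))%:E)%E.
  move=> mg g0; rewrite integral_zext.
  rewrite -(@fubini_tonelli _ _ _ _ R mu mu (fun z => (\1_(under_graph g) z)%:E)).
  - apply: eq_integral => x _; rewrite mu_under_graph2//.
    exact: zext_ge0.
  - by apply/measurable_EFinP; apply: measurable_indic; exact: measurable_under_graph.
  - by move=> z; rewrite lee_fin.
rewrite !layer//; apply: ge0_le_integral => //.
- by move=> s _; apply: integral_ge0 => x _; rewrite lee_fin.
- apply: (@measurable_fun_fubini_tonelli_G _ _ _ _ R mu (fun z => (\1_(under_graph h) z)%:E)) => //.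
  - by apply/measurable_EFinP; apply: measurable_indic; exact: measurable_under_graph.
- apply: (@measurable_fun_fubini_tonelli_G _ _ _ _ R mu (fun z => (\1_(under_graph k) z)%:E)) => //.
  - by apply/measurable_EFinP; apply: measurable_indic; exact: measurable_under_graph.
- by move=> s _; rewrite !mu_under_graph1//; case: ifP => // s0; exact: hk.
Qed.

End LayerCake.

(** * The K-functional *)

Section KFunctional.
Variable R : realType.
Local Notation mu := (@lebesgue_measure R).
Local Notation D := (@pos_half R).
Implicit Types (f g h : R -> R) (G : set (R -> R)) (s t l : R).

Definition unit_weights t : set (R -> R) :=
  [set g : R -> R | [/\ mes g, forall x, 0 <= g x <= 1
             & (\int[mu]_(x in D) (g x)%:E <= t%:E)%E]].

(** Peetre's K-functional of the couple (L_1, L_oo), in dual form. *)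
Definition Kfun t f := gauge (unit_weights t) f.

Lemma weights_unit_weights t : 0 <= t -> weights (unit_weights t).
Proof.
move=> t0; split=> [g [mg g01 _]|].
  by split=> // x; case/andP: (g01 x).
exists (cst 0); split=> [|x|].
- exact: measurable_cst.
- by rewrite lexx ler01.
- by rewrite integral0 lee_fin.
Qed.

Lemma unit_weight_weight t g : unit_weights t g -> weight g.
Proof. by move=> [mg g01 _]; split=> // x; case/andP: (g01 x). Qed.

Lemma le_mu (A B : set R) : measurable A -> measurable B -> A `<=` B ->
  (mu A <= mu B)%E.
Proof. by move=> mA mB; apply: (@le_measure _ R _ mu); rewrite inE; [exact: mA|exact: mB]. Qed.

Lemma unit_weightsS s t : s <= t -> unit_weights s `<=` unit_weights t.
Proof.
by move=> st g [mg g01 gs]; split => //; apply: le_trans gs _; rewrite lee_fin.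
Qed.

Lemma Kfun_mono s t f : s <= t -> (Kfun s f <= Kfun t f)%E.
Proof.
by move=> st; apply/gauge_leP => g /(unit_weightsS st); exact: pairing_gauge.
Qed.

Lemma integral_indicD (A : set R) : measurable A ->
  (\int[mu]_(x in D) (\1_A x)%:E = mu (A `&` D))%E.
Proof. by move=> mA; rewrite integral_indic; [|exact: measurable_pos_half|exact: mA]. Qed.

Lemma unit_weight_indic (A : set R) t : measurable A -> (mu (A `&` D) <= t%:E)%E ->
  unit_weights t (\1_A).
Proof.
move=> mA At; split => [|x|]; first exact: measurable_indic.
  by rewrite indicE; case: (x \in A); rewrite ?lexx ?ler01.
by rewrite integral_indicD.
Qed.

Lemma unit_weight_scale t (c : R) g : 0 <= c <= 1 -> 0 <= t ->
  mes g -> (forall x, 0 <= g x <= 1) -> (c%:E * \int[mu]_(x in D) (g x)%:E <= t%:E)%E ->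
  unit_weights t (fun x => c * g x).
Proof.
move=> /andP[c0 c1] t0 mg g01 gt; split => [|x|]; first exact: mesZ.
  have /andP[gx0 gx1] := g01 x.
  by rewrite mulr_ge0//= mulr_ile1.
under eq_integral do rewrite EFinM.
rewrite ge0_integralZl_EFin//.
  by move=> x _; rewrite lee_fin; case/andP: (g01 x).
by apply/measurable_EFinP.
Qed.

Lemma pairing_Zweight (c : R) g f : 0 <= c -> weight g -> mes f ->
  pairing (fun x => c * g x) f = (c%:E * pairing g f)%E.
Proof.
move=> c0 wg mf; rewrite /pairing -ge0_integralZl_EFin//.
- by apply: eq_integral => x _; rewrite -EFinM mulrA.
- by move=> *; exact: pairing_integrand_ge0.
- by apply: mes_pairing => //; case: wg.
Qed.

(** Dividing a weight of mass s by 1 + s/t leaves mass at most t. Hence finiteness of K at one t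
    gives finiteness at all. *)
Lemma Kfun_scale s t f : 0 < t -> 0 <= s -> mes f ->
  (Kfun s f <= (1 + s / t)%:E * Kfun t f)%E.
Proof.
move=> t0 s0 mf; have c1 : 1 <= 1 + s / t by rewrite lerDl divr_ge0// ltW.
have c0 : 0 < 1 + s / t by apply: lt_le_trans c1.
apply/gauge_leP => g [mg g01 gs].
have wg : weight g by split=> // x; case/andP: (g01 x).
have : (pairing (fun x => ((1 + s / t)^-1 * g x)%R) f <= Kfun t f)%E.
  apply: pairing_gauge; apply: unit_weight_scale => //; last 2 first.
  - exact: ltW.
  - apply: le_trans (lee_wpmul2l _ gs) _; first by rewrite lee_fin invr_ge0 ltW.
    rewrite -EFinM lee_fin ler_pdivrMl// mulrDl mul1r divfK ?gt_eqF// lerDr ltW//.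
  - by rewrite invr_ge0 (ltW c0) invf_le1.
rewrite pairing_Zweight//; last by rewrite invr_ge0 ltW.
move=> /(@lee_wpmul2l _ (1 + s / t)%:E)/=; rewrite lee_fin => /(_ (ltW c0)).
by rewrite muleA -EFinM divff ?gt_eqF// mul1e.
Qed.

Lemma le_levelset f s t : s <= t -> levelset f t `<=` levelset f s.
Proof. by move=> st x [Dx /=]/(le_lt_trans st). Qed.

Lemma le_distrib f s t : mes f -> s <= t -> (distrib f t <= distrib f s)%E.
Proof.
move=> mf st; rewrite !distribE; apply: le_mu; [| |exact: le_levelset];
  exact: measurable_levelset.
Qed.

(** Cut A at n until its measure M is finite and at least t; the weight t/M on this piece has mass t
    and pairs with f to at least s t. *)
Lemma Kfun_infinite_set (A : set R) s t f : measurable A -> A `<=` D -> 0 <= s -> 0 < t ->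
  mes f -> mu A = +oo%E -> (forall x, A x -> s <= `|f x|) -> ((s * t)%:E <= Kfun t f)%E.
Proof.
move=> mA AD s0 t0 mf Aoo fs.
pose B (n : nat) := A `&` `]-oo, n%:R]%classic.
have mB n : measurable (B n) by apply: measurableI => //; exact: measurable_itv.
have UB : \bigcup_n B n = A.
  apply/seteqP; split=> [x [n _ []//]|x Ax].
  exists (Num.truncn `|x|).+1 => //; split => //=; rewrite in_itv/=.
  by apply: le_trans (ler_norm x) (ltW _); exact: truncnS_gt.
have : mu \o B @ \oo --> mu A.
  rewrite -UB; apply: nondecreasing_cvg_mu => //; first by rewrite UB.
  move=> m n mn; apply/subsetPset => x [Ax]; rewrite /= !in_itv/= => xm.
  by split=> //=; rewrite in_itv/= (le_trans xm)// ler_nat.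
rewrite Aoo => /cvgeyPge/(_ t)[n _ /(_ n (leqnn n))/= tB].
have Bfin : (mu (B n) < +oo)%E.
  apply: (@le_lt_trans _ _ (mu `]0, n%:R]%classic)).
    apply: le_mu => //.
    by move=> x [/AD]; rewrite pos_halfE /= !in_itv/= => -> ->.
  by rewrite lebesgue_measure_itv/=; case: ifP; rewrite ?ltry// -EFinB ltry.
have [M MB] : exists M, mu (B n) = M%:E.
  by exists (fine (mu (B n))); rewrite fineK// ge0_fin_numE.
have tM : t <= M by rewrite -lee_fin -MB.
have M0 : 0 < M by exact: lt_le_trans tM.
have BD : B n `&` D = B n by apply/setIidPl => x [/AD].
have g01 x : 0 <= (\1_(B n) x : R) <= 1.
  by rewrite indicE; case: (x \in B n); rewrite ?lexx ?ler01.
have c0 : 0 <= t / M by rewrite divr_ge0// ltW.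
have Gt : unit_weights t (fun x => t / M * \1_(B n) x).
  apply: unit_weight_scale => //.
  - by rewrite c0 ler_pdivrMr// mul1r.
  - exact: ltW.
  - by rewrite integral_indicD// BD MB -EFinM divfK// gt_eqF.
apply: le_trans (pairing_gauge f Gt).
have wB : weight (\1_(B n) : R -> R).
  by split=> [|x]; [exact: measurable_indic|case/andP: (g01 x)].
rewrite pairing_Zweight//.
have -> : s * t = t / M * (s * M).
  by rewrite mulrCA -mulrA mulVf ?gt_eqF// mulr1.
rewrite EFinM; apply: lee_wpmul2l; first by rewrite lee_fin.
rewrite EFinM -MB -{1}BD -integral_indicD// -ge0_integralZl_EFin//; last first.
  by apply/measurable_EFinP; case: wB.
apply: ge0_le_integral => //.
- by move=> x _; rewrite -EFinM lee_fin mulr_ge0.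
- by apply: measurable_funeM; apply/measurable_EFinP; case: wB.
- by apply: mes_pairing => //; case: wB.
- move=> x _; rewrite -EFinM lee_fin mulrC indicE.
  by case: (boolP (x \in B n)) => [/set_mem[Ax _]|]; rewrite ?mul1r ?mul0r ?fs.
Qed.

Lemma Kfun_le_bounded t f (c : R) : 0 <= t -> 0 <= c -> mes f ->
  (forall x, 0 < x -> `|f x| <= c) -> (\int[mu]_(x in D) `|f x|%:E <= c%:E)%E ->
  (Kfun t f <= (c * Num.min t 1)%:E)%E.
Proof.
move=> t0 c0 mf fc fi; apply/gauge_leP => g [mg g01 gt].
have g0 x : 0 <= g x by case/andP: (g01 x).
have g1 x : g x <= 1 by case/andP: (g01 x).
have H1 : (pairing g f <= (c * t)%:E)%E.
  apply: (@le_trans _ _ (\int[mu]_(x in D) (c%:E * (g x)%:E))%E).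
    apply: ge0_le_integral => //.
    - by move=> x _; rewrite lee_fin mulr_ge0.
    - exact: mes_pairing.
    - by apply: measurable_funeM; by apply/measurable_EFinP.
    - by move=> x; rewrite pos_halfE => x0; rewrite -EFinM lee_fin mulrC ler_wpM2r// fc.
  rewrite ge0_integralZl_EFin//; last 2 first.
  - by move=> x _; rewrite lee_fin.
  - by apply/measurable_EFinP.
  by rewrite EFinM lee_wpmul2l// lee_fin.
have H2 : (pairing g f <= c%:E)%E.
  apply: le_trans fi; apply: ge0_le_integral => //.
  - by move=> x _; rewrite lee_fin mulr_ge0.
  - exact: mes_pairing.
  - by apply/measurable_EFinP; exact: mes_norm.
  - by move=> x _; rewrite lee_fin ler_piMl.
by rewrite minr_pMr// EFin_min le_min H1 mulr1.
Qed.

(** The L_1 part of f when it is split at height l. *)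
Definition excess f (l : R) : \bar R :=
  (\int[mu]_(x in D) (Num.max (`|f x| - l) 0)%:E)%E.

Lemma mes_excess f l : mes f -> mes (fun x => Num.max (`|f x| - l) 0).
Proof.
move=> mf; apply: measurable_maxr; last exact: measurable_cst.
by apply: measurable_funB; [exact: mes_norm|exact: measurable_cst].
Qed.

(** Pointwise g |f| <= l g + (|f| - l)_+ because 0 <= g <= 1. By [Kfun_attained] some l gives
    equality when f has finite distribution function. *)
Lemma Kfun_le_excess t f l : 0 <= t -> 0 <= l -> mes f ->
  (Kfun t f <= (l * t)%:E + excess f l)%E.
Proof.
move=> t0 l0 mf; apply/gauge_leP => g [mg g01 gt].
have g0 x : 0 <= g x by case/andP: (g01 x).
have g1 x : g x <= 1 by case/andP: (g01 x).
apply: (@le_trans _ _ (l%:E * (\int[mu]_(x in D) (g x)%:E) + excess f l)%E).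
  rewrite -ge0_integralZl_EFin//; last 2 first.
  - by move=> x _; rewrite lee_fin.
  - by apply/measurable_EFinP.
  rewrite -ge0_integralD//; last 4 first.
  - by move=> x _; rewrite -EFinM lee_fin mulr_ge0.
  - by apply: measurable_funeM; by apply/measurable_EFinP.
  - by move=> x _; rewrite lee_fin le_max lexx orbT.
  - by apply/measurable_EFinP; exact: mes_excess.
  apply: ge0_le_integral => //.
  - by move=> x _; rewrite lee_fin mulr_ge0.
  - exact: mes_pairing.
  - apply: emeasurable_funD; first by apply: measurable_funeM; by apply/measurable_EFinP.
    by apply/measurable_EFinP; exact: mes_excess.
  - move=> x _; rewrite -EFinM -EFinD lee_fin.
    have := g0 x; have := g1 x; have := normr_ge0 (f x).
    rewrite /Num.max; case: ifPn; nra.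
apply: leeD => //; rewrite EFinM lee_wpmul2l// lee_fin.
Qed.

Lemma distrib_excess f l s : 0 <= l -> 0 < s ->
  mu (D `&` [set x | s < Num.max (`|f x| - l) 0]) = distrib f (l + s).
Proof.
move=> l0 s0; rewrite distribE; congr (mu _); apply/seteqP.
by split => x [Dx /= H]; split => //=; move: H; rewrite /Num.max; case: ifPn; lra.
Qed.

Lemma le_excess f g l : 0 <= l -> mes f -> mes g ->
  (forall s, 0 < s -> (distrib f s <= distrib g s)%E) -> (excess f l <= excess g l)%E.
Proof.
move=> l0 mf mg fg; apply: le_integral_of_le_measure_superlevel.
- exact: mes_excess.
- exact: mes_excess.
- by move=> x; rewrite le_max lexx orbT.
- by move=> x; rewrite le_max lexx orbT.
- move=> s s0; rewrite !distrib_excess//; apply: fg; lra.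
Qed.

Lemma distrib_right_continuous f l t : mes f ->
  (forall n : nat, (distrib f (l + n.+1%:R^-1) <= t%:E)%E) -> (distrib f l <= t%:E)%E.
Proof.
move=> mf ft; rewrite distribE.
have UE : \bigcup_n levelset f (l + n.+1%:R^-1) = levelset f l.
  apply/seteqP; split=> [x [n _]|x [Dx /= lx]].
    by apply: le_levelset; rewrite lerDl.
  have d0 : 0 < `|f x| - l by rewrite subr_gt0.
  have [n _ /= nl] := near_infty_natSinv_lt (PosNum d0).
  exists n => //; split => //=; rewrite -ltrBrDl; exact: (nl n (leqnn n)).
have : mu \o (fun n => levelset f (l + n.+1%:R^-1)) @ \oo --> mu (levelset f l).
  rewrite -UE; apply: nondecreasing_cvg_mu => //.
  - by move=> n; exact: measurable_levelset.
  - by rewrite UE; exact: measurable_levelset.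
  - move=> m n mn; apply/subsetPset; apply: le_levelset.
    by rewrite lerD2l lef_pV2 ?posrE// ler_nat ltnS.
move=> /cvg_lim <-//; apply: lime_le; last by apply: nearW => n /=; rewrite -distribE.
apply: ereal_nondecreasing_is_cvgn => m n mn /=.
rewrite -!distribE; apply: le_distrib => //.
by rewrite lerD2l lef_pV2 ?posrE// ler_nat ltnS.
Qed.

Lemma cvge_eventually_lt (u : (\bar R)^nat) (l c : \bar R) :
  u @ \oo --> l -> (l < c)%E -> exists N, forall n, (N <= n)%N -> (u n < c)%E.
Proof.
move=> ul lc; have : nbhs l [set y | (y < c)%E].
  by apply: open_nbhs_nbhs; split => //; exact: open_ereal_lt_ereal.
by move=> /ul[N _ H]; exists N => n /H.
Qed.

Lemma distrib_cvg0 f t : mes f -> 0 < t -> (distrib f 1 < +oo)%E ->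
  exists2 s, 0 <= s & (distrib f s <= t%:E)%E.
Proof.
move=> mf t0 f1.
have IE : \bigcap_n levelset f n.+1%:R = set0.
  apply/seteqP; split=> [x fx|//].
  have [_ /=] := fx (Num.truncn `|f x|) I.
  by rewrite ltNge (ltW (truncnS_gt _)).
have : mu \o (fun n => levelset f n.+1%:R) @ \oo --> mu set0.
  rewrite -IE; apply: nonincreasing_cvg_mu.
  - by move: f1; rewrite distribE.
  - by move=> n; exact: measurable_levelset.
  - by rewrite IE; exact: measurable0.
  - by move=> m n mn; apply/subsetPset; apply: le_levelset; rewrite ler_nat ltnS.
rewrite measure0 => H.
have t0' : (0 < t%:E)%E by rewrite lte_fin.
have [N /(_ N (leqnn N))/ltW Nt] := cvge_eventually_lt H t0'.
by exists N.+1%:R; rewrite ?distribE.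
Qed.

(* [\1_(|f| > l) + c \1_(|f| = l)] with [l] the value at [t] of the decreasing
   rearrangement of [f] attains the supremum defining [Kfun t f]. *)
Lemma Kfun_attained t f : 0 < t -> mes f ->
  (forall s, 0 < s -> (distrib f s < +oo)%E) ->
  exists g l, [/\ unit_weights t g, 0 <= l &
    ((l * t)%:E + excess f l <= pairing g f)%E].
Proof.
move=> t0 mf ffin.
pose S := [set s : R | 0 <= s /\ (distrib f s <= t%:E)%E].
have S0 : S !=set0 by have [s s0 st] := distrib_cvg0 mf t0 (ffin 1 ltr01); exists s.
have Slb : lbound S 0 by move=> s [].
have hS : has_inf S by split => //; exists 0.
pose l := inf S.
have l0 : 0 <= l by apply: lb_le_inf.
have fl : (distrib f l <= t%:E)%E.
  apply: distrib_right_continuous => // n.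
  have [s [s0 st] sl] := inf_adherent (ltac:(rewrite invr_gt0; exact: ltr0Sn) : 0 < n.+1%:R^-1) hS.
  by apply: le_trans st; apply: le_distrib => //; exact: ltW.
(* The pointwise bound behind [Kfun_le_excess] is an equality for any g that is 1 where |f| > l and
   0 where |f| < l. *)
have key (g : R -> R) : mes g -> (forall x, 0 <= g x) ->
    (forall x, D x -> l < `|f x| -> g x = 1) ->
    (forall x, D x -> `|f x| < l -> g x = 0) ->
    pairing g f = (l%:E * (\int[mu]_(x in D) (g x)%:E) + excess f l)%E.
  move=> mg g0 gA gB.
  rewrite -ge0_integralZl_EFin//; last 2 first.
  - by move=> x _; rewrite lee_fin.
  - by apply/measurable_EFinP.
  rewrite -ge0_integralD//; last 4 first.
  - by move=> x _; rewrite -EFinM lee_fin mulr_ge0.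
  - by apply: measurable_funeM; apply/measurable_EFinP.
  - by move=> x _; rewrite lee_fin le_max lexx orbT.
  - by apply/measurable_EFinP; exact: mes_excess.
  apply: eq_integral => x /set_mem Dx; rewrite -EFinM -EFinD; congr (_%:E).
  case: (ltgtP l `|f x|) => lf.
  - by rewrite gA// !mul1r mulr1 max_l ?subr_ge0 ?(ltW lf)// addrC subrK.
  - by rewrite gB// mul0r mulr0 add0r max_r// subr_le0 ltW.
  - by rewrite -lf subrr maxxx addr0 mulrC.
have mA : measurable (levelset f l) by exact: measurable_levelset.
have AD : levelset f l `&` D = levelset f l by apply/setIidPl => x [].
(* For l = 0 the set where |f| = l may have infinite measure, but then the term l t vanishes and the
   indicator of {|f| > 0} suffices. *)
have [l00|lN0] := eqVneq l 0.
  exists (\1_(levelset f l)), l; split => //.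
    by apply: unit_weight_indic => //; rewrite AD -distribE.
  rewrite key.
  - by rewrite l00 mul0r mul0e.
  - exact: measurable_indic.
  - by move=> x; rewrite indicE.
  - by move=> x Dx lf; rewrite indicE mem_set.
  - by move=> x Dx; rewrite l00 ltNge normr_ge0.
have lp : 0 < l by rewrite lt_neqAle eq_sym lN0.
pose C := D `&` [set x | l <= `|f x|].
have mC : measurable C.
  by apply: measurable_pos_half_le; [exact: measurable_cst|exact: mes_norm].
(* By minimality of l, {|f| > L n} has measure above t for every L n < l. The index n.+2 keeps L n
   positive, so these measures are finite and continuity from above applies. *)
have tC : (t%:E <= mu C)%E.
  pose L n := l - l * n.+2%:R^-1.
  have L0 n : 0 < L n.
    by rewrite subr_gt0 gtr_pMr// invf_lt1// ltr1n.
  have Ll n : L n < l by rewrite ltrBlDr ltrDl divr_gt0.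
  have IE : \bigcap_n levelset f (L n) = C.
    apply/seteqP; split=> [x fx|x [Dx /= lf] n _]; last first.
      by split => //=; exact: lt_le_trans lf.
    have [Dx _] := fx 0%N I; split => //=; rewrite leNgt; apply/negP => fl'.
    have d0 : 0 < (l - `|f x|) / l by rewrite divr_gt0// subr_gt0.
    have [n _ /= nl] := near_infty_natSinv_lt (PosNum d0).
    have [_ /=] := fx n I; apply/negP; rewrite -leNgt /L lerBrDl -lerBrDr.
    rewrite mulrC -ler_pdivlMr//; apply: ltW (nl _ (leqnSn n)).
  have : mu \o (fun n => levelset f (L n)) @ \oo --> mu C.
    rewrite -IE; apply: nonincreasing_cvg_mu.
    - by have := ffin _ (L0 0%N); rewrite distribE.
    - by move=> n; exact: measurable_levelset.
    - by rewrite IE.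
    - move=> m n mn; apply/subsetPset; apply: le_levelset.
      by rewrite lerD2l lerN2 ler_pM2l// lef_pV2 ?posrE// ler_nat !ltnS.
  move=> /cvg_lim <-//; apply: lime_ge.
    apply: ereal_nonincreasing_is_cvgn => m n mn /=.
    rewrite -!distribE; apply: le_distrib => //.
    by rewrite lerD2l lerN2 ler_pM2l// lef_pV2 ?posrE// ler_nat !ltnS.
  apply: nearW => n /=; rewrite -distribE leNgt; apply/negP => /ltW Lt.
  have : l <= L n by apply: ge_inf; [exists 0|split => //; exact: ltW].
  by rewrite leNgt Ll.
pose B := C `\` levelset f l.
have mB : measurable B by exact: measurableD.
have BD : B `&` D = B by apply/setIidPl => x [[]].
have CE : mu C = (mu (levelset f l) + mu B)%E.
  rewrite -measureU//; last by apply/seteqP; split => x // [? []].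
  congr (mu _); rewrite /B setDE setUIr setUv setIT; apply/esym/setUidr.
  by move=> x [Dx /=] /ltW.
have [a aE] : exists a, mu (levelset f l) = a%:E.
  exists (fine (mu (levelset f l))); rewrite fineK// ge0_fin_numE//.
  by rewrite -distribE ffin.
have [b bE] : exists b, mu B = b%:E.
  exists (fine (mu B)); rewrite fineK// ge0_fin_numE//.
  apply: le_lt_trans (ffin (l / 2) (ltac:(rewrite divr_gt0//))).
  rewrite distribE; apply: le_mu => //; first exact: measurable_levelset.
  move=> x [[Dx /= lf] _]; split => //=; apply: lt_le_trans lf.
  by rewrite ltr_pdivrMr// ltr_pMr// ltr1n.
have a0 : 0 <= a by rewrite -lee_fin -aE.
have b0 : 0 <= b by rewrite -lee_fin -bE.
have at' : a <= t by rewrite -lee_fin -aE -distribE.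
have tab : t <= a + b by rewrite -lee_fin EFinD -aE -bE -CE.
(* The share of {|f| = l} that brings the mass to exactly t; if that set is null then a = t already,
   and c = 0. *)
have [c [c0 c1 abt]] : exists c, [/\ 0 <= c, c <= 1 & a + c * b = t].
  have [b00|bN0] := eqVneq b 0.
    by exists 0; split => //; rewrite mul0r addr0; apply/eqP; rewrite eq_le at'; move: tab; rewrite b00 addr0.
  have bp : 0 < b by rewrite lt_neqAle eq_sym bN0.
  exists ((t - a) / b); split.
  - by rewrite divr_ge0// subr_ge0.
  - by rewrite ler_pdivrMr// mul1r lerBlDl.
  - by rewrite divfK// addrC subrK.
pose g := fun x => (\1_(levelset f l) x : R) + c * \1_B x.
have mg : mes g.
  apply: measurable_funD; first exact: measurable_indic.
  by apply: mesZ; exact: measurable_indic.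
have g0 x : 0 <= g x by rewrite /g !indicE addr_ge0// mulr_ge0.
have gi : (\int[mu]_(x in D) (g x)%:E = t%:E)%E.
  rewrite /g; under eq_integral do rewrite EFinD EFinM.
  rewrite ge0_integralD//.
  - rewrite ge0_integralZl_EFin//.
    + by rewrite !integral_indicD// AD BD aE bE -EFinM -EFinD abt.
    + by apply/measurable_EFinP; exact: measurable_indic.
  - by apply/measurable_EFinP; exact: measurable_indic.
  - by move=> x _; rewrite -EFinM lee_fin mulr_ge0.
  - by apply: measurable_funeM; apply/measurable_EFinP; exact: measurable_indic.
exists g, l; split => //.
- split => // [x|]; last by rewrite gi.
  rewrite g0 /g !indicE.
  case: (boolP (x \in B)) => [/set_mem[_ nA]|_]; first by rewrite (memNset nA) add0r mulr1.
  by rewrite mulr0 addr0 /=; case: (x \in _).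
- rewrite key//; first by rewrite gi -EFinM.
  + move=> x Dx lf; rewrite /g !indicE mem_set// memNset ?mulr0 ?addr0//.
    by move=> [_ []].
  + move=> x Dx lf; rewrite /g !indicE !memNset ?mulr0 ?addr0//.
      by move=> [[_ /=]]; rewrite leNgt lf.
    by move=> [_ /=]; rewrite ltNge (ltW lf).
Qed.

Lemma cvg_integral_dominated (v : nat -> R -> R) (h w : R -> R) :
  (forall k, mes (v k)) -> mes h -> mu.-integrable D (EFin \o w) ->
  {ae mu, forall x, D x -> v ^~ x @ \oo --> h x} ->
  (forall k, {ae mu, forall x, D x -> `|v k x| <= w x}) ->
  ((\int[mu]_(x in D) (v k x)%:E)%E @[k --> \oo] --> (\int[mu]_(x in D) (h x)%:E)%E).
Proof.
move=> mv mh iw vh vw.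
have m1 k : measurable_fun D (EFin \o v k) by apply/measurable_EFinP.
have m2 : measurable_fun D (EFin \o h) by apply/measurable_EFinP.
have c1 : {ae mu, forall x, D x -> (EFin \o v k) x @[k --> \oo] --> (EFin \o h) x}.
  move: vh; apply: filterS => x /[apply] vx.
  by apply: cvg_EFin; first exact: nearW.
have b1 : {ae mu, forall x n, D x -> (`|(EFin \o v n) x| <= (EFin \o w) x)%E}.
  have := ae_foralln vw; apply: filterS => x vx n Dx.
  by rewrite /= lee_fin vx.
by have [] := @dominated_convergence _ _ _ mu _ (@measurable_pos_half R) _ _ _ m1 m2 c1 iw b1.
Qed.

(** Both sides are compared at the level l that is optimal for g. This yields rearrangement
    invariance of K without forming rearrangements. *)
Lemma le_Kfun t f g : 0 < t -> mes f -> mes g ->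
  (forall s, 0 < s -> (distrib g s < +oo)%E) ->
  (forall s, 0 < s -> (distrib f s <= distrib g s)%E) -> (Kfun t f <= Kfun t g)%E.
Proof.
move=> t0 mf mg gfin fg.
have [h [l [th l0 hl]]] := Kfun_attained t0 mg gfin.
apply: le_trans (pairing_gauge g th); apply: le_trans hl.
apply: le_trans (Kfun_le_excess (ltW t0) l0 mf) _.
by apply: leeD => //; exact: le_excess.
Qed.

(** Split at height l = e / (2t). The bounded part costs e/2; the excess is dominated by |u 0| on
    {|u 0| > l}, which is integrable because that set has finite measure a and K(a, u 0) is
    finite. *)
Lemma Kfun_order_continuous t (u : nat -> R -> R) (e : R) : 0 < t -> 0 < e ->
  (forall k, mes (u k)) ->
  (forall s, 0 < s -> (distrib (u 0%N) s < +oo)%E) -> (Kfun t (u 0%N) < +oo)%E ->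
  (forall k, ae_abs_le (u k) (u 0%N)) ->
  {ae mu, forall x, D x -> u ^~ x @ \oo --> 0} ->
  exists k0, forall k, (k0 <= k)%N -> (Kfun t (u k) <= e%:E)%E.
Proof.
move=> t0 e0 mu' ufin Kfin ule u0.
pose l := e / 2 / t.
have l0 : 0 < l by rewrite !divr_gt0.
pose A := levelset (u 0%N) l.
have mA : measurable A by exact: measurable_levelset.
pose v k x := Num.max (`|u k x| - l) 0.
have mv k : mes (v k) by exact: mes_excess.
have v0 k x : 0 <= v k x by rewrite le_max lexx orbT.
pose w x := (\1_A x : R) * `|u 0%N x|.
have mw : mes w.
  by apply: measurable_funM; [exact: measurable_indic|exact: mes_norm].
have w0 x : 0 <= w x by rewrite mulr_ge0// indicE.
have [a aE] : exists a, distrib (u 0%N) l = a%:E.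
  exists (fine (distrib (u 0%N) l)); rewrite fineK// ge0_fin_numE//; first exact: ufin.
have a0 : 0 <= a by rewrite -lee_fin -aE.
have iw : mu.-integrable D (EFin \o w).
  apply/integrableP; split; first by apply/measurable_EFinP.
  under eq_integral do rewrite /= ger0_norm//.
  apply: (@le_lt_trans _ _ (Kfun a (u 0%N))).
    apply: (@pairing_gauge _ _ (\1_A)); apply: unit_weight_indic => //.
    by rewrite setIAC setIid -aE distribE.
  apply: le_lt_trans (Kfun_scale t0 a0 (mu' 0%N)) _.
  have K0 := gauge_ge0 (u 0%N) (weights_unit_weights (ltW t0)).
  rewrite -[Kfun t _]fineK ?ge0_fin_numE//.
  by rewrite -EFinM ltry.
have /cvge_eventually_lt :
    ((\int[mu]_(x in D) (v k x)%:E)%E @[k --> \oo] --> (\int[mu]_(x in D) (0 : R)%:E)%E).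
  apply: (cvg_integral_dominated mv _ iw); first exact: measurable_cst.
    move: u0; apply: filterS => x /[apply] ux.
    have u0x : (fun k => `|u k x|) @ \oo --> (0 : R).
      by rewrite -(normr0 R); exact: cvg_norm.
    apply: (squeeze_cvgr _ (cvg_cst 0) u0x); apply: nearW => k.
    by rewrite v0 /v ge_max normr_ge0 andbT gerBl ltW.
  move=> k; move: (ule k); apply: filterS => x + Dx => /(_ Dx) ukx.
  rewrite ger0_norm// /w indicE; case: (boolP (x \in A)) => [_|/negP xA].
    by rewrite mul1r /v ge_max normr_ge0 andbT (le_trans _ ukx)// gerBl ltW.
  rewrite mul0r /v ge_max lexx andbT subr_le0 (le_trans ukx)// leNgt.
  by apply/negP => lx; apply: xA; rewrite inE.
rewrite integral0 => /(_ (e / 2)%:E); rewrite lte_fin divr_gt0// => /(_ isT)[N HN].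
exists N => k /HN /ltW vk.
apply: le_trans (Kfun_le_excess (ltW t0) (ltW l0) (mu' k)) _.
by rewrite /l divfK ?gt_eqF// [X in (_ <= X%:E)%E](splitr e) EFinD leeD.
Qed.

End KFunctional.

(** * Mixed spaces *)

Section MixedSpace.
Variable R : realType.
Local Notation mu := (@lebesgue_measure R).
Local Notation D := (@pos_half R).
Implicit Types (f g h : R -> R) (s c e : R).

(** Cauchy-Schwarz, from the squares of (e + c) b_n - v_n; the extra e keeps the divisor positive
    when c = 0. *)
Lemma sum_mul_le M (b v : nat -> R) c : 0 <= c ->
  \sum_(n < M) b n ^+ 2 <= 1 -> \sum_(n < M) v n ^+ 2 <= c ^+ 2 ->
  \sum_(n < M) b n * v n <= c.
Proof.
move=> c0 b1 vc; apply/ler_addgt0Pl => e e0.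
have ec : 0 < e + c by rewrite ltr_pwDl.
have vc' : \sum_(n < M) v n ^+ 2 <= (e + c) ^+ 2.
  by apply: le_trans vc _; rewrite ler_sqr ?nnegrE ?(ltW ec)// lerDr ltW.
suff : \sum_(n < M) 2 * (e + c) * (b n * v n) <= (e + c) ^+ 2 + (e + c) ^+ 2.
  rewrite -mulr_sumr => H; rewrite -(ler_pM2l ec); move: H; rewrite expr2; lra.
apply: (@le_trans _ _ (\sum_(n < M) ((e + c) ^+ 2 * b n ^+ 2 + v n ^+ 2))).
  apply: ler_sum => n _; have := sqr_ge0 ((e + c) * b n - v n); nra.
rewrite big_split /= -mulr_sumr lerD//.
by rewrite ler_piMr// sqr_ge0.
Qed.

Lemma sum_pow2_sqr M : \sum_(n < M) (2^-1 ^+ n : R) ^+ 2 <= 2.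
Proof.
suff : \sum_(n < M) (2^-1 ^+ n : R) ^+ 2 <= 2 - 2 * (2^-1 ^+ M) ^+ 2.
  by move=> /le_trans; apply; rewrite gerBl mulr_ge0// sqr_ge0.
elim: M => [|M IH]; first by rewrite big_ord0 expr0 expr1n mulr1 subrr.
rewrite big_ord_recr /= [X in 2 * X ^+ 2]exprS; have := sqr_ge0 (2^-1 ^+ M : R).
move: IH; move: (\sum_(i < M) _) (2^-1 ^+ M : R) => S x; nra.
Qed.

Variables (t d : nat -> R).
Hypotheses (t_gt0 : forall n, 0 < t n) (d_gt0 : forall n, 0 < d n).

(** The l^2-norm of the sequence d_n K(t_n, f) in dual form: b ranges over the finite sequences in
    the unit ball of l^2. *)
Definition mixed_weights : set (R -> R) :=
  [set g | exists M (b : nat -> R) (w : nat -> R -> R),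
    [/\ forall n, 0 <= b n, \sum_(n < M) b n ^+ 2 <= 1,
        forall n, unit_weights (t n) (w n)
      & g = fun x => \sum_(n < M) b n * d n * w n x]].

Definition enorm f : \bar R := gauge mixed_weights f.

Definition mixed_space : set (R -> R) := [set f | mes f /\ (enorm f < +oo)%E].

Definition mixed_norm f : R := fine (enorm f).

Definition Kcoord f n : R := d n * fine (Kfun (t n) f).

Lemma unit_weights_cst0 s : 0 <= s -> unit_weights s (cst 0 : R -> R).
Proof.
move=> s0; split=> [|x|]; [exact: measurable_cst|by rewrite lexx ler01|].
by rewrite integral0 lee_fin.
Qed.

Lemma mixed_weight_weight g : mixed_weights g -> weight g.
Proof.
move=> [M [b [w [b0 _ wt ->]]]]; split=> [|x].
  by apply: measurable_sum => n; apply: mesZ; case: (wt n).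
apply: sumr_ge0 => n _; rewrite !mulr_ge0// ?(ltW (d_gt0 _))//.
by case: (wt n) => _ /(_ x) /andP[].
Qed.

Lemma weights_mixed_weights : weights mixed_weights.
Proof.
split; first exact: mixed_weight_weight.
exists (fun x => \sum_(n < 0) 0 * d n * 0), 0%N, (fun=> 0), (fun _ => cst 0).
split => //; first by rewrite big_ord0.
by move=> n; apply/unit_weights_cst0/ltW.
Qed.

Lemma pairing_mixed M (b : nat -> R) (w : nat -> R -> R) f : (forall n, 0 <= b n) ->
  (forall n, unit_weights (t n) (w n)) -> mes f ->
  pairing (fun x => \sum_(n < M) b n * d n * w n x) f =
  (\sum_(n < M) (b n * d n)%:E * pairing (w n) f)%E.
Proof.
move=> b0 wt mf; rewrite pairing_sum// => n; first by rewrite mulr_ge0// ltW.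
exact: unit_weight_weight (wt n).
Qed.

Lemma enorm_ge0 f : (0 <= enorm f)%E.
Proof. exact/gauge_ge0/weights_mixed_weights. Qed.

Lemma mixed_norm_ge0 f : 0 <= mixed_norm f.
Proof. exact/fine_ge0/enorm_ge0. Qed.

Lemma enormE f : mixed_space f -> enorm f = (mixed_norm f)%:E.
Proof. by move=> [mf fin]; rewrite fineK// ge0_fin_numE// enorm_ge0. Qed.

Lemma mixed_space_le f c : mes f -> (enorm f <= c%:E)%E -> mixed_space f /\ mixed_norm f <= c.
Proof.
move=> mf fc; have Ff : mixed_space f by split => //; exact: le_lt_trans (ltry c).
by split=> //; rewrite -lee_fin -enormE.
Qed.

Lemma Kfun_le_enorm f n : mes f -> ((d n)%:E * Kfun (t n) f <= enorm f)%E.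
Proof.
move=> mf; suff : (Kfun (t n) f <= (d n)^-1%:E * enorm f)%E.
  move=> /(@lee_wpmul2l _ (d n)%:E); rewrite lee_fin => /(_ (ltW (d_gt0 n))).
  by rewrite muleA -EFinM divff ?gt_eqF// mul1e.
apply/gauge_leP => g gt.
suff : ((d n)%:E * pairing g f <= enorm f)%E.
  move=> /(@lee_wpmul2l _ (d n)^-1%:E); rewrite lee_fin invr_ge0 => /(_ (ltW (d_gt0 n))).
  by rewrite muleA -EFinM mulVf ?gt_eqF// mul1e.
pose b (k : nat) : R := (k == n)%:R.
pose w k := if k == n then g else cst 0.
have wt k : unit_weights (t k) (w k).
  by rewrite /w; case: eqP => [->//|_]; apply/unit_weights_cst0/ltW.
have : mixed_weights (fun x => \sum_(k < n.+1) b k * d k * w k x).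
  exists n.+1, b, w; split => //.
  rewrite big_ord_recr /= /b eqxx expr1n big1 ?add0r// => k _.
  by rewrite ltn_eqF// expr0n.
move=> /pairing_gauge-/(_ f); apply: le_trans.
rewrite pairing_mixed// big_ord_recr /= /b /w eqxx mul1r.
rewrite big1 ?add0e// => k _.
by rewrite ltn_eqF// mul0r mul0e.
Qed.

Lemma Kfun_fin f n : mixed_space f -> (Kfun (t n) f < +oo)%E.
Proof.
move=> [mf fin]; have := le_lt_trans (Kfun_le_enorm n mf) fin.
have := gauge_ge0 f (weights_unit_weights (ltW (t_gt0 n))).
rewrite -/(Kfun _ _); case: (Kfun _ _) => [r _ _|_|//]; first exact: ltry.
by rewrite gt0_muley// lte_fin.
Qed.

Lemma KfunE f n : mixed_space f -> Kfun (t n) f = (Kcoord f n / d n)%:E.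
Proof.
move=> Ff; rewrite /Kcoord mulrAC divff ?gt_eqF// mul1r fineK// ge0_fin_numE ?Kfun_fin//.
exact/gauge_ge0/weights_unit_weights/ltW.
Qed.

Lemma coord_ge0 f n : 0 <= Kcoord f n.
Proof.
by rewrite mulr_ge0 ?(ltW (d_gt0 _))// fine_ge0//; apply/gauge_ge0/weights_unit_weights/ltW.
Qed.

Lemma coord_leP f n c : mixed_space f -> ((d n)%:E * Kfun (t n) f <= c%:E)%E = (Kcoord f n <= c).
Proof.
by move=> Ff; rewrite KfunE// -EFinM lee_fin mulrCA divff ?gt_eqF// mulr1.
Qed.

Lemma coord_le f h n : mixed_space f -> mixed_space h ->
  (Kfun (t n) f <= Kfun (t n) h)%E -> Kcoord f n <= Kcoord h n.
Proof.
by move=> Ff Fh; rewrite !KfunE// lee_fin ler_pM2r// invr_gt0.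
Qed.

(** Test with b proportional to the coordinates themselves and with weights w_n that almost attain
    each K(t_n, f). *)
Lemma sum_coord_sqr_le f M : mixed_space f ->
  \sum_(n < M) Kcoord f n ^+ 2 <= mixed_norm f ^+ 2.
Proof.
move=> Ff; have [mf _] := Ff.
set S := \sum_(n < M) _.
have S0 : 0 <= S by apply: sumr_ge0 => n _; exact: sqr_ge0.
have [->|SN0] := eqVneq S 0; first exact: sqr_ge0.
pose q := Num.sqrt S.
have q0 : 0 < q by rewrite sqrtr_gt0 lt_neqAle eq_sym SN0.
have qS : q ^+ 2 = S by rewrite sqr_sqrtr.
suff qN : q <= mixed_norm f by rewrite -qS ler_sqr ?nnegrE ?mixed_norm_ge0// ltW.
pose b n := Kcoord f n / q.
have b0 n : 0 <= b n by rewrite divr_ge0 ?coord_ge0 ?ltW.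
have b1 : \sum_(n < M) b n ^+ 2 <= 1.
  rewrite /b; under eq_bigr do rewrite expr_div_n.
  by rewrite -mulr_suml qS divff.
have qE : q = \sum_(n < M) b n * Kcoord f n.
  rewrite /b; under eq_bigr do rewrite mulrAC -expr2.
  by rewrite -mulr_suml -/S -qS expr2 mulfK// gt_eqF.
apply/ler_addgt0Pl => e e0.
pose B := \sum_(n < M) b n * d n.
have B0 : 0 <= B by apply: sumr_ge0 => n _; rewrite mulr_ge0// ltW.
(* The errors e' of the single weights add up to e' * B <= e. *)
pose e' := e / (1 + B).
have e'0 : 0 < e' by rewrite divr_gt0// ltr_pwDl.
have /choice[w wP] : forall n, exists g, unit_weights (t n) g /\
    ((Kcoord f n / d n - e')%:E <= pairing g f)%E.
  move=> n; apply: contrapT => /forallNP H.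
  have : (Kfun (t n) f <= (Kcoord f n / d n - e')%:E)%E.
    apply/gauge_leP => g gt; rewrite leNgt; apply/negP => /ltW ?.
    exact: (H g).
  by rewrite KfunE// lee_fin; apply/negP; rewrite -ltNge gtrBl.
have wt n : unit_weights (t n) (w n) by case: (wP n).
have : mixed_weights (fun x => \sum_(n < M) b n * d n * w n x) by exists M, b, w.
move=> /pairing_gauge-/(_ f); rewrite pairing_mixed// -/(enorm f) enormE//.
move=> H; have : (\sum_(n < M) (b n * d n)%:E * (Kcoord f n / d n - e')%:E <= (mixed_norm f)%:E)%E.
  apply: le_trans H; apply: lee_sum => n _; apply: lee_wpmul2l.
    by rewrite lee_fin mulr_ge0// ltW.
  by case: (wP n).
rewrite sumEFin lee_fin => {}H; rewrite -lerBlDl; apply: le_trans H.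
rewrite (_ : \sum_(n < M) _ = q - e' * B).
  rewrite lerD2l lerN2 /e' mulrAC ler_pdivrMr ?ltr_pwDl// ler_pM2l// lerDr ler01//.
rewrite qE /B mulr_sumr -sumrB; apply: eq_bigr => n _.
rewrite mulrBr [e' * _]mulrC; congr (_ - _).
by rewrite -mulrA; congr (_ * _); rewrite mulrCA divff ?mulr1// gt_eqF.
Qed.

(** Stated with majorants v_n, not with [Kcoord]: there [fine] would turn an infinite K(t_n, f) into
    0. *)
Lemma enorm_le_of_coord f (v : nat -> R) c : mes f -> 0 <= c ->
  (forall n, ((d n)%:E * Kfun (t n) f <= (v n)%:E)%E) ->
  (forall M, \sum_(n < M) v n ^+ 2 <= c ^+ 2) -> (enorm f <= c%:E)%E.
Proof.
move=> mf c0 kv vc; apply/gauge_leP => _ [M [b [w [b0 b1 wt ->]]]].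
rewrite pairing_mixed//; apply: (@le_trans _ _ (\sum_(n < M) b n * v n)%:E); last first.
  by rewrite lee_fin; exact: sum_mul_le.
rewrite -sumEFin; apply: lee_sum => n _; rewrite !EFinM -muleA.
apply: lee_wpmul2l; first by rewrite lee_fin.
apply: le_trans (kv n); apply: lee_wpmul2l; first by rewrite lee_fin ltW.
exact: pairing_gauge.
Qed.

Lemma mixed_norm_le_of_coord f c : mixed_space f -> 0 <= c ->
  (forall M, \sum_(n < M) Kcoord f n ^+ 2 <= c ^+ 2) -> mixed_norm f <= c.
Proof.
move=> Ff c0 fc; have [mf _] := Ff.
have := @enorm_le_of_coord f (Kcoord f) c mf c0 _ fc.
by rewrite enormE// lee_fin; apply => n; rewrite coord_leP.
Qed.

Lemma mixed_space_geometric f c : mes f -> 0 <= c ->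
  (forall n, ((d n)%:E * Kfun (t n) f <= (c * 2^-1 ^+ n)%:E)%E) ->
  mixed_space f /\ mixed_norm f <= 2 * c.
Proof.
move=> mf c0 kc; apply: mixed_space_le => //.
apply: (enorm_le_of_coord mf _ kc); first by rewrite mulr_ge0.
move=> M; under eq_bigr do rewrite exprMn.
rewrite -mulr_sumr exprMn mulrC ler_wpM2r ?sqr_ge0//.
by apply: le_trans (sum_pow2_sqr M) _; rewrite expr2 ler_peMl// ler1n.
Qed.

Lemma sum_coord_tail f e : mixed_space f -> 0 < e ->
  exists M, forall M', \sum_(M <= n < M') Kcoord f n ^+ 2 <= e.
Proof.
move=> Ff e0.
pose A := [set S | exists M, S = \sum_(n < M) Kcoord f n ^+ 2].
have sA : has_sup A.
  split; first by exists (\sum_(n < 0) Kcoord f n ^+ 2), 0%N.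
  by exists (mixed_norm f ^+ 2) => _ [M ->]; exact: sum_coord_sqr_le.
have [_ [M ->] HM] := sup_adherent e0 sA.
exists M => M'; have [MM|MM] := leqP M M'; last first.
  by rewrite big_geq ?(ltnW MM)// ltW.
have : \sum_(n < M') Kcoord f n ^+ 2 <= sup A by apply: sup_ubound; [case: sA|exists M'].
rewrite -(big_mkord xpredT (fun n => Kcoord f n ^+ 2)) (big_cat_nat (n := M))//=.
rewrite big_mkord => H; move: HM H; lra.
Qed.

Lemma coordD f h n : mixed_space f -> mixed_space h -> mixed_space (f \+ h) ->
  Kcoord (f \+ h) n <= Kcoord f n + Kcoord h n.
Proof.
move=> Ff Fh Ffh; rewrite -coord_leP// EFinD.
have [mf _] := Ff; have [mh _] := Fh.
apply: (@le_trans _ _ ((d n)%:E * (Kfun (t n) f + Kfun (t n) h))%E).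
  apply: lee_wpmul2l; first by rewrite lee_fin ltW.
  by apply: gaugeD => //; exact/weights_unit_weights/ltW.
have w0 := weights_unit_weights (ltW (t_gt0 n)).
rewrite muleDr ?fin_num_adde_defl//; last by rewrite KfunE.
by apply: leeD; rewrite coord_leP.
Qed.

Lemma coordZ f a n : mixed_space f -> mixed_space (fun x => a * f x) ->
  Kcoord (fun x => a * f x) n = `|a| * Kcoord f n.
Proof.
move=> Ff Faf; have [mf _] := Ff; rewrite /Kcoord /Kfun gaugeZ//; last first.
  exact/weights_unit_weights/ltW.
by rewrite -/(Kfun _ _) KfunE//= mulrCA.
Qed.

Lemma mixed_spaceD f h : mixed_space f -> mixed_space h ->
  mixed_space (f \+ h) /\ mixed_norm (f \+ h) <= mixed_norm f + mixed_norm h.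
Proof.
move=> Ff Fh; have [mf _] := Ff; have [mh _] := Fh.
apply: mixed_space_le; first exact: measurable_funD.
by rewrite EFinD -!enormE//; apply: gaugeD => //; exact: weights_mixed_weights.
Qed.

Lemma mixed_spaceZ f a : mixed_space f ->
  mixed_space (fun x => a * f x) /\ mixed_norm (fun x => a * f x) = `|a| * mixed_norm f.
Proof.
move=> Ff; have [mf _] := Ff.
have E : enorm (fun x => a * f x) = (`|a| * mixed_norm f)%:E.
  by rewrite EFinM -enormE// /enorm gaugeZ//; exact: weights_mixed_weights.
split; first by split; [exact: mesZ|rewrite E ltry].
by rewrite /mixed_norm E.
Qed.

Lemma mixed_spaceB f h : mixed_space f -> mixed_space h -> mixed_space (f \- h).
Proof.
move=> Ff Fh; have [Fh' _] := mixed_spaceZ (-1) Fh.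
have [+ _] := mixed_spaceD Ff Fh'; congr mixed_space.
by apply/funext => x /=; rewrite mulN1r.
Qed.

Lemma mixed_space_ae_le f h : mes f -> mixed_space h -> ae_abs_le f h ->
  mixed_space f /\ mixed_norm f <= mixed_norm h.
Proof.
move=> mf Fh fh; have [mh _] := Fh; apply: mixed_space_le => //.
by rewrite -enormE//; apply: gauge_le => //; exact: weights_mixed_weights.
Qed.

Hypothesis d_min : forall n, d n * Num.min (t n) 1 <= 2^-1 ^+ n.

(** Here d_n K(t_n, f) <= c d_n min(t_n, 1), which [d_min] makes geometrically small. *)
Lemma mixed_space_bounded f c : mes f -> 0 <= c ->
  (forall x, 0 < x -> `|f x| <= c) -> (\int[mu]_(x in D) `|f x|%:E <= c%:E)%E ->
  mixed_space f /\ mixed_norm f <= 2 * c.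
Proof.
move=> mf c0 fc fi; apply: mixed_space_geometric => // n.
apply: (le_trans (lee_wpmul2l _ (Kfun_le_bounded (ltW (t_gt0 n)) c0 mf fc fi))).
  by rewrite lee_fin ltW.
by rewrite -EFinM lee_fin mulrCA ler_wpM2l.
Qed.

Hypothesis d_inf : forall m, exists2 n, (m <= n)%N & 1 <= d n * t n.

(** If {|f| > s} had infinite measure, then K(t_n, f) >= s t_n, so infinitely many coordinates would
    be at least s, against square summability. *)
Lemma mixed_space_distrib_fin f s : mixed_space f -> 0 < s -> (distrib f s < +oo)%E.
Proof.
move=> Ff s0; have [mf _] := Ff.
rewrite ltNge leye_eq; apply/negP => /eqP foo.
have [M HM] := sum_coord_tail Ff (ltac:(rewrite divr_gt0// exprn_gt0//) : 0 < s ^+ 2 / 2).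
have [n Mn dt] := d_inf M.
have sn : s <= Kcoord f n.
  rewrite -[s]mul1r; apply: (@le_trans _ _ (d n * t n * s)); first by rewrite ler_pM2r.
  rewrite -mulrA /Kcoord ler_pM2l//  -lee_fin fineK; last first.
    by rewrite KfunE.
  rewrite mulrC; apply: (@Kfun_infinite_set _ (levelset f s)) => //.
  - exact: measurable_levelset.
  - by move=> x [].
  - exact: ltW.
  - by rewrite -distribE.
  - by move=> x [_ /ltW].
have := HM n.+1; rewrite big_nat_recr//= => H.
have T0 : 0 <= \sum_(M <= i < n) Kcoord f i ^+ 2 by apply: sumr_ge0 => i _; exact: sqr_ge0.
have : s ^+ 2 <= Kcoord f n ^+ 2 by rewrite ler_sqr ?nnegrE ?coord_ge0// ltW.
have : 0 < s ^+ 2 by rewrite exprn_gt0.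
move: H T0; lra.
Qed.

(** The coordinates of u k are below those of u 0, so one index M controls all the tails; the
    finitely many others go to 0 by [Kfun_order_continuous]. *)
Lemma mixed_norm_order_continuous (u : nat -> R -> R) e : 0 < e ->
  (forall k, mes (u k)) -> mixed_space (u 0%N) ->
  (forall k, ae_abs_le (u k) (u 0%N)) ->
  {ae mu, forall x, D x -> u ^~ x @ \oo --> 0} ->
  exists k0, forall k, (k0 <= k)%N -> mixed_norm (u k) <= e.
Proof.
move=> e0 mu' Fu0 ule u0.
have Fu k : mixed_space (u k) by have [] := mixed_space_ae_le (mu' k) Fu0 (ule k).
have [M HM] := sum_coord_tail Fu0 (ltac:(rewrite divr_gt0// exprn_gt0//) : 0 < e ^+ 2 / 2).
(* M coordinates of size e' have squares summing to at most e^2 / 4; M.+1 covers M = 0. *)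
pose e' := e / 2 / M.+1%:R.
have e'0 : 0 < e' by rewrite !divr_gt0.
have /choice[K HK] : forall n, exists k0, forall k, (k0 <= k)%N -> Kcoord (u k) n <= e'.
  move=> n.
  have e'd : 0 < e' / d n by rewrite divr_gt0.
  have [||k0 Hk] := Kfun_order_continuous (t_gt0 n) e'd mu' _ _ ule u0.
  - by move=> s; exact: mixed_space_distrib_fin.
  - exact: Kfun_fin.
  exists k0 => k /Hk; rewrite KfunE// lee_fin ler_pM2r// invr_gt0//.
exists (\max_(n < M) K n)%N => k kK.
apply: mixed_norm_le_of_coord => //; first exact: ltW.
move=> M'.
have ck n : Kcoord (u k) n <= Kcoord (u 0%N) n.
  apply: coord_le => //; apply: gauge_le => //.
  exact/weights_unit_weights/ltW.
have head : \sum_(n < M) Kcoord (u k) n ^+ 2 <= e ^+ 2 / 2.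
  apply: (@le_trans _ _ (\sum_(n < M) e' ^+ 2)).
    apply: ler_sum => n _; rewrite ler_sqr ?nnegrE ?coord_ge0 ?(ltW e'0)//.
    by apply: HK; apply: leq_trans kK; exact: leq_bigmax.
  rewrite sumr_const card_ord -[_ *+ M]mulr_natr /e' expr_div_n -mulrA.
  have M1 : (M.+1%:R : R) ^- 2 * M%:R <= 1.
    rewrite mulrC ler_pdivrMr ?exprn_gt0// mul1r -natrX ler_nat.
    by rewrite (leq_trans (leqnSn M))// leq_pmulr.
  rewrite expr_div_n -mulrA ler_pM2l ?exprn_gt0//.
  have : 0 <= (M.+1%:R : R) ^- 2 * M%:R by rewrite mulr_ge0// invr_ge0 exprn_ge0.
  move: M1; set z := _ * M%:R; nra.
have [MM|/ltnW MM] := leqP M M'; last first.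
  apply: (@le_trans _ _ (\sum_(n < M) Kcoord (u k) n ^+ 2)).
    rewrite -!(big_mkord xpredT (fun n => Kcoord (u k) n ^+ 2)).
    rewrite [leRHS](big_cat_nat (n := M'))//= lerDl.
    by apply: sumr_ge0 => n _; exact: sqr_ge0.
  by apply: le_trans head _; rewrite ler_pdivrMr// ler_peMr ?sqr_ge0// ler1n.
rewrite -(big_mkord xpredT (fun n => Kcoord (u k) n ^+ 2)) (big_cat_nat (n := M))//=.
rewrite big_mkord [leRHS](splitr (e ^+ 2)) lerD//.
apply: le_trans (HM M'); apply: ler_sum => n _.
by rewrite ler_sqr ?nnegrE ?coord_ge0.
Qed.

End MixedSpace.

(** * Almost everywhere statements *)

Section AlmostEverywhere.
Variable R : realType.
Local Notation mu := (@lebesgue_measure R).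
Local Notation D := (@pos_half R).
Implicit Types (f g h : R -> R) (s c e t : R).

Lemma ae_of_null (A : set R) (P : R -> Prop) : measurable A -> mu A = 0%E ->
  (forall x, D x -> ~ A x -> P x) -> {ae mu, forall x, D x -> P x}.
Proof.
move=> mA A0 AP; exists A; split => // x /= nP; apply: contrapT => nA.
by apply: nP => Dx; exact: AP.
Qed.

Lemma null_of_ae (A : set R) : measurable A -> {ae mu, forall x, ~ A x} -> mu A = 0%E.
Proof.
move=> mA [B [mB B0 AB]]; apply/eqP; rewrite eq_le measure_ge0 andbT -B0.
by apply: le_mu => // x Ax; apply: AB => /=; exact.
Qed.

Lemma measurable_ae_le f g : mes f -> mes g -> measurable [set x : R | 0 < x /\ g x < f x].
Proof.
move=> mf mg; have := measurable_pos_half_lt mg mf; congr measurable.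
by apply/seteqP; split => x; rewrite /= ?pos_halfE.
Qed.

Lemma ae_leP f g : mes f -> mes g ->
  ae_le f g <-> {ae mu, forall x, D x -> f x <= g x}.
Proof.
move=> mf mg; have mA := measurable_ae_le mf mg; split => [fg|fg].
  apply: (ae_of_null mA fg) => x Dx nA; rewrite leNgt; apply/negP => gf.
  by apply: nA; rewrite /= -pos_halfE.
apply: null_of_ae => //; move: fg; apply: filterS => x fg [x0].
by apply/negP; rewrite -leNgt fg// pos_halfE.
Qed.

Lemma ae_zeroE f : ae_zero f = (distrib f 0 = 0%E).
Proof.
rewrite /ae_zero /distrib; congr (mu _ = _); apply/seteqP.
by split => x /= [? fx]; split => //; rewrite normr_gt0 in fx *.
Qed.

Lemma ae_zeroP f : mes f -> ae_zero f <-> {ae mu, forall x, D x -> f x = 0}.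
Proof.
move=> mf; have mA := measurable_levelset 0 mf; rewrite ae_zeroE distribE.
split => [f0|f0].
  apply: (ae_of_null mA f0) => x Dx nA; apply/eqP; rewrite -normr_le0 leNgt.
  by apply/negP => fx; apply: nA.
apply: null_of_ae => //; move: f0; apply: filterS => x fx [Dx /=].
by rewrite fx// normr0 ltxx.
Qed.

(** Take r strictly between the two values if they are in the wrong order: then the rearrangement of
    h at r is at most s, while by right continuity that of f exceeds s. *)
Lemma rearr_le_distrib f h s : mes f -> mes h -> 0 <= s -> rearr_le f h ->
  (distrib f s <= distrib h s)%E.
Proof.
move=> mf mh s0 fh; rewrite leNgt; apply/negP => hf.
have h0 : (0 <= distrib h s)%E by rewrite distribE; exact: measure_ge0.
have [r [r0 hr rf]] : exists r, [/\ 0 < r, (distrib h s <= r%:E)%E & (r%:E < distrib f s)%E].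
  move: h0 hf; case: (distrib h s) => [x||//]; last by move=> _; rewrite ltNge leey.
  rewrite lee_fin => x0; case: (distrib f s) => [y||//].
    rewrite lte_fin => xy; exists ((x + y) / 2); split.
    - lra.
    - rewrite lee_fin; lra.
    - rewrite lte_fin; lra.
  by move=> _; exists (x + 1); rewrite lee_fin ltry; split => //; lra.
have hs : (rearr h r <= s%:E)%E by apply: ereal_inf_lbound; exists s.
suff : (s%:E < rearr f r)%E by apply/negP; rewrite -leNgt (le_trans (fh r r0)).
have [n rn] : exists n : nat, (r%:E < distrib f (s + n.+1%:R^-1))%E.
  apply: contrapT => /forallNP H.
  have : (distrib f s <= r%:E)%E.
    by apply: distrib_right_continuous => // n; rewrite leNgt; apply/negP; exact: H.
  by rewrite leNgt rf.
apply: (@lt_le_trans _ _ (s + n.+1%:R^-1)%:E); first by rewrite lte_fin ltrDl.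
apply: le_ereal_inf_tmp => _ [s' [s'0 fs'] <-]; rewrite lee_fin leNgt; apply/negP => ss.
have := le_trans (le_distrib mf (ltW ss)) fs'.
by rewrite leNgt rn.
Qed.

Lemma distrib_rearr_le f h :
  (forall s, 0 <= s -> (distrib f s <= distrib h s)%E) -> rearr_le f h.
Proof.
move=> fh t t0; apply: ereal_inf_le_tmp => _ [s [s0 hs] <-].
by exists s => //; split => //; apply: le_trans hs; exact: fh.
Qed.

(** A strictly positive integrable weight, at most 1 on (0, oo): pairing with it turns almost
    everywhere comparisons into comparisons of real numbers. *)
Definition exp_weight (x : R) : R := expR (- x).

Lemma exp_weight_gt0 x : 0 < exp_weight x.
Proof. exact: expR_gt0. Qed.

Lemma mes_exp_weight : mes exp_weight.
Proof.
by apply: measurableT_comp => //; apply: measurable_funN; exact: measurable_id.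
Qed.

Lemma exp_weight_le1 x : 0 < x -> exp_weight x <= 1.
Proof. by move=> x0; rewrite -expR0 ler_expR oppr_le0 ltW. Qed.

Lemma integral_exp_weight : (\int[mu]_(x in D) (exp_weight x)%:E <= 1)%E.
Proof.
have := @integral_exponential_pdf R 1 ltr01; move=> <-.
rewrite integral_mkcond; apply: ge0_le_integral => //.
- by move=> x _; rewrite patchE; case: ifP => // _; rewrite lee_fin expR_ge0.
- apply/(measurable_restrictT _ _).1 => //; apply/measurable_EFinP; exact: mes_exp_weight.
- by apply/measurable_EFinP; exact: measurable_exponential_pdf.
- move=> x _; rewrite patchE; case: ifPn => [/set_mem|_]; last first.
    by rewrite lee_fin exponential_pdf_ge0.
  rewrite pos_halfE => x0; rewrite (@exponential_pdfE R 1 x (ltW x0)).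
  by rewrite mul1r mulN1r.
Qed.

(** The weighted increments have an integrable sum, so it is finite almost everywhere; at such
    points the telescoping series converges absolutely. *)
Lemma ae_cvg_of_summable (a : nat -> R -> R) : (forall k, mes (a k)) ->
  (\sum_(k <oo) pairing exp_weight (a k.+1 \- a k)%R < +oo)%E ->
  exists2 f : R -> R, mes f & {ae mu, forall x, D x -> a ^~ x @ \oo --> f x}.
Proof.
move=> ma afin.
have wE : weight exp_weight by split => [|x]; [exact: mes_exp_weight|exact: expR_ge0].
pose v k x : \bar R := (exp_weight x * `|a k.+1 x - a k x|)%:E.
have mv k : measurable_fun D (v k).
  by apply: mes_pairing; [exact: mes_exp_weight|exact: measurable_funB].
have v0 k x : (0 <= v k x)%E by exact: (pairing_integrand_ge0 (a k.+1 \- a k) x wE).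
pose V x := (\sum_(k <oo) v k x)%E.
have mV : measurable_fun D V.
  by apply: ge0_emeasurable_sum => // k x _ _; exact: v0.
have V0 x : (0 <= V x)%E by apply: nneseries_ge0 => k _ _; exact: v0.
have iV : mu.-integrable D V.
  apply/integrableP; split => //.
  under eq_integral do rewrite gee0_abs//.
  by rewrite /V integral_nneseries// => k x _; exact: v0.
pose G := D `&` [set x | (V x < +oo)%E].
have mG : measurable G by exact: emeasurable_fun_infty_o.
have aeG : {ae mu, forall x, D x -> G x}.
  have := @integrable_ae _ _ _ mu _ (@measurable_pos_half R) _ iV; apply: filterS => x Vx Dx.
  by split => //=; rewrite ltey_eq Vx.
(* Cut to 0 off the good set, so that [b] converges at every point of (0, oo) and its limit is
   measurable. *)
pose b k x := a k x * \1_G x.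
have mb k : mes (b k) by apply: measurable_funM => //; exact: measurable_indic.
have cb x : D x -> cvgn (b ^~ x).
  move=> Dx; rewrite /b indicE; case: (boolP (x \in G)) => [/set_mem[_ /= Vx]|_]; last first.
    by under eq_fun do rewrite mulr0; exact: is_cvg_cst.
  under eq_fun do rewrite mulr1.
  suff H : cvgn (series (fun k => a k.+1 x - a k x)).
    have : cvgn (fun k => a 0%N x + series (fun k => a k.+1 x - a k x) k).
      by apply: is_cvgD => //; exact: is_cvg_cst.
    by congr (cvgn _); apply/funext => k; rewrite /series /= telescope_sumr// addrC subrK.
  apply: normed_cvg; rewrite /normed_series_of /=.
  have Ex := exp_weight_gt0 x.
  apply: (@nondecreasing_is_cvgn _ _).
    by apply/nondecreasing_seqP => k; rewrite /series /= big_nat_recr//= lerDl.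
  exists (fine (V x) / exp_weight x) => _ [k _ <-].
  rewrite ler_pdivlMr// -lee_fin fineK ?ge0_fin_numE//.
  rewrite /series /= mulr_suml -sumEFin.
  apply: le_trans (nneseries_lim_ge k _); last by move=> i _ _; exact: v0.
  by apply: lee_sum => i _; rewrite mulrC.
exists (fun x => limn (b ^~ x)).
  exact: (measurable_fun_cvg mb).
move: aeG; apply: filterS => x Gx Dx.
have -> : a ^~ x = b ^~ x.
  by apply/funext => k; rewrite /b indicE mem_set ?mulr1//; exact: Gx.
exact: cb.
Qed.

Lemma weight_exp_weight : weight exp_weight.
Proof. by split => [|x]; [exact: mes_exp_weight|exact: expR_ge0]. Qed.

Definition exp_mean f : R := fine (\int[mu]_(x in D) (exp_weight x * f x)%:E)%E.

Lemma integrable_exp_weight f : mes f -> (pairing exp_weight f < +oo)%E ->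
  mu.-integrable D (fun x => (exp_weight x * f x)%:E).
Proof.
move=> mf fin; apply/integrableP; split.
  by apply/measurable_EFinP; apply: measurable_funM => //; exact: mes_exp_weight.
apply: le_lt_trans fin; rewrite /pairing; apply: ge0_le_integral => //.
- apply: measurableT_comp => //; apply/measurable_EFinP.
  by apply: measurable_funM => //; exact: mes_exp_weight.
- by apply: mes_pairing => //; exact: mes_exp_weight.
- by move=> x _; rewrite /= normrM lee_fin ger0_norm// expR_ge0.
Qed.

Lemma exp_mean_le f : mes f -> (pairing exp_weight f < +oo)%E ->
  ((exp_mean f)%:E <= pairing exp_weight f)%E.
Proof.
move=> mf fin; have iwf := integrable_exp_weight mf fin.
rewrite /exp_mean fineK; last exact: integrable_fin_num.
apply: le_integral => //; last first.
  by move=> x _; rewrite lee_fin ler_wpM2l ?expR_ge0// ler_norm.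
have /integrable_exp_weight : mes (fun x => `|f x|) by exact: mes_norm.
apply; apply: le_lt_trans fin; rewrite /pairing.
by under eq_integral do rewrite normr_id.
Qed.

Lemma pairing_exp_weightB f h : mes f -> mes h ->
  (pairing exp_weight f < +oo)%E -> (pairing exp_weight h < +oo)%E ->
  {ae mu, forall x, D x -> f x <= h x} ->
  pairing exp_weight (h \- f) = (exp_mean h - exp_mean f)%:E.
Proof.
move=> mf mh ff fh fleh.
have iwf := integrable_exp_weight mf ff; have iwh := integrable_exp_weight mh fh.
rewrite /exp_mean EFinB !fineK; do ?exact: integrable_fin_num.
rewrite -integralB_EFin//.
have mw := mes_exp_weight; rewrite /pairing.
have mhf : measurable_fun D (fun x => exp_weight x * h x - exp_weight x * f x).
  by apply: measurable_funB; apply: measurable_funM.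
apply: ae_eq_integral => //.
- by apply: mes_pairing => //; exact: measurable_funB.
- by apply/measurable_EFinP.
- move: fleh; apply: filterS => x /[apply] fh'.
  by rewrite /= ger0_norm ?subr_ge0// mulrBr EFinB.
Qed.

Lemma exp_mean_ae_le f h : mes f -> mes h ->
  (pairing exp_weight f < +oo)%E -> (pairing exp_weight h < +oo)%E ->
  {ae mu, forall x, D x -> f x <= h x} -> exp_mean f <= exp_mean h.
Proof.
move=> mf mh ff fh fleh; rewrite -subr_ge0 -lee_fin -pairing_exp_weightB//.
exact/pairing_ge0/weight_exp_weight.
Qed.

Lemma ae_le_of_pairing f h : mes f -> mes h ->
  pairing exp_weight (fun x => Num.max (f x - h x) 0) = 0%E ->
  {ae mu, forall x, D x -> f x <= h x}.
Proof.
move=> mf mh; rewrite /pairing => p0.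
have mm : mes (fun x => Num.max (f x - h x) 0).
  by apply: measurable_maxr; [exact: measurable_funB|exact: measurable_cst].
have mp := mes_pairing mes_exp_weight mm.
have /(ae_eq_integral_abs mu (@measurable_pos_half R) mp).1 :
    (\int[mu]_(x in D) `|(exp_weight x * `|Num.max (f x - h x) 0|)%:E| = 0)%E.
  rewrite -[RHS]p0; apply: eq_integral => x _.
  by rewrite gee0_abs// lee_fin mulr_ge0// expR_ge0.
apply: filterS => x /[apply] /= -[] /eqP.
rewrite mulf_eq0 (gt_eqF (exp_weight_gt0 x))/= normr_eq0 => /eqP fhx.
by rewrite -subr_le0 -[leRHS]fhx le_max lexx.
Qed.

Lemma ae_nondecreasing (u : nat -> R -> R) :
  (forall k, {ae mu, forall x, D x -> u k x <= u k.+1 x}) ->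
  {ae mu, forall x, D x -> nondecreasing_seq (u ^~ x)}.
Proof.
move=> uk; have := ae_foralln uk; apply: filterS => x ux Dx.
by apply/nondecreasing_seqP => k; exact: ux.
Qed.

(* An upward directed family with bounded means has a countable cofinal increasing
   sequence: pick one along which the means approach their supremum. *)
Lemma directed_sup (X : set (R -> R)) c : X !=set0 ->
  (forall g, X g -> mes g) -> (forall g, X g -> (pairing exp_weight g < +oo)%E) ->
  (forall g h, X g -> X h -> exists k, X k /\ ae_le g k /\ ae_le h k) ->
  (forall g, X g -> exp_mean g <= c) ->
  exists (u : nat -> R -> R) (f : R -> R), [/\ forall k, X (u k), mes f,
    {ae mu, forall x, D x -> nondecreasing_seq (u ^~ x)},
    {ae mu, forall x, D x -> u ^~ x @ \oo --> f x}
    & forall g, X g -> {ae mu, forall x, D x -> g x <= f x}].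
Proof.
move=> [g0 Xg0] mX fX dX cX.
pose J := [set exp_mean g | g in X].
have supJ : has_sup J.
  by split; [exists (exp_mean g0), g0|exists c => _ [g Xg <-]; exact: cX].
have /choice[a aP] : forall n : nat, exists g, X g /\ sup J - n.+1%:R^-1 < exp_mean g.
  move=> n; have n0 : 0 < n.+1%:R^-1 :> R by rewrite invr_gt0.
  by have [_ [g Xg <-] H] := sup_adherent n0 supJ; exists g.
have /choice[j jP] : forall gh : (R -> R) * (R -> R), exists k, X gh.1 -> X gh.2 ->
    [/\ X k, ae_le gh.1 k & ae_le gh.2 k].
  move=> [g h] /=; have [Xg|nX] := pselect (X g); last by exists g.
  have [Xh|nX] := pselect (X h); last by exists g.
  by have [k [? [? ?]]] := dX _ _ Xg Xh; exists k.
(* [u n.+1] dominates both [u n] and the near-maximiser [a n.+1]: the sequence increases and its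
   means tend to the supremum. *)
pose u := fix u n := if n is n'.+1 then j (u n', a n) else a 0%N.
have Xu n : X (u n).
  elim: n => [|n IH /=]; first by case: (aP 0%N).
  by have [] := jP (u n, a n.+1) IH (aP n.+1).1.
have leJ g h : X g -> X h -> {ae mu, forall x, D x -> g x <= h x} -> exp_mean g <= exp_mean h.
  by move=> Xg Xh; apply: exp_mean_ae_le; [exact: mX|exact: mX|exact: fX|exact: fX].
have Jsup g : X g -> exp_mean g <= sup J.
  by move=> Xg; apply: sup_ubound; [case: supJ|exists g].
have uS n : {ae mu, forall x, D x -> u n x <= u n.+1 x}.
  by apply/ae_leP; [exact: mX|exact: mX|]; have [] := jP (u n, a n.+1) (Xu n) (aP n.+1).1.
have Ju n : sup J - n.+1%:R^-1 < exp_mean (u n).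
  apply: (lt_le_trans (aP n).2); case: n => [//|n]; apply: leJ => //; first by case: (aP n.+1).
  apply/ae_leP; [by apply: mX; case: (aP n.+1)|exact: mX|].
  by have [] := jP (u n, a n.+1) (Xu n) (aP n.+1).1.
have und := ae_nondecreasing uS.
have [f mf uf] : exists2 f : R -> R, mes f & {ae mu, forall x, D x -> u ^~ x @ \oo --> f x}.
  apply: ae_cvg_of_summable => [k|]; first exact: mX.
  apply: (@le_lt_trans _ _ (c - exp_mean (u 0%N))%:E); last exact: ltry.
  apply: lime_le.
    by apply: is_cvg_nneseries => k _ _; exact/pairing_ge0/weight_exp_weight.
  apply: nearW => n.
  have step k : pairing exp_weight (u k.+1 \- u k) =
      (exp_mean (u k.+1) - exp_mean (u k))%:E.
    by apply: pairing_exp_weightB; [exact: mX|exact: mX|exact: fX|exact: fX|exact: uS].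
  rewrite (eq_bigr _ (fun k _ => step k)).
  by rewrite sumEFin telescope_sumr// lee_fin lerD2r cX.
exists u, f; split => // g Xg.
have ulef n : {ae mu, forall x, D x -> u n x <= f x}.
  move: und uf; apply: filterS2 => x + + Dx => /(_ Dx) ndu /(_ Dx) cu.
  by rewrite -(cvg_lim _ cu)//; apply: nondecreasing_cvgn_le => //; apply/cvg_ex; exists (f x).
have mm (h : R -> R) : mes h -> mes (fun x => Num.max (g x - h x) 0).
  move=> mh; apply: measurable_maxr; last exact: measurable_cst.
  by apply: measurable_funB => //; exact: mX.
(* A common upper bound v of g and u n has mean within 1/(n+1) of that of u n, and (g - f)_+ <= v -
   u n. *)
have p0 : pairing exp_weight (fun x => Num.max (g x - f x) 0) = 0%E.
  apply/eqP; rewrite eq_le (pairing_ge0 _ weight_exp_weight) andbT.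
  apply/lee_addgt0Pr => e e0; rewrite add0e.
  have [n _ /= ne] := near_infty_natSinv_lt (PosNum e0).
  have {}ne := ne n (leqnn n).
  have [Xv gv uv] := jP (g, u n) Xg (Xu n).
  set v := j _ in Xv gv uv.
  have := pairing_exp_weightB (mX _ (Xu n)) (mX _ Xv) (fX _ (Xu n)) (fX _ Xv)
    ((ae_leP (mX _ (Xu n)) (mX _ Xv)).1 uv).
  move=> E; apply: (@le_trans _ _ (pairing exp_weight (v \- u n))); last first.
    rewrite E lee_fin; apply: (le_trans _ (ltW ne)); rewrite lerBlDl.
    by apply: (le_trans (Jsup _ Xv)); rewrite -lerBlDr; exact: ltW (Ju n).
  apply: pairing_le => //; first exact: weight_exp_weight.
  - exact: mm.
  - by apply: measurable_funB; exact: mX.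
  - have gv' := (ae_leP (mX _ Xg) (mX _ Xv)).1 gv.
    have uv' := (ae_leP (mX _ (Xu n)) (mX _ Xv)).1 uv.
    move: gv' uv' (ulef n); apply: filterS3 => x + + + Dx.
    move=> /(_ Dx) H1 /(_ Dx) H2 /(_ Dx) H3 /=.
    rewrite (ger0_norm (_ : 0 <= Num.max _ _)) ?le_max ?lexx ?orbT//.
    rewrite ger0_norm ?subr_ge0// ge_max subr_ge0 H2 andbT; lra.
by apply: ae_le_of_pairing => //; exact: mX.
Qed.

End AlmostEverywhere.

Arguments exp_weight {R} x.

(** * Mixed spaces are KB-spaces *)

Section MixedKB.
Variable R : realType.
Local Notation mu := (@lebesgue_measure R).
Local Notation D := (@pos_half R).
Implicit Types (f g h : R -> R) (s c e : R).
Variables (t d : nat -> R).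
Hypotheses (t_gt0 : forall n, 0 < t n) (d_gt0 : forall n, 0 < d n).
Hypothesis d_min : forall n, d n * Num.min (t n) 1 <= 2^-1 ^+ n.
Hypothesis d_inf : forall m, exists2 n, (m <= n)%N & 1 <= d n * t n.
Local Notation F := (mixed_space t d).
Local Notation NF := (mixed_norm t d).

Let m0 : measurable_fun D (fun _ : R => 0 : R).
Proof. exact: measurable_cst. Qed.

(** Embedding constant of F into weighted L_1, from K(1, f) <= (1 + 1/t_0) K(t_0, f) and d_0 K(t_0,
    f) <= |f|_F. *)
Definition exp_const : R := (1 + 1 / t 0%N) / d 0%N.

Lemma exp_const_gt0 : 0 < exp_const.
Proof. by rewrite divr_gt0// ltr_pwDl// divr_ge0// ltW. Qed.

Lemma Kfun_le_norm s f : 0 <= s -> F f ->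
  (Kfun s f <= ((1 + s / t 0%N) / d 0%N * NF f)%:E)%E.
Proof.
move=> s0 Ff; have [mf _] := Ff.
apply: le_trans (Kfun_scale (t_gt0 0%N) s0 mf) _.
rewrite (KfunE t_gt0 d_gt0)// -EFinM lee_fin -[_ / d 0%N * NF f]mulrA ler_pM2l; last first.
  by rewrite ltr_pwDl// divr_ge0// ltW.
rewrite mulrC ler_pM2l ?invr_gt0// -lee_fin.
by rewrite -(enormE t_gt0 d_gt0)//; apply: le_trans (Kfun_le_enorm t_gt0 d_gt0 0%N mf); rewrite (KfunE t_gt0 d_gt0)// -EFinM mulrCA divff ?mulr1// gt_eqF.
Qed.

Lemma pairing_exp_weight_le f : F f -> (pairing exp_weight f <= (exp_const * NF f)%:E)%E.
Proof.
move=> Ff; apply: le_trans (Kfun_le_norm ler01 Ff).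
have [mf _] := Ff.
(* The minimum with 1 is for x < 0, where [exp_weight] exceeds 1; unit weights are bounded on the
   whole line. *)
have wt : unit_weights 1 (fun x : R => Num.min (exp_weight x) 1).
  split => [|x|].
  - by apply: measurable_minr; [exact: mes_exp_weight|exact: measurable_cst].
  - by rewrite le_min expR_ge0 ler01 ge_min lexx orbT.
  - apply: le_trans (integral_exp_weight R); apply: ge0_le_integral => //.
    + by move=> x _; rewrite lee_fin le_min expR_ge0 ler01.
    + apply/measurable_EFinP.
      by apply: measurable_minr; [exact: mes_exp_weight|exact: measurable_cst].
    + by apply/measurable_EFinP; exact: mes_exp_weight.
    + by move=> x _; rewrite lee_fin ge_min lexx.
apply: le_trans (pairing_gauge f wt); rewrite le_eqVlt; apply/orP; left; apply/eqP.
apply: eq_integral => x /set_mem; rewrite pos_halfE => x0.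
by rewrite min_l// exp_weight_le1.
Qed.

Lemma pairing_exp_weight_fin f : F f -> (pairing exp_weight f < +oo)%E.
Proof. by move=> Ff; apply: le_lt_trans (pairing_exp_weight_le Ff) _; exact: ltry. Qed.

Lemma mixed_distrib_le f h : mes f -> F h ->
  (forall s, 0 < s -> (distrib f s <= distrib h s)%E) -> F f /\ NF f <= NF h.
Proof.
move=> mf Fh fh; have [mh _] := Fh.
apply: (mixed_space_le t_gt0 d_gt0 mf).
have N0 := mixed_norm_ge0 t_gt0 d_gt0 h.
refine (@enorm_le_of_coord R t d d_gt0 f (Kcoord t d h) (NF h) mf N0 _ _).
- move=> n; apply: (@le_trans _ _ ((d n)%:E * Kfun (t n) h)%E); last by rewrite coord_leP.
  apply: lee_wpmul2l; first by rewrite lee_fin ltW.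
  apply: le_Kfun => // s; exact: (mixed_space_distrib_fin t_gt0 d_gt0 d_inf).
- by move=> M; exact: sum_coord_sqr_le.
Qed.

Lemma mixed_space0 : F (fun=> 0).
Proof.
apply: (mixed_space_bounded t_gt0 d_gt0 d_min (c := 0) _ _ _ _).1 => //.
- by move=> x _; rewrite normr0.
- by under eq_integral do rewrite normr0; rewrite integral0.
Qed.

Lemma mixed_norm_zero f : F f -> NF f = 0 <-> ae_zero f.
Proof.
move=> Ff; have [mf _] := Ff; rewrite ae_zeroP//; split => [f0|f0]; last first.
  have [F0 N0] : F (cst 0) /\ NF (cst 0) <= 2 * 0.
    apply: (mixed_space_bounded t_gt0 d_gt0 d_min) => //.
      by move=> x _; rewrite normr0.
    by under eq_integral do rewrite normr0; rewrite integral0.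
  apply/eqP; rewrite eq_le (mixed_norm_ge0 t_gt0 d_gt0) andbT.
  rewrite mulr0 in N0; apply: le_trans N0.
  have [] // := mixed_space_ae_le t_gt0 d_gt0 mf F0.
  by move: f0; apply: filterS => x /[apply] ->; rewrite normr0.
have p0 : pairing exp_weight f = 0%E.
  apply/eqP; rewrite eq_le (pairing_ge0 _ (weight_exp_weight R)) andbT.
  by apply: le_trans (pairing_exp_weight_le Ff) _; rewrite f0 mulr0.
have mm : mes (fun x => `|f x|) by exact: mes_norm.
have pn : pairing exp_weight (fun x => Num.max (`|f x| - 0) 0) = 0%E.
  by rewrite -p0; apply: eq_integral => x _; rewrite subr0 max_l// normr_id.

have := ae_le_of_pairing mm m0 pn.
by apply: filterS => x /[apply] fx; apply/eqP; rewrite -normr_le0.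
Qed.

(** A fast subsequence converges almost everywhere by the embedding into weighted L_1, and the Fatou
    property of the gauge makes its limit the norm limit. *)
Lemma mixed_space_complete (u : nat -> R -> R) : (forall n, F (u n)) ->
  (forall e, 0 < e -> exists n0, forall m n, (n0 <= m)%N -> (n0 <= n)%N ->
     NF (u m \- u n) < e) ->
  exists f, F f /\ (forall e, 0 < e -> exists n0, forall n, (n0 <= n)%N -> NF (u n \- f) < e).
Proof.
move=> Fu cu.
have /choice[n0 n0P] : forall k : nat, exists n0, forall m n, (n0 <= m)%N -> (n0 <= n)%N ->
     NF (u m \- u n) < 2^-1 ^+ k by move=> k; apply: cu; rewrite exprn_gt0.
(* The maximum makes p k and p k.+1 both at least n0 k; the summand k makes p tend to infinity. *)
pose p k := (\max_(i < k.+1) n0 i + k)%N.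
have pn0 k i : (i <= k)%N -> (n0 i <= p k)%N.
  rewrite -ltnS => ik; apply: leq_trans (leq_addr _ _).
  exact: (bigop.bigmax_sup (Ordinal ik)).
have mu' n : mes (u n) by case: (Fu n).
have Fd m n : F (u m \- u n) by exact: mixed_spaceB.
have [f mf uf] : exists2 f : R -> R, mes f &
    {ae mu, forall x, D x -> (fun k => u (p k)) ^~ x @ \oo --> f x}.
  apply: ae_cvg_of_summable => //.
  apply: (@le_lt_trans _ _ (exp_const * 2)%:E); last exact: ltry.
  apply: lime_le.
    by apply: is_cvg_nneseries => k _ _; exact/pairing_ge0/weight_exp_weight.
  apply: nearW => n.
  apply: (@le_trans _ _ (\sum_(0 <= k < n) (exp_const * 2^-1 ^+ k)%:E)%E).
    apply: lee_sum => k _; apply: le_trans (pairing_exp_weight_le (Fd _ _)) _.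
    by rewrite lee_fin ler_pM2l ?exp_const_gt0//; apply/ltW/n0P; apply: pn0.
  rewrite sumEFin lee_fin -mulr_sumr ler_pM2l ?exp_const_gt0//.
  suff : \sum_(0 <= k < n) (2^-1 ^+ k : R) <= 2 - 2 * 2^-1 ^+ n.
    by move=> /le_trans; apply; rewrite gerBl mulr_ge0// exprn_ge0.
  elim: n => [|n IH]; first by rewrite big_geq// expr0 mulr1 subrr.
  by rewrite big_nat_recr//= [X in 2 * X]exprS; lra.
have key e m : (exists n, forall k, (n <= k)%N -> NF (u m \- u (p k)) <= e) ->
    F (u m \- f) /\ NF (u m \- f) <= e.
  move=> [n nP]; apply: (mixed_space_le t_gt0 d_gt0); first exact: measurable_funB.
  apply: (@gauge_fatou _ _ (fun k => u m \- u (p k)) _ _ n).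
  - exact: weights_mixed_weights.
  - by move=> k; exact: measurable_funB.
  - exact: measurable_funB.
  - move: uf; apply: filterS => x /[apply] ux; apply: cvgB => //; exact: cvg_cst.
  - by move=> k nk; rewrite -/(enorm _ _ _) (enormE t_gt0 d_gt0)// lee_fin nP.
have pk k : (k <= p k)%N by rewrite leq_addl.
have key2 e : 0 < e -> exists n0, forall n, (n0 <= n)%N -> F (u n \- f) /\ NF (u n \- f) <= e.
  move=> e0; have [N NP] := cu e e0; exists N => m Nm; apply: key.
  by exists N => k Nk; apply/ltW/NP => //; exact: leq_trans Nk (pk k).
exists f; split; last first.
  move=> e e0; have e2 : 0 < e / 2 by rewrite divr_gt0.
  have [N NP] := key2 _ e2; exists N => n /NP[_ /le_lt_trans]; apply.
  by rewrite ltr_pdivrMr// ltr_pMr// ltr1n.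
have [N /(_ N (leqnn N))[FN _]] := key2 1 ltr01.
have := mixed_spaceB t_gt0 d_gt0 (Fu N) FN; congr mixed_space.
by apply/funext => x /=; rewrite opprB addrC subrK.
Qed.

Lemma mixed_symmetric : symmetric_space F NF.
Proof.
split.
- move=> f Ff; split; first by case: Ff.
  by exists 1; split => //; apply: (mixed_space_distrib_fin t_gt0 d_gt0 d_inf).
- split; last split.
  + exact: mixed_space0.
  + by move=> f g Ff Fg; have [] := mixed_spaceD t_gt0 d_gt0 Ff Fg.
  + by move=> a f Ff; have [] := mixed_spaceZ t_gt0 d_gt0 a Ff.
- split; last split.
  + move=> f Ff; split; first exact: mixed_norm_ge0.
    exact: mixed_norm_zero.
  + by move=> f g Ff Fg; have [] := mixed_spaceD t_gt0 d_gt0 Ff Fg.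
  + by move=> a f Ff; have [] := mixed_spaceZ t_gt0 d_gt0 a Ff.
- exact: mixed_space_complete.
- move=> f g [mf _] Fg fg; have [mg _] := Fg; apply: mixed_distrib_le => // s s0.
  by apply: rearr_le_distrib => //; exact: ltW.
Qed.

(** Bounded norms give bounded means, so [directed_sup] provides the supremum as a limit of a
    sequence from the family, and the gauge passes to it. *)
Lemma mixed_fatou : Defs.fatou F NF.
Proof.
move=> X XF X0 Xge0 Xdir [M XM].
have mX g : X g -> mes g by move=> /XF[].
have fX g : X g -> (pairing exp_weight g < +oo)%E by move=> /XF; exact: pairing_exp_weight_fin.
have [|u [f [Xu mf und uf fub]]] := @directed_sup _ X (exp_const * M) X0 mX fX Xdir.
  move=> g Xg; rewrite -lee_fin; apply: le_trans (exp_mean_le (mX _ Xg) (fX _ Xg)) _.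
  apply: le_trans (pairing_exp_weight_le (XF _ Xg)) _.
  by rewrite lee_fin ler_pM2l ?exp_const_gt0// XM.
have fle c : (forall g, X g -> NF g <= c) -> F f /\ NF f <= c.
  move=> Xc; apply: (mixed_space_le t_gt0 d_gt0 mf).
  apply: (@gauge_fatou _ _ u _ _ 0%N) => //.
  - exact: weights_mixed_weights.
  - by move=> k; exact: mX.
  - by move=> k _; rewrite -/(enorm _ _ _) (enormE t_gt0 d_gt0) ?lee_fin ?Xc//; exact: XF.
have [Ff _] := fle M XM.
exists f; split => //.
- by move=> g Xg; apply/ae_leP => //; [exact: mX|exact: fub].
- move=> h [mh _] hub; apply/ae_leP => //.
  have uh : {ae mu, forall x, forall k, D x -> u k x <= h x}.
    by apply: ae_foralln => k; apply/ae_leP; [exact: mX|done|exact: hub].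
  move: uf uh; apply: filterS2 => x + uhx Dx => /(_ Dx) ux.
  rewrite -(cvg_lim _ ux)//; apply: limr_le; first by apply/cvg_ex; exists (f x).
  by apply: nearW => k; exact: uhx.
- move=> g Xg; apply: (mixed_space_ae_le t_gt0 d_gt0 (mX _ Xg) Ff _).2.
  have g0 := (ae_leP m0 (mX _ Xg)).1 (Xge0 _ Xg).
  move: g0 (fub _ Xg); apply: filterS2 => x + + Dx => /(_ Dx) gx /(_ Dx) gf.
  by rewrite !ger0_norm// (le_trans gx).
- by move=> c /fle[].
Qed.

(** [directed_sup] applied to the opposite family gives a decreasing sequence whose limit lies in F
    and bounds the family from below, so it is 0; the sequential statement then applies. *)
Lemma mixed_order_continuous : order_continuous F NF.
Proof.
move=> X XF X0 Xdir Xge0 Xinf e e0.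
have mX g : X g -> mes g by move=> /XF[].
pose X' := [set \- g | g in X].
have mX' g : X' g -> mes g by move=> [h Xh <-]; apply: measurable_funN; exact: mX.
have fX' g : X' g -> (pairing exp_weight g < +oo)%E.
  move=> [h Xh <-]; apply: le_lt_trans (pairing_exp_weight_fin (XF _ Xh)).
  rewrite le_eqVlt; apply/orP; left; apply/eqP.
  by apply: eq_integral => x _; rewrite normrN.
have leN g h : ae_le g h -> ae_le (\- h) (\- g).
  rewrite /ae_le => <-; congr (mu _); apply/seteqP.
  by split => x /= [? ?]; split => //; lra.
have [| | |u' [f' [Xu' mf' und' uf' fub']]] := @directed_sup _ X' 0 _ mX' fX'.
- by have [g Xg] := X0; exists (\- g), g.
- move=> _ _ [g Xg <-] [h Xh <-]; have [k [Xk [kg kh]]] := Xdir _ _ Xg Xh.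
  by exists (\- k); split; [exists k|split; exact: leN].
- move=> _ [g Xg <-].
  have X'g : X' (\- g) by exists g.

  have J0 : exp_mean (fun=> 0 : R) = 0.
    by rewrite /exp_mean; under eq_integral do rewrite mulr0; rewrite integral0.
  rewrite -J0; apply: exp_mean_ae_le => //; [exact: mX'|exact: fX'| |].
    exact: pairing_exp_weight_fin mixed_space0.
  move: ((ae_leP m0 (mX _ Xg)).1 (Xge0 _ Xg)).
  by apply: filterS => x /[apply]; rewrite oppr_le0.
have /choice[g gP] k : exists g, X g /\ \- g = u' k by have [g ? ?] := Xu' k; exists g.
have Xg k : X (g k) by case: (gP k).
have u'E k : u' k = \- g k by case: (gP k).

have g0 : {ae mu, forall x k, D x -> 0 <= g k x}.
  by apply: ae_foralln => k; apply: (ae_leP m0 (mX _ (Xg k))).1; exact: Xge0.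
have mNf : mes (\- f') by exact: measurable_funN.
have f'0 : {ae mu, forall x, D x -> f' x <= 0}.
  move: uf' g0; apply: filterS2 => x + gx Dx => /(_ Dx) ux.
  rewrite -(cvg_lim _ ux)//; apply: limr_le; first by apply/cvg_ex; exists (f' x).
  by apply: nearW => k; rewrite u'E oppr_le0 gx.
have f'g h : X h -> {ae mu, forall x, D x -> - f' x <= h x}.
  move=> Xh; have : X' (\- h) by exists h.
  by move=> /fub'; apply: filterS => x /[apply]; rewrite lerNl.
have FNf : F (\- f').
  apply: (mixed_space_ae_le t_gt0 d_gt0 mNf (XF _ (Xg 0%N)) _).1.
  move: f'0 (f'g _ (Xg 0%N)); apply: filterS2 => x + + Dx => /(_ Dx) f0 /(_ Dx) fg.
  by rewrite ger0_norm ?oppr_ge0// (le_trans fg)// ler_norm.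
have f'ge0 : {ae mu, forall x, D x -> - f' x <= 0}.
  apply/(ae_leP mNf m0); apply: Xinf => // h Xh.
  by apply/ae_leP => //; [exact: mX|exact: f'g].
have [| | | |k0 k0P] := mixed_norm_order_continuous t_gt0 d_gt0 d_inf (u := g)
    (ltac:(rewrite divr_gt0//) : 0 < e / 2).
- by move=> k; exact: mX.
- exact: XF.
- move=> k; move: und' g0; apply: filterS2 => x + gx Dx => /(_ Dx)/(_ 0%N k (leq0n k)).
  by rewrite !u'E /= lerN2 !ger0_norm ?gx.
- move: uf' f'0 f'ge0; apply: filterS3 => x + + + Dx => /(_ Dx) ux /(_ Dx) f0 /(_ Dx) f1.
  have -> : g ^~ x = (fun k => - u' k x) by apply/funext => k; rewrite u'E opprK.
  rewrite -oppr0; apply: cvgN; move: ux.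
  by rewrite (_ : f' x = 0)//; apply/eqP; rewrite eq_le f0 -oppr_le0.
exists (g k0); split => // h Xh hg.
apply: (@le_lt_trans _ _ (NF (g k0))); last first.
  apply: (le_lt_trans (k0P k0 (leqnn k0))).
  by rewrite ltr_pdivrMr// ltr_pMr// ltr1n.
apply: (mixed_space_ae_le t_gt0 d_gt0 (mX _ Xh) (XF _ (Xg k0)) _).2.
move: ((ae_leP m0 (mX _ Xh)).1 (Xge0 _ Xh)) ((ae_leP (mX _ Xh) (mX _ (Xg k0))).1 hg).
apply: filterS2 => x + + Dx => /(_ Dx) hx /(_ Dx) hgx.
by rewrite !ger0_norm// (le_trans hx).
Qed.

Lemma mixed_KB : KB_space F NF.
Proof.
by split; [exact: mixed_symmetric|exact: mixed_fatou|exact: mixed_order_continuous].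
Qed.

End MixedKB.

(** * Densities of continuous functionals *)

Section Density.
Variable R : realType.
Local Notation mu := (@lebesgue_measure R).
Local Notation D := (@pos_half R).
Implicit Types (s : R -> R) (c e : R).

Definition bounded_mes s := mes s /\ exists c, forall x, `|s x| <= c.

Variable L : (R -> R) -> R.
Hypothesis L_linear : forall s s' c, bounded_mes s -> bounded_mes s' ->
  L (fun x => s x + c * s' x) = L s + c * L s'.
Hypothesis L_cont : forall (s : nat -> R -> R) c, (forall k, mes (s k)) ->
  (forall k x, `|s k x| <= c) ->
  {ae mu, forall x, D x -> s ^~ x @ \oo --> 0} -> (fun k => L (s k)) @ \oo --> 0.

Lemma bounded_mes_indic (A : set R) : measurable A -> bounded_mes (\1_A).
Proof.
move=> mA; split; first exact: measurable_indic.
by exists 1 => x; rewrite indicE; case: (_ \in _); rewrite ?normr1 ?normr0.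
Qed.

Lemma bounded_mesD s s' c : bounded_mes s -> bounded_mes s' ->
  bounded_mes (fun x => s x + c * s' x).
Proof.
move=> [ms [a sa]] [ms' [b sb]]; split; first by apply: measurable_funD => //; exact: mesZ.
exists (a + `|c| * b) => x; apply: (le_trans (ler_normD _ _)).
by rewrite lerD// normrM ler_wpM2l.
Qed.

(** A constant sequence equal to s tends to 0 almost everywhere, so [L_cont] forces L s = 0. *)
Let L_ae0 s : bounded_mes s -> {ae mu, forall x, D x -> s x = 0} -> L s = 0.
Proof.
move=> [ms [c sc]] s0.
have H : (fun _ : nat => L s) @ \oo --> 0.
  apply: (@L_cont (fun=> s) c) => //.
  by move: s0; apply: filterS => x /[apply] ->; exact: cvg_cst.
by rewrite -(cvg_lim (@Rhausdorff R) H) lim_cst.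
Qed.

(** A charge on the whole line. The continuity of L makes it countably additive, absolutely
    continuous and concentrated on (0, oo). *)
Let nu (A : set (measurableTypeR R)) : \bar R := (L (\1_A))%:E.

Let L0 : L (fun=> 0) = 0.
Proof.
apply: L_ae0; last by apply: nearW.
by split; [exact: measurable_cst|exists 0 => x; rewrite normr0].
Qed.

Let nu0 : nu set0 = 0%E.
Proof.
rewrite /nu -[X in _ = X]/(0%:E) -L0; congr (_%:E); congr L.
by apply/funext => x; rewrite indic0.
Qed.

Let nu_fin A : measurable A -> nu A \is a fin_num.
Proof. by []. Qed.

Let L_indicU (A B : set R) : measurable A -> measurable B -> A `&` B = set0 ->
  L (\1_(A `|` B)) = L (\1_A) + L (\1_B).
Proof.
move=> mA mB AB; rewrite -[L \1_B]mul1r -L_linear; do ?exact: bounded_mes_indic.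
congr L; apply/funext => x; rewrite mul1r !indicE in_setU.
case: (boolP (x \in A)) => [/set_mem Ax|]; last by rewrite add0r.
rewrite memNset ?addr0// => Bx.
by have : (A `&` B) x by []; rewrite AB.
Qed.

Let nu_sigma_additive : semi_sigma_additive nu.
Proof.
move=> F mF tF mUF.
have mFn n : measurable (\big[setU/set0]_(0 <= i < n) F i) by exact: bigsetU_measurable.
have sumE n : (\sum_(0 <= i < n) nu (F i) = (L (\1_(\big[setU/set0]_(0 <= i < n) F i)))%:E)%E.
  elim: n => [|n IH]; first by rewrite !big_geq// -nu0.
  rewrite !big_nat_recr//= IH (L_indicU (mFn n) (mF n))//.
  apply/seteqP; split=> // x []; rewrite big_mkord -bigcup_mkord => -[i /= ilt Fix] Fnx.
  have := tF i n I I (ex_intro _ x (conj Fix Fnx)).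
  by move: ilt => /[swap] ->; rewrite ltnn.
rewrite (eq_cvg _ _ sumE).
(* The indicator of what the first n sets leave uncovered; it tends to 0 pointwise. *)
pose s n := \1_(\bigcup_n F n) - \1_(\big[setU/set0]_(0 <= i < n) F i) : R -> R.
have sE n x : s n x = \1_(\bigcup_n F n) x + (-1) * \1_(\big[setU/set0]_(0 <= i < n) F i) x.
  by rewrite mulN1r.
have Ls n : L (s n) = L (\1_(\bigcup_n F n)) - L (\1_(\big[setU/set0]_(0 <= i < n) F i)).
  rewrite -mulN1r -(@L_linear _ _ (-1) (bounded_mes_indic mUF) (bounded_mes_indic (mFn n))).
  by congr L; apply/funext => x; exact: sE.
have subU n x : (\big[setU/set0]_(0 <= i < n) F i) x -> (\bigcup_n F n) x.
  by rewrite big_mkord -bigcup_mkord => -[i _ Fix]; exists i.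
have s0 : (fun n => L (s n)) @ \oo --> 0.
  apply: (@L_cont s 1) => [k|k x|].
  - have [mk _] := bounded_mesD (-1) (bounded_mes_indic mUF) (bounded_mes_indic (mFn k)).
    by rewrite (_ : s k = fun x => \1_(\bigcup_n F n) x + (-1) * \1_(\big[setU/set0]_(0 <= i < k) F i) x)//;
      apply/funext => x; exact: sE.
  - rewrite sE mulN1r !indicE; case: (boolP (x \in \big[setU/set0]_(0 <= i < k) F i)).
      by move=> /set_mem/subU Ux; rewrite mem_set// subrr normr0.
    by rewrite subr0; case: (_ \in _); rewrite ?normr1 ?normr0.
  - apply: aeW => x _; apply/cvgrPdist_lt => e e0.
    have [[N _ FNx]|nU] := pselect ((\bigcup_n F n) x).
      near=> n; have Fx : (\big[setU/set0]_(0 <= i < n) F i) x.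
        rewrite big_mkord -bigcup_mkord; exists N => //=; near: n; exact: nbhs_infty_gt.
      by rewrite sE !indicE !mem_set ?mulr1 ?subrr ?normr0//; exact: subU Fx.
    apply: nearW => n; rewrite sE !indicE !memNset ?mulr0 ?addr0 ?subrr ?normr0//.
    by move=> /subU.
apply: cvg_EFin; first exact: nearW.
rewrite (_ : L _ = L (\1_(\bigcup_n F n)) - 0); last by rewrite subr0.
rewrite [X in X @ _ --> _](_ : _ = (fun n => L (\1_(\bigcup_n F n)) - L (s n))); last first.
  by apply/funext => n; rewrite Ls opprB addrC subrK.
by apply: cvgB => //; exact: cvg_cst.
Unshelve. all: by end_near. Qed.

HB.instance Definition _ := isCharge.Build _ _ R nu nu0 nu_fin nu_sigma_additive.

Let nu_dominated : nu `<< mu.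
Proof.
apply/null_content_dominatesP => A mA A0; rewrite /nu L_ae0//.
  exact: bounded_mes_indic.
by apply: (ae_of_null mA A0) => x _ nA; rewrite indicE memNset.
Qed.

Definition density (x : R) : R := fine (Radon_Nikodym nu mu x).

Let densityE x : (density x)%:E = Radon_Nikodym nu mu x.
Proof. by rewrite fineK// Radon_Nikodym_fin_num. Qed.

Lemma integrable_density : mu.-integrable D (EFin \o density).
Proof.
have H := Radon_Nikodym_integrable nu_dominated.
rewrite (_ : EFin \o density = Radon_Nikodym nu mu); last first.
  by apply/funext => x /=; rewrite densityE.
by apply: integrableS H => //; exact: measurable_pos_half.
Qed.

Lemma mes_density : mes density.
Proof. by apply/measurable_EFinP; apply: measurable_int integrable_density. Qed.

Let integrable_densityM s : bounded_mes s ->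
  mu.-integrable D (fun x => (density x * s x)%:E).
Proof.
move=> [ms [c sc]].
apply: (@le_integrable _ _ _ mu D (@measurable_pos_half R) _ (fun x => (c%:E * (density x)%:E)%E)).
- apply/measurable_EFinP; apply: measurable_funM => //; exact: mes_density.
- move=> x _; rewrite -EFinM !lee_fin !normrM mulrC ler_wpM2r// (le_trans (sc x))//.
  exact: ler_norm.
- by apply: integrableZl; [exact: measurable_pos_half|exact: integrable_density].
Qed.

Let J s : R := fine (\int[mu]_(x in D) (density x * s x)%:E)%E.

Let JE s : bounded_mes s -> (\int[mu]_(x in D) (density x * s x)%:E)%E = (J s)%:E.
Proof.
move=> bs; rewrite /J fineK//; apply: integrable_fin_num; first exact: measurable_pos_half.
exact: integrable_densityM.
Qed.

Let J_linear s s' c : bounded_mes s -> bounded_mes s' ->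
  J (fun x => s x + c * s' x) = J s + c * J s'.
Proof.
move=> bs bs'; apply: EFin_inj; rewrite -JE; last exact: bounded_mesD.
have H := integrable_densityM bs; have H' := integrable_densityM bs'.
rewrite EFinD EFinM -!JE// -integralZl//.
rewrite -integralD//; last first.
  by apply: integrableZl => //; exact: measurable_pos_half.
by apply: eq_integral => x _; rewrite -EFinM -EFinD mulrDr mulrCA.
Qed.

Let J_cont (s : nat -> R -> R) c : (forall k, mes (s k)) ->
  (forall k x, `|s k x| <= c) ->
  {ae mu, forall x, D x -> s ^~ x @ \oo --> 0} -> (fun k => J (s k)) @ \oo --> 0.
Proof.
move=> ms sc s0; have bs k : bounded_mes (s k) by split => //; exists c.
have H : (\int[mu]_(x in D) (density x * s k x)%:E)%E @[k --> \oo] -->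
    (\int[mu]_(x in D) (0 : R)%:E)%E.
  apply: (@cvg_integral_dominated _ (fun k x => density x * s k x) _ (fun x => c * `|density x|)).
  - by move=> k; apply: measurable_funM => //; exact: mes_density.
  - exact: measurable_cst.
  - rewrite (_ : EFin \o _ = (fun x => (c%:E * (`|density x|)%:E)%E))//.
    apply: integrableZl; first exact: measurable_pos_half.
    exact: (integrable_norm integrable_density).
  - move: s0; apply: filterS => x /[apply] sx.
    by rewrite -(mulr0 (density x)); apply: cvgMr.
  - by move=> k; apply: aeW => x _; rewrite normrM mulrC ler_wpM2r.
move: H; rewrite integral0 => /fine_cvg; exact.
Qed.

Let LJ_indic A : measurable A -> L (\1_A) = J (\1_A).
Proof.
move=> mA; have mAD : measurable (A `&` D) by apply: measurableI => //; exact: measurable_pos_half.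
have -> : L (\1_A) = L (\1_(A `&` D)).
  apply/eqP; rewrite -subr_eq0; apply/eqP; rewrite -mulN1r -L_linear; do ?exact: bounded_mes_indic.
  apply: L_ae0; first by apply: bounded_mesD; exact: bounded_mes_indic.
  apply: aeW => x Dx; rewrite !indicE in_setI (mem_set Dx) andbT mulN1r subrr//.
apply: EFin_inj; rewrite -JE; last exact: bounded_mes_indic.
have := Radon_Nikodym_integral nu_dominated mAD; rewrite /= /nu => ->.
rewrite setIC integral_mkcondr; apply: eq_integral => x _.
by rewrite patchE indicE -densityE; case: ifP; rewrite ?mulr1 ?mulr0.
Qed.

(* Binary expansion: [r n] is [s] minus the first [n] binary digits, and each digit
   is an indicator function. *)
Let LJ_01 s : mes s -> (forall x, 0 <= s x <= 1) -> L s = J s.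
Proof.
move=> ms s01.
pose dig n (r : R -> R) : set R := D `&` [set x | 2^-1 ^+ n.+1 <= r x].
(* Digits are taken inside (0, oo) only, while the bounds on r n must hold at every real x; hence
   the cut of s to (0, oo). *)
pose r := fix r n := if n is n'.+1 then
  (fun x => r n' x + (- 2^-1 ^+ n) * \1_(dig n' (r n')) x) else (fun x => s x * \1_D x).
have mr n : mes (r n) /\ forall x, 0 <= r n x <= 2^-1 ^+ n.
  elim: n => [|n [IH1 IH2]].
    split=> [|x]; first by apply: measurable_funM => //; exact: measurable_indic.
    rewrite /= expr0 indicE; case: (x \in D); first by rewrite mulr1.
    by rewrite mulr0 lexx ler01.
  have mdig : measurable (dig n (r n)) by apply: measurable_pos_half_le => //; exact: measurable_cst.
  split=> [|x]; first by apply: measurable_funD => //; apply: mesZ; exact: measurable_indic.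
  have H := IH2 x; have E : 2^-1 ^+ n = 2 * 2^-1 ^+ n.+1 :> R by rewrite exprS mulrA divff// mul1r.
  have p0 : 0 < 2^-1 ^+ n.+1 :> R by rewrite exprn_gt0.
  move: H; rewrite E /= indicE; case: (boolP (x \in dig n (r n))) => [/set_mem[_ /=]|/negP nd].
    by lra.
  have [Dx|nDx] := pselect (D x); last first.
    have -> : r n x = 0.
      elim: (n) => [|m IH] /=; first by rewrite indicE memNset// mulr0.
      by rewrite IH indicE memNset ?mulr0 ?addr0// => -[].
    by move=> _; rewrite mulr0 addr0; lra.
  have : r n x < 2^-1 ^+ n.+1.
    by rewrite ltNge; apply/negP => h; apply: nd; rewrite inE.
  by rewrite mulr0 addr0; lra.
have br n : bounded_mes (r n).
  split; [by case: (mr n)|exists (2^-1 ^+ n) => x].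
  by case: (mr n) => _ /(_ x) /andP[r0 r1]; rewrite ger0_norm.
have mdig n : measurable (dig n (r n)).
  by apply: measurable_pos_half_le; [exact: measurable_cst|case: (mr n)].
(* L and J agree on the digits, so L - J is the same at every r n; both terms tend to 0. *)
have LJr n : L (r 0%N) - J (r 0%N) = L (r n) - J (r n).
  elim: n => [//|n ->] /=; rewrite L_linear ?J_linear//; try exact: bounded_mes_indic.
  by rewrite (LJ_indic (mdig n)); lra.
have r0x : {ae mu, forall x, D x -> r ^~ x @ \oo --> 0}.
  apply: aeW => x _; have c2 : (fun n => (2^-1 : R) ^+ n) @ \oo --> (0 : R).
    by apply: cvg_expr; rewrite ger0_norm// invf_lt1// ltr1n.
  apply: (squeeze_cvgr _ (cvg_cst 0) c2); apply: nearW => n.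
  by case: (mr n) => _ /(_ x).
have r1 k x : `|r k x| <= 1.
  case: (mr k) => _ /(_ x) /andP[rk0 rk1]; rewrite ger0_norm// (le_trans rk1)//.
  by rewrite exprn_ile1// invf_le1// ler1n.
have mr' k : mes (r k) by case: (mr k).
have C1 := L_cont mr' r1 r0x; have C2 := J_cont mr' r1 r0x.
have : (fun n => L (r n) - J (r n)) @ \oo --> (0 - 0 : R) by exact: cvgB.
rewrite subr0 => C.
have E : L (r 0%N) - J (r 0%N) = 0.
  rewrite -(cvg_lim (@Rhausdorff R) C); apply/esym; rewrite (_ : (fun n => _) = fun=> L (r 0%N) - J (r 0%N)).
    by rewrite lim_cst.
  by apply/funext => n; rewrite -LJr.
have bs : bounded_mes s by split => //; exists 1 => x; case/andP: (s01 x) => ? ?; rewrite ger0_norm.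
have r0s x : D x -> r 0%N x = s x by move=> Dx /=; rewrite indicE mem_set// mulr1.
have <- : L (r 0%N) = L s.
  apply/eqP; rewrite -subr_eq0 -mulN1r -L_linear//; apply/eqP; apply: L_ae0.
    exact: bounded_mesD.
  by apply: aeW => x Dx; rewrite r0s// mulN1r subrr.
have <- : J (r 0%N) = J s.
  by congr fine; apply: eq_integral => x /set_mem Dx; rewrite r0s.
by apply/eqP; rewrite -subr_eq0 E.
Qed.

(** An affine change moves s into [0, 1], where [LJ_01] applies; [|c| + 1] is used because c could
    be 0. *)
Lemma densityP s : bounded_mes s ->
  (L s)%:E = (\int[mu]_(x in D) (density x * s x)%:E)%E.
Proof.
move=> bs; rewrite JE//; congr (_%:E); have [ms [c sc]] := bs.
have c0 : 0 < `|c| + 1 by rewrite ltr_wpDl.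
pose q x := (s x + (`|c| + 1)) / (2 * (`|c| + 1)).
have q01 x : 0 <= q x <= 1.
  have := sc x; rewrite ler_norml => /andP[s1 s2].
  have := ler_norm c => cc.
  rewrite /q ler_pdivrMr ?mulr_gt0// mul1r divr_ge0 ?mulr_ge0 ?(ltW c0)//=; lra.
have mq : mes q.
  apply: measurable_funM; last exact: measurable_cst.
  by apply: measurable_funD => //; exact: measurable_cst.
have bq : bounded_mes q by split => //; exists 1 => x; case/andP: (q01 x) => ? ?; rewrite ger0_norm.
have b1 : bounded_mes (\1_[set: R]) by exact: bounded_mes_indic.
have sE : s = fun x => (- (`|c| + 1) * \1_[set: R] x) + (2 * (`|c| + 1)) * q x.
  apply/funext => x; rewrite indicT mulr1 /q mulrCA divff ?mulr1 ?gt_eqF ?mulr_gt0//.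
  by rewrite addrC addrK.
have bz : bounded_mes (fun=> 0 : R) by split; [exact: measurable_cst|exists 0 => x; rewrite normr0].
have b1' : bounded_mes (fun x => - (`|c| + 1) * \1_[set: R] x).
  have := bounded_mesD (- (`|c| + 1)) bz b1; congr bounded_mes.
  by apply/funext => x; rewrite add0r.
have L1 : L (fun x => - (`|c| + 1) * \1_[set: R] x) = - (`|c| + 1) * L (\1_[set: R]).
  rewrite -[RHS]add0r -L0 -L_linear//; congr L; apply/funext => x; rewrite add0r//.
have J1 : J (fun x => - (`|c| + 1) * \1_[set: R] x) = - (`|c| + 1) * J (\1_[set: R]).
  have J0 : J (fun=> 0) = 0.
    by rewrite /J; under eq_integral do rewrite mulr0; rewrite integral0.
  rewrite -[RHS]add0r -J0 -J_linear//; congr J; apply/funext => x; rewrite add0r//.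
by rewrite sE L_linear// J_linear// L1 J1 (LJ_01 mq q01) LJ_indic.
Qed.

End Density.

(** * Tails of functionals on mixed spaces *)

Section Reflexive.
Variable R : realType.
Local Notation mu := (@lebesgue_measure R).
Local Notation D := (@pos_half R).
Implicit Types (f g h : R -> R) (s c e : R).
Variables (t d : nat -> R).
Hypotheses (t_gt0 : forall n, 0 < t n) (d_gt0 : forall n, 0 < d n).
Hypothesis d_min : forall n, d n * Num.min (t n) 1 <= 2^-1 ^+ n.
Hypothesis d_inf : forall m, exists2 n, (m <= n)%N & 1 <= d n * t n.
Hypothesis d_ge1 : forall m, exists2 n, (m <= n)%N & 1 <= d n.
Local Notation F := (mixed_space t d).
Local Notation NF := (mixed_norm t d).

Lemma sum_d_sqr_unbounded (k : nat) : exists M, k%:R <= \sum_(n < M) d n ^+ 2.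
Proof.
elim: k => [|k [M IH]]; first by exists 0%N; rewrite big_ord0.
have [n Mn dn] := d_ge1 M; exists n.+1.
rewrite big_ord_recr /= -natr1 lerD//; last by rewrite exprn_ege1.
apply: le_trans IH _.
rewrite -!(big_mkord xpredT (fun n => d n ^+ 2)) [leRHS](big_cat_nat (n := M))//= lerDl.
by apply: sumr_ge0 => i _; exact: sqr_ge0.
Qed.

Lemma t_lower_bound M : exists2 e, 0 < e & forall n, (n < M)%N -> e <= t n.
Proof.
elim: M => [|M [e e0 H]]; first by exists 1.
exists (Num.min e (t M)); first by rewrite lt_min e0 t_gt0.
move=> n; rewrite ltnS leq_eqVlt => /orP[/eqP ->|/H]; rewrite ge_min ?lexx ?orbT//.
by move=> ->.
Qed.

(** Choose M with the sum of d_n^2 over n < M at least k > e^-2, and r below the corresponding t_n.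
    Each K(t_n, f) is at least K(r, f), so k K(r, f)^2 <= |f|_F^2. *)
Lemma Kfun_uniform e : 0 < e ->
  exists2 r, 0 < r & forall f, F f -> (Kfun r f <= (e * NF f)%:E)%E.
Proof.
move=> e0; pose k := (Num.truncn (e ^- 2)).+1.
have [M HM] := sum_d_sqr_unbounded k; have [r r0 Hr] := t_lower_bound M.
exists r => // f Ff; have [mf _] := Ff.
have K0 := gauge_ge0 f (weights_unit_weights (ltW r0)).
have [y yE] : exists y, Kfun r f = y%:E.
  exists (fine (Kfun r f)); rewrite fineK// ge0_fin_numE//.
  apply: le_lt_trans (Kfun_scale (t_gt0 0%N) (ltW r0) mf) _.
  by rewrite (KfunE t_gt0 d_gt0)// -EFinM ltry.
have y0 : 0 <= y by rewrite -lee_fin -yE.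
rewrite yE lee_fin -ler_sqr ?nnegrE ?mulr_ge0 ?(ltW e0) ?mixed_norm_ge0//.
have : k%:R * y ^+ 2 <= NF f ^+ 2.
  apply: le_trans (sum_coord_sqr_le t_gt0 d_gt0 M Ff).
  apply: (@le_trans _ _ (\sum_(n < M) (d n * y) ^+ 2)).
    under eq_bigr do rewrite exprMn.
    by rewrite -mulr_suml ler_wpM2r ?sqr_ge0.
  apply: ler_sum => n _.
  have dy : 0 <= d n * y by rewrite mulr_ge0// ltW.
  rewrite ler_sqr ?nnegrE; [|exact: dy|exact: coord_ge0].
  rewrite /Kcoord ler_pM2l// -lee_fin fineK ?(KfunE t_gt0 d_gt0)// -(KfunE t_gt0 d_gt0)// -yE.
  by apply: Kfun_mono; exact: Hr.
move=> H; rewrite exprMn -ler_pdivrMl ?exprn_gt0//; apply: le_trans H.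
by rewrite ler_wpM2r ?sqr_ge0// ltW// truncnS_gt.
Qed.

Lemma sum_indic_disjoint_le1 (S : nat -> set R) N x : trivIset setT S ->
  \sum_(i < N) (\1_(S i) x : R) <= 1.
Proof.
move=> tS; have [[i Six]|nS] := pselect (exists i : 'I_N, S i x); last first.
  rewrite big1// => i _; rewrite indicE memNset// => Six; apply: nS; by exists i.
rewrite (bigD1 i)//= indicE mem_set// big1 ?addr0// => j ji.
rewrite indicE memNset// => Sjx; move/eqP: ji; apply.
by apply/val_inj/(tS _ _ I I); exists x.
Qed.

(** A weight of mass s splits along the disjoint S i into weights of masses tau i with sum at most
    s. By scaling, f i contributes at most (1 + tau i / r) e, and the mean of these is at most (1 +
    s / (N r)) e. *)
Lemma Kfun_disjoint_average (f : nat -> R -> R) (S : nat -> set R) N r s e :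
  0 < r -> 0 < s -> 0 <= e -> (0 < N)%N -> s <= N%:R * r ->
  (forall h, F h -> (Kfun r h <= (e * NF h)%:E)%E) ->
  (forall i, F (f i)) -> (forall i, NF (f i) <= 1) ->
  trivIset setT S -> (forall i, measurable (S i)) ->
  (forall i x, ~ S i x -> f i x = 0) ->
  (Kfun s (fun x => (N%:R^-1 * \sum_(i < N) f i x)%R) <= (2 * e)%:E)%E.
Proof.
move=> r0 s0 e0 N0 sNr Hr Ff Nf tS mS fS.
have N0' : 0 < N%:R :> R by rewrite ltr0n.
have mf i : mes (f i) by case: (Ff i).
apply/gauge_leP => g [mg g01 gs].
have g0 x : 0 <= g x by case/andP: (g01 x).
have g1 x : g x <= 1 by case/andP: (g01 x).
have wg : weight g by [].
pose gS i x := g x * \1_(S i) x.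
have gS01 i x : 0 <= gS i x <= 1.
  by rewrite /gS indicE; case: (_ \in _); rewrite ?mulr1 ?mulr0 ?g01// lexx ler01.
have mgS i : mes (gS i) by apply: measurable_funM => //; exact: measurable_indic.
have wgS i : weight (gS i) by split => // x; case/andP: (gS01 i x).
pose tau i : R := fine (\int[mu]_(x in D) (gS i x)%:E)%E.
have tauE i : (\int[mu]_(x in D) (gS i x)%:E)%E = (tau i)%:E.
  rewrite /tau fineK// ge0_fin_numE; last first.
    by apply: integral_ge0 => x _; rewrite lee_fin; case/andP: (gS01 i x).
  apply: (@le_lt_trans _ _ s%:E); last exact: ltry.
  apply: le_trans gs; apply: ge0_le_integral => //.
  - by move=> x _; rewrite lee_fin; case/andP: (gS01 i x).
  - by apply/measurable_EFinP; exact: mgS.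
  - by apply/measurable_EFinP.
  - by move=> x _; rewrite lee_fin /gS indicE; case: (_ \in _); rewrite ?mulr1 ?mulr0.
have tau0 i : 0 <= tau i.
  by apply/fine_ge0/integral_ge0 => x _; rewrite lee_fin; case/andP: (gS01 i x).
have sum_tau : \sum_(i < N) tau i <= s.
  rewrite -lee_fin -sumEFin; apply: le_trans gs.
  under eq_bigr do rewrite -tauE.
  rewrite -ge0_integral_sum//; last 2 first.
  - by move=> i; apply/measurable_EFinP; exact: mgS.
  - by move=> i x _; rewrite lee_fin; case/andP: (gS01 i x).
  apply: ge0_le_integral => //.
  - by move=> x _; apply: sume_ge0 => i _; rewrite lee_fin; case/andP: (gS01 i x).
  - by apply: emeasurable_sum => i; apply/measurable_EFinP; exact: mgS.
  - by apply/measurable_EFinP.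
  - move=> x _; rewrite sumEFin lee_fin /gS -mulr_sumr ler_piMr//.
    exact: sum_indic_disjoint_le1.
have pgS i : (pairing (gS i) (f i) <= ((1 + tau i / r) * e)%:E)%E.
  have gSt : unit_weights (tau i) (gS i) by split => //; rewrite tauE.
  apply: le_trans (pairing_gauge (f i) gSt) _.
  apply: le_trans (Kfun_scale r0 (tau0 i) (mf i)) _.
  rewrite EFinM; apply: lee_wpmul2l; first by rewrite lee_fin addr_ge0// divr_ge0// ltW.
  by apply: le_trans (Hr _ (Ff i)) _; rewrite lee_fin ler_piMr.
rewrite pairingZ//; last by apply: measurable_sum => i.
rewrite ger0_norm ?invr_ge0 ?ler0n//.
have sub : (pairing g (fun x => (\sum_(i < N) f i x)%R) <= \sum_(i < N) pairing (gS i) (f i))%E.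
  rewrite /pairing -ge0_integral_sum//; last 2 first.
  - by move=> i; exact: mes_pairing.
  - by move=> i x _; rewrite lee_fin mulr_ge0//; case/andP: (gS01 i x).
  apply: ge0_le_integral => //.
  - by move=> x _; rewrite lee_fin mulr_ge0.
  - by apply: mes_pairing => //; apply: measurable_sum => i.
  - by apply: emeasurable_sum => i; exact: mes_pairing.
  - move=> x _; rewrite sumEFin lee_fin.
    apply: (@le_trans _ _ (g x * \sum_(i < N) `|f i x|)).
      by rewrite ler_wpM2l// ler_norm_sum.
    rewrite mulr_sumr; apply: ler_sum => i _; rewrite /gS indicE.
    case: (boolP (x \in S i)) => [_|/negP nS]; first by rewrite mulr1.
    by rewrite fS ?normr0 ?mulr0// => Six; apply: nS; rewrite inE.
apply: (@le_trans _ _ ((N%:R^-1)%:E * (\sum_(i < N) (1 + tau i / r) * e)%:E)%E).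
  apply: lee_wpmul2l; first by rewrite lee_fin invr_ge0 ler0n.
  by apply: le_trans sub _; rewrite -sumEFin; apply: lee_sum => i _.
rewrite -EFinM lee_fin -mulr_suml big_split /= sumr_const card_ord -mulr_suml.
rewrite mulrA ler_wpM2r// ler_pdivrMl// mulrDr mulr1 lerD2l.
by rewrite ler_pdivrMr//; exact: le_trans sNr.
Qed.

Lemma sqr_sum_le N (a : nat -> R) : (\sum_(i < N) a i) ^+ 2 <= N%:R * \sum_(i < N) a i ^+ 2.
Proof.
elim: N => [|N IH]; first by rewrite !big_ord0 expr0n mul0r.
rewrite !big_ord_recr /=.
have : \sum_(i < N) 2 * (a i * a N) <= \sum_(i < N) (a i ^+ 2 + a N ^+ 2).
  by apply: ler_sum => i _; have := sqr_ge0 (a i - a N); nra.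
rewrite -mulr_sumr -mulr_suml big_split /= sumr_const card_ord -[a N ^+ 2 *+ N]mulr_natl.
rewrite (_ : N.+1%:R = N%:R + 1 :> R); last by rewrite natr1.
move: IH; move: (\sum_(i < N) a i) (\sum_(i < N) a i ^+ 2) (N%:R : R) => S Q n; lra.
Qed.

Lemma mixed_indic_vanishing f (A : nat -> set R) e : F f -> 0 < e ->
  (forall k, measurable (A k)) ->
  (forall x, D x -> exists N, forall k, (N <= k)%N -> ~ A k x) ->
  exists k0, forall k, (k0 <= k)%N ->
    F (fun x => f x * \1_(A k) x) /\ NF (fun x => f x * \1_(A k) x) <= e.
Proof.
move=> Ff e0 mA A0; have [mf _] := Ff.
have mfA k : mes (fun x => f x * \1_(A k) x).
  by apply: measurable_funM => //; exact: measurable_indic.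
have fA k : ae_abs_le (fun x => f x * \1_(A k) x) f.
  by apply: aeW => x _; rewrite indicE; case: (_ \in _); rewrite ?mulr1 ?mulr0 ?normr0.
(* The dominating function must be the term of index 0. *)
pose u k := if k is k'.+1 then (fun x => f x * \1_(A k') x) else f.
have [| | | |k0 k0P] := mixed_norm_order_continuous t_gt0 d_gt0 d_inf (u := u) e0.
- by case.
- by [].
- by case=> [|k]; [apply: aeW|exact: fA].
- apply: aeW => x Dx; have [N NP] := A0 x Dx.
  apply/cvgrPdist_lt => r r0; near=> k.
  have Nk : (N < k)%N by near: k; exact: nbhs_infty_gt.
  move: Nk; case: (k) => // k' Nk /=.
  by rewrite indicE memNset ?mulr0 ?subrr ?normr0//; exact: NP.
exists k0 => k kk0; split; first exact: (mixed_space_ae_le t_gt0 d_gt0 (mfA k) Ff (fA k)).1.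
exact: (k0P k.+1 (leqW kk0)).
Unshelve. all: by end_near. Qed.

(* By the parallelogram identity in [l^2], if the midpoint of [f] and [h] nearly has norm 1
   then their coordinate sequences are close. *)
Lemma coord_tail_near f h M M' : F f -> F h -> NF f <= 1 -> NF h <= 1 ->
  97 / 100 <= NF (fun x => 2^-1 * (f \+ h) x) ->
  (forall M', \sum_(M <= n < M') Kcoord t d f n ^+ 2 <= 1 / 100) ->
  \sum_(M <= n < M') Kcoord t d h n ^+ 2 <= 65 / 100.
Proof.
move=> Ff Fh f1 h1 Nu HM.
have [Fs _] := mixed_spaceD t_gt0 d_gt0 Ff Fh.
have [Fu _] := mixed_spaceZ t_gt0 d_gt0 2^-1 Fs.
set u := (fun x => 2^-1 * _) in Nu Fu.
have [L0 L0P] : exists L0, (96 / 100) ^+ 2 < \sum_(n < L0) Kcoord t d u n ^+ 2.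
  apply: contrapT => /forallNP HL.
  have := @mixed_norm_le_of_coord _ _ _ t_gt0 d_gt0 u (96 / 100) Fu _ _.
  move=> /(_ (ltac:(rewrite divr_ge0//)))H3.
  have : NF u <= 96 / 100 by apply: H3 => L; rewrite leNgt; apply/negP; exact: HL.
  move: Nu; lra.
pose L := maxn (maxn L0 M) M'.
have cu n : Kcoord t d u n ^+ 2 <= ((Kcoord t d f n + Kcoord t d h n) / 2) ^+ 2.
  rewrite ler_sqr ?nnegrE; last 2 first.
  - exact: coord_ge0.
  - by rewrite divr_ge0// addr_ge0//; exact: coord_ge0.
  rewrite /u (coordZ t_gt0 d_gt0)// ger0_norm// mulrC ler_pM2r//.
  exact: coordD.
have sumL (a : nat -> R) L1 L2 : (L1 <= L2)%N -> (forall n, 0 <= a n) ->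
    \sum_(0 <= n < L1) a n <= \sum_(0 <= n < L2) a n.
  move=> L12 a0; rewrite [leRHS](big_cat_nat (n := L1))//= lerDl.
  exact: sumr_ge0.
have E1 : (96 / 100) ^+ 2 <= \sum_(0 <= n < L) Kcoord t d u n ^+ 2.
  apply: le_trans (ltW L0P) _; rewrite -(big_mkord xpredT (fun n => Kcoord t d u n ^+ 2)).
  by apply: sumL => [|n]; [rewrite /L !leq_max leqnn|exact: sqr_ge0].
have x1 : \sum_(0 <= n < L) Kcoord t d f n ^+ 2 <= 1.
  rewrite big_mkord; apply: le_trans (sum_coord_sqr_le t_gt0 d_gt0 L Ff) _.
  by rewrite expr_le1// mixed_norm_ge0.
have y1 : \sum_(0 <= n < L) Kcoord t d h n ^+ 2 <= 1.
  rewrite big_mkord; apply: le_trans (sum_coord_sqr_le t_gt0 d_gt0 L Fh) _.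
  by rewrite expr_le1// mixed_norm_ge0.
pose dxy n := (Kcoord t d f n - Kcoord t d h n) ^+ 2.
have dL : \sum_(0 <= n < L) dxy n <= 4 - 4 * (96 / 100) ^+ 2.
  have : \sum_(0 <= n < L) dxy n <= \sum_(0 <= n < L)
      (2 * Kcoord t d f n ^+ 2 + 2 * Kcoord t d h n ^+ 2 - 4 * Kcoord t d u n ^+ 2).
    by apply: ler_sum => n _; have := cu n; rewrite /dxy; lra.
  rewrite sumrB big_split /= -!mulr_sumr; move: E1 x1 y1; lra.
have ML : (M <= L)%N by rewrite /L !leq_max leqnn orbT.
have dML : \sum_(M <= n < L) dxy n <= 4 - 4 * (96 / 100) ^+ 2.
  apply: le_trans dL; rewrite [leRHS](big_cat_nat (n := M))//= lerDr.
  by apply: sumr_ge0 => n _; exact: sqr_ge0.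
(* From h^2 <= 2 f^2 + 2 (f - h)^2. Numerically 4 - 4 (0.96)^2 = 0.3136, and 2/100 + 2 (0.3136) is
   below 65/100. *)
have : \sum_(M <= n < L) Kcoord t d h n ^+ 2 <=
    \sum_(M <= n < L) (2 * Kcoord t d f n ^+ 2 + 2 * dxy n).
  apply: ler_sum => n _; rewrite /dxy.
  by have := sqr_ge0 (2 * Kcoord t d f n - Kcoord t d h n); lra.
rewrite big_split /= -!mulr_sumr => H4.
have : \sum_(M <= n < M') Kcoord t d h n ^+ 2 <= \sum_(M <= n < L) Kcoord t d h n ^+ 2.
  have [MM|MM] := leqP M M'; last first.
    by rewrite big_geq ?(ltnW MM)//; apply: sumr_ge0 => n _; exact: sqr_ge0.
  rewrite [leRHS](big_cat_nat (n := M'))//= ?lerDl; last by rewrite /L leq_max leqnn orbT.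
  by apply: sumr_ge0 => n _; exact: sqr_ge0.
have := HM L; move: dML H4; lra.
Qed.

(** The first M squares sum to at most 1/9, and 1/9 + 65/100 < (9/10)^2. *)
Lemma norm_le_of_head_tail u M : F u ->
  (forall n, (n < M)%N -> Kcoord t d u n <= (3 * M.+1%:R)^-1) ->
  (forall M', \sum_(M <= n < M') Kcoord t d u n ^+ 2 <= 65 / 100) -> NF u <= 9 / 10.
Proof.
move=> Fu uhead utail.
have eta0 : 0 <= (3 * M.+1%:R)^-1 :> R by rewrite invr_ge0 mulr_ge0.
have Hh : \sum_(0 <= n < M) Kcoord t d u n ^+ 2 <= 1 / 9.
  rewrite big_mkord; apply: (@le_trans _ _ (\sum_(n < M) (3 * M.+1%:R)^-1 ^+ 2)).
    apply: ler_sum => n _; rewrite ler_sqr ?nnegrE//; [exact: uhead|exact: coord_ge0].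
  rewrite sumr_const card_ord -[_ *+ M]mulr_natr exprVn exprMn invfM.
  rewrite -mulrA mul1r (_ : 3 ^+ 2 = 9 :> R); last lra.
  rewrite ler_piMr// mulrC ler_pdivrMr ?exprn_gt0// mul1r -natrX ler_nat.
  by rewrite expnS expn1 (leq_trans (leqnSn M))// leq_pmulr.
apply: (mixed_norm_le_of_coord t_gt0 d_gt0 Fu) => [|M']; first by rewrite divr_ge0.
rewrite -(big_mkord xpredT (fun n => Kcoord t d u n ^+ 2)).
have [MM|/ltnW MM] := leqP M M'.
  by rewrite (big_cat_nat (n := M))//=; have := utail M'; move: Hh; lra.
apply: (@le_trans _ _ (1 / 9)); last lra.
apply: le_trans Hh; rewrite [leRHS](big_cat_nat (n := M'))//= lerDl.
by apply: sumr_ge0 => n _; exact: sqr_ge0.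
Qed.

Lemma mixed_indic f (A : set R) : F f -> measurable A ->
  F (fun x => f x * \1_A x) /\ NF (fun x => f x * \1_A x) <= NF f.
Proof.
move=> Ff mA; have [mf _] := Ff; apply: (mixed_space_ae_le t_gt0 d_gt0) => //.
  by apply: measurable_funM => //; exact: measurable_indic.
by apply: aeW => x _; rewrite indicE; case: (_ \in _); rewrite ?mulr1 ?mulr0 ?normr0.
Qed.

Section Tail.
Variable phi : (R -> R) -> R.
Hypothesis dual_phi : dual_elt F NF phi.
Variable B : nat -> set R.
Hypothesis mB : forall k, measurable (B k).
Hypothesis ndB : forall m n, (m <= n)%N -> B m `<=` B n.
Hypothesis coverB : forall x, D x -> exists k, B k x.

Let outside k f := fun x => f x * \1_(~` B k) x.

Let F0 : F (fun=> 0) := mixed_space0 t_gt0 d_gt0 d_min.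

Lemma mixed_norm0 : NF (fun=> 0) = 0.
Proof.
apply/(mixed_norm_zero t_gt0 d_gt0 d_min F0); apply/ae_zeroP; first by case: F0.
exact: aeW.
Qed.

Lemma dual0 : phi (fun=> 0) = 0.
Proof.
have [lin _] := dual_phi; have := lin _ _ (-1) F0 F0.
rewrite (_ : _ \+ _ = fun=> 0); first by lra.
by apply/funext => x /=; rewrite mulr0 addr0.
Qed.

Lemma dualZ a f : F f -> phi (fun x => a * f x) = a * phi f.
Proof.
move=> Ff; have [lin _] := dual_phi; have := lin _ _ a F0 Ff.
by rewrite dual0 add0r => <-; congr phi; apply/funext => x /=; rewrite add0r.
Qed.

Lemma dualD f h : F f -> F h -> phi (f \+ h) = phi f + phi h.
Proof.
move=> Ff Fh; have [lin _] := dual_phi; have := lin _ _ 1 Ff Fh.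
by rewrite mul1r => <-; congr phi; apply/funext => x /=; rewrite mul1r.
Qed.

Lemma dual_const : exists2 C, 0 < C & forall f, F f -> `|phi f| <= C * NF f.
Proof.
have [_ [C CP]] := dual_phi; exists (`|C| + 1); first by rewrite ltr_wpDl.
move=> f Ff; apply: le_trans (CP f Ff) _; rewrite ler_wpM2r ?mixed_norm_ge0//.
by rewrite (le_trans (ler_norm C))// lerDl.
Qed.

(** The part of the unit ball that vanishes on B k; [supV k] is the norm of phi on the functions of
    this kind. *)
Let V k := [set f | [/\ F f, NF f <= 1 & forall x, B k x -> f x = 0]].
Let supV k := sup [set phi f | f in V k].

Let V0 k : V k (fun=> 0).
Proof. by split => //; rewrite mixed_norm0. Qed.

Let sup_phi k : has_sup [set phi f | f in V k].
Proof.
split; first by exists (phi (fun=> 0)), (fun=> 0).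
have [C C0 CP] := dual_const; exists C => _ [f [Ff f1 _] <-].
apply: le_trans (ler_norm _) _; apply: le_trans (CP f Ff) _.
by rewrite -[leRHS]mulr1 ler_pM2l.
Qed.

Let le_supV k f : V k f -> phi f <= supV k.
Proof. by move=> Vf; apply: sup_ubound; [case: (sup_phi k)|exists f]. Qed.

Let norm_gt0 f : F f -> 0 < `|phi f| -> 0 < NF f.
Proof.
move=> Ff f0; have [C C0 CP] := dual_const.
by rewrite -(pmulr_rgt0 _ C0) (lt_le_trans f0)// CP.
Qed.

Let supV_ge e k : 0 < e -> (exists2 h, F h & e * NF h < `|phi (outside k h)|) -> e <= supV k.
Proof.
move=> e0 [h Fh eh]; have [Fo No] := mixed_indic Fh (measurableC (mB k)).
have No0 : 0 < NF (outside k h).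
  apply: norm_gt0 => //; apply: le_lt_trans eh.
  by rewrite mulr_ge0 ?(ltW e0)// mixed_norm_ge0.
have N0 : 0 < NF h by exact: lt_le_trans No.
pose a := Num.sg (phi (outside k h)) / NF h.
have [Fa Na] := mixed_spaceZ t_gt0 d_gt0 a Fo.
have Va : V k (fun x => a * outside k h x).
  split => //; last first.
    by move=> x Bx; rewrite /outside indicE memNset ?mulr0//; apply/not_notP.
  rewrite Na normrM normr_sg normfV (gtr0_norm N0).
  case: (_ != 0); rewrite ?mul0r ?mul0r ?ler01//.
  by rewrite mul1r mulrC ler_pdivrMr// mul1r.
have := le_supV Va; rewrite dualZ// /a mulrAC -normrEsg; apply: le_trans.
by rewrite ler_pdivlMr// ltW.
Qed.

Lemma mixed_space_sum (h : nat -> R -> R) N : (forall i, F (h i)) ->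
  [/\ F (fun x => \sum_(i < N) h i x),
      phi (fun x => \sum_(i < N) h i x) = \sum_(i < N) phi (h i) &
      forall n, Kcoord t d (fun x => \sum_(i < N) h i x) n <= \sum_(i < N) Kcoord t d (h i) n].
Proof.
move=> Fh; elim: N => [|N [F1 p1 K1]].
  have -> : (fun x => \sum_(i < 0) h i x) = (fun=> 0) by apply/funext => x; rewrite big_ord0.
  split => //; first by rewrite dual0 big_ord0.
  move=> n; rewrite big_ord0 -(coord_leP t_gt0 d_gt0)//.
  by apply: le_trans (Kfun_le_enorm t_gt0 d_gt0 n _) _; [case: F0|rewrite (enormE t_gt0 d_gt0)// mixed_norm0].
have -> : (fun x => \sum_(i < N.+1) h i x) = (fun x => \sum_(i < N) h i x) \+ h N.
  by apply/funext => x; rewrite big_ord_recr.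
have [F2 _] := mixed_spaceD t_gt0 d_gt0 F1 (Fh N).
split => // [|n]; first by rewrite dualD// p1 big_ord_recr.
rewrite big_ord_recr /=; apply: le_trans (coordD t_gt0 d_gt0 n F1 (Fh N) F2) _.
by rewrite lerD2r.
Qed.

Lemma upper_bound (a : nat -> R) M : exists2 b, 0 < b & forall n, (n < M)%N -> a n <= b.
Proof.
elim: M => [|M [b b0 H]]; first by exists 1.
exists (Num.max b (a M)); first by rewrite lt_max b0.
move=> n; rewrite ltnS leq_eqVlt => /orP[/eqP ->|/H]; rewrite le_max ?lexx ?orbT//.
by move=> ->.
Qed.

(* If the tails did not vanish, the functional would have almost maximizers carried by
   successive disjoint sets. Uniform convexity of [l^2] makes their coordinate sequences
   close to the first one, so their [l^2] tails are uniformly small; but the low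
   coordinates of averages of disjoint functions vanish, contradicting maximality. *)
Lemma dual_tail e : 0 < e -> exists k, forall h, F h -> `|phi (outside k h)| <= e * NF h.
Proof.
move=> e0; apply: contrapT => /forallNP H.
have {}H k : exists2 h, F h & e * NF h < `|phi (outside k h)|.
  have /existsNP[h /not_implyP[Fh /negP]] := H k.
  by rewrite -ltNge => eh; exists h.
have se k : e <= supV k by apply: supV_ge => //; exact: H.
pose A := [set supV k | k in [set: nat]].
have infA : has_inf A by split; [exists (supV 0%N), 0%N|exists e => _ [k _ <-]].
(* These norms decrease with k; s is their limit, positive by assumption, and k0 brings them within
   one percent of it. *)
pose s := inf A.
have s_gt0 : 0 < s.
  by apply: (lt_le_trans e0); apply: lb_le_inf; [case: infA|move=> _ [k _ <-]].
have sle k : s <= supV k by apply: ge_inf; [case: infA|exists k].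
have [C C0 CP] := dual_const.
have s100 : 0 < s / 100 by rewrite divr_gt0.
have [_ [k0 _ <-] k0P] := inf_adherent s100 infA.
(* On functions vanishing on B k0, phi has norm below 1.01 s, and 98/101 > 97/100. *)
have low u : F u -> (forall x, B k0 x -> u x = 0) -> s * (98 / 100) <= phi u -> 97 / 100 <= NF u.
  move=> Fu u0 su.
  have pu : 0 < phi u by apply: lt_le_trans su; rewrite mulr_gt0// divr_gt0.
  have Nu : 0 < NF u by apply: norm_gt0 => //; rewrite gtr0_norm.
  have [Fv Nv] := mixed_spaceZ t_gt0 d_gt0 (NF u)^-1 Fu.
  have Vu : V k0 (fun x => (NF u)^-1 * u x).
    split => //; last by move=> x /u0 ->; rewrite mulr0.
    by rewrite Nv normfV gtr0_norm// mulVf// gt_eqF.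
  have := le_supV Vu; rewrite dualZ// ler_pdivrMl// => H1.
  have : phi u < NF u * (s + s / 100) by apply: le_lt_trans H1 _; rewrite ltr_pM2l.
  move=> H2; have := le_lt_trans su H2.
  rewrite (_ : NF u * (s + s / 100) = s * (NF u * (101 / 100))); last lra.
  rewrite ltr_pM2l//; lra.
(* A maximiser up to s/100, cut to a large B m at the cost of another s/100. *)
have next k : exists mh : nat * (R -> R), [/\ (k < mh.1)%N, V k mh.2,
    forall x, ~ B mh.1 x -> mh.2 x = 0 & s * (98 / 100) <= phi mh.2].
  have [_ [h Vh <-] hP] := sup_adherent s100 (sup_phi k).
  have [Fh h1 h0] := Vh.
  have sC : 0 < s / 100 / C by rewrite divr_gt0.
  have [||m0 m0P] := @mixed_indic_vanishing h (fun k => ~` B k) _ Fh sC.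
  - by move=> j; exact: measurableC (mB j).
  - move=> x /coverB[j Bj]; exists j => i ji; apply; exact: (ndB ji).
  pose m := maxn m0 k.+1.
  have [Fo No] := m0P m (leq_maxl _ _).
  have [Fi Ni] := mixed_indic Fh (mB m).
  exists (m, fun x => h x * \1_(B m) x); split => /=.
  - exact: leq_maxr.
  - by split => //; [exact: le_trans h1|move=> x /h0 ->; rewrite mul0r].
  - by move=> x nB; rewrite indicE memNset// mulr0.
  - have : phi h = phi (fun x => h x * \1_(B m) x) + phi (fun x => h x * \1_(~` B m) x).
      rewrite -dualD//; congr phi; apply/funext => x /=; rewrite !indicE in_setC.
      by case: (_ \in _); rewrite ?mulr1 ?mulr0 ?addr0 ?add0r.
    have : `|phi (fun x => h x * \1_(~` B m) x)| <= s / 100.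
      apply: le_trans (CP _ Fo) _; rewrite mulrC -ler_pdivlMr//.
    move=> /(le_trans (ler_norm _)) H1 H2.
    have := sle k; move: hP H1; rewrite -/(supV k) H2; lra.
have /choice[nx nxP] := next.
pose m := fix m i := if i is i'.+1 then (nx (m i')).1 else k0.
pose h i := (nx (m i)).2.
have mS i : (m i < m i.+1)%N by case: (nxP (m i)).
have mle i j : (i <= j)%N -> (m i <= m j)%N.
  by move=> /(homo_leq (@leqnn) leq_trans (fun i => ltnW (mS i))).
have Fh i : F (h i) by case: (nxP (m i)) => _ [].
have h1 i : NF (h i) <= 1 by case: (nxP (m i)) => _ [].
have ph i : s * (98 / 100) <= phi (h i) by case: (nxP (m i)).
pose S i := B (m i.+1) `\` B (m i).
have mSi i : measurable (S i) by exact: measurableD.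
have hS i x : ~ S i x -> h i x = 0.
  have [_ [_ _ h0] h0' _] := nxP (m i) => nS.
  have [Bx|nB] := pselect (B (m i) x); first exact: h0.
  by apply: h0' => Bx; apply: nS.
have hk0 i x : B k0 x -> h i x = 0.
  by move=> Bx; apply: hS => -[_]; apply; apply: ndB Bx; exact: (mle 0%N).
have tS : trivIset setT S.
  have disj i j : (i < j)%N -> S i `&` S j !=set0 -> False.
    by move=> ij [x [[Bx _] [_]]]; apply; apply: ndB Bx; exact: mle.
  move=> i j _ _ ne; case: (ltngtP i j) => // ij; first by case: (disj i j ij ne).
  by case: (disj j i ij); rewrite setIC.
have [M HM] := sum_coord_tail t_gt0 d_gt0 (Fh 0%N) (ltac:(rewrite divr_gt0//) : 0 < 1 / 100).
have tail i M' : \sum_(M <= n < M') Kcoord t d (h i) n ^+ 2 <= 65 / 100.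
  have [Fs _] := mixed_spaceD t_gt0 d_gt0 (Fh 0%N) (Fh i).
  have [Fu _] := mixed_spaceZ t_gt0 d_gt0 2^-1 Fs.
  apply: (@coord_tail_near (h 0%N)) => //; apply: low => //.
    by move=> x Bx; rewrite /= !hk0// addr0 mulr0.
  by rewrite dualZ// dualD//; have := ph 0%N; have := ph i; lra.
have [dm dm0 dmP] := upper_bound d M.
have [tm tm0 tmP] := upper_bound t M.
pose eta : R := (3 * M.+1%:R)^-1.
have eta0 : 0 < eta by rewrite invr_gt0 mulr_gt0.
(* The average of disjoint terms satisfies K <= 2 e' = eta / dm with this e', so after
   multiplication by d_n <= dm its coordinate is at most eta. *)
have e'0 : 0 < eta / (2 * dm) by rewrite divr_gt0// mulr_gt0.
have [r r0 rP] := Kfun_uniform e'0.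
(* Enough terms to have t_n <= N r for all n < M. *)
pose N := (Num.truncn (tm / r)).+1.
have [FU pU KU] := mixed_space_sum N Fh.
have N0 : 0 < N%:R :> R by rewrite ltr0n.
have [Fu _] := mixed_spaceZ t_gt0 d_gt0 N%:R^-1 FU.
set u := (fun x => N%:R^-1 * _) in Fu.
have Nu : 97 / 100 <= NF u.
  apply: low => //.
    by move=> x Bx; rewrite /u big1 ?mulr0// => i _; exact: hk0.
  rewrite dualZ// pU ler_pdivlMl//.
  apply: (@le_trans _ _ (\sum_(i < N) s * (98 / 100))); last by apply: ler_sum => i _; exact: ph.
  by rewrite sumr_const card_ord -[X in _ <= X]mulr_natl.
have uc n : Kcoord t d u n <= N%:R^-1 * \sum_(i < N) Kcoord t d (h i) n.
  by rewrite /u (coordZ t_gt0 d_gt0)// ger0_norm ?invr_ge0 ?ler0n// ler_pM2l// invr_gt0.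
(* Convexity of the square lets the average inherit the common tail bound. *)
have uc2 n : Kcoord t d u n ^+ 2 <= N%:R^-1 * \sum_(i < N) Kcoord t d (h i) n ^+ 2.
  apply: (@le_trans _ _ ((N%:R^-1 * \sum_(i < N) Kcoord t d (h i) n) ^+ 2)).
    rewrite ler_sqr ?nnegrE; [exact: uc|exact: coord_ge0|].
    by rewrite mulr_ge0 ?invr_ge0 ?ler0n//; apply: sumr_ge0 => i _; exact: coord_ge0.
  rewrite exprMn expr2 -mulrA ler_pM2l ?invr_gt0// ler_pdivrMl//.
  exact: (@sqr_sum_le N (fun i => Kcoord t d (h i) n)).
have utail M' : \sum_(M <= n < M') Kcoord t d u n ^+ 2 <= 65 / 100.
  apply: (@le_trans _ _ (\sum_(M <= n < M') (N%:R^-1 * \sum_(i < N) Kcoord t d (h i) n ^+ 2))).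
    by apply: ler_sum => n _.
  rewrite -mulr_sumr exchange_big /= ler_pdivrMl//.
  apply: (@le_trans _ _ (\sum_(i < N) 65 / 100)); first by apply: ler_sum => i _; exact: tail.
  by rewrite sumr_const card_ord -[X in X <= _]mulr_natl.
have uhead n : (n < M)%N -> Kcoord t d u n <= eta.
  move=> nM; rewrite -(coord_leP t_gt0 d_gt0)//.
  have e'0' := ltW e'0.
  have tN : t n <= N%:R * r.
    rewrite -ler_pdivrMr//; apply: (@le_trans _ _ (tm / r)); last by rewrite ltW// truncnS_gt.
    by rewrite ler_pM2r ?invr_gt0// tmP.
  have := @Kfun_disjoint_average h S N r (t n) (eta / (2 * dm)) r0 (t_gt0 n) e'0' _ tN rP Fh h1 tS mSi hS.
  move=> /(_ isT)/(@lee_wpmul2l _ (d n)%:E); rewrite lee_fin => /(_ (ltW (d_gt0 n))).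
  move=> /le_trans; apply; rewrite -EFinM lee_fin invfM (mulrCA 2) (mulrA 2) divff//.
  rewrite mul1r mulrCA ler_piMr ?(ltW eta0)//.
  by rewrite ler_pdivrMr// mul1r dmP.
have := norm_le_of_head_tail Fu uhead utail.
move: Nu; lra.
Qed.

End Tail.
End Reflexive.

(** * Reflexivity of mixed spaces *)

Section Reflexivity.
Variable R : realType.
Local Notation mu := (@lebesgue_measure R).
Local Notation D := (@pos_half R).
Implicit Types (b f g h s : R -> R) (c e : R).
Variables (t d : nat -> R).
Hypotheses (t_gt0 : forall n, 0 < t n) (d_gt0 : forall n, 0 < d n).
Hypothesis d_min : forall n, d n * Num.min (t n) 1 <= 2^-1 ^+ n.
Hypothesis d_inf : forall m, exists2 n, (m <= n)%N & 1 <= d n * t n.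
Hypothesis d_ge1 : forall m, exists2 n, (m <= n)%N & 1 <= d n.
Local Notation F := (mixed_space t d).
Local Notation NF := (mixed_norm t d).

Local Notation normf b := (fun x => `|b x|).

Definition inner b h : R := fine (\int[mu]_(x in D) (b x * h x)%:E)%E.

Lemma weight_norm b : mes b -> weight (normf b).
Proof. by move=> mb; split => //; exact: mes_norm. Qed.

Lemma pairing_le_weight g g' h : mes g -> mes g' -> mes h ->
  (forall x, D x -> 0 <= g x <= g' x) -> (pairing g h <= pairing g' h)%E.
Proof.
move=> mg mg' mh gg; apply: ge0_le_integral => //; try exact: mes_pairing.
- by move=> x /gg /andP[g0 _]; rewrite lee_fin mulr_ge0.
- by move=> x /gg /andP[g0 g1]; rewrite lee_fin ler_wpM2r.
Qed.

Lemma integrable_mul b h : mes b -> mes h -> (pairing (normf b) h < +oo)%E ->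
  mu.-integrable D (fun x => (b x * h x)%:E).
Proof.
move=> mb mh H; apply/integrableP; split.
  by apply/measurable_EFinP; exact: measurable_funM.
apply: le_lt_trans H; apply: ge0_le_integral => //.
- by apply: measurableT_comp => //; apply/measurable_EFinP; exact: measurable_funM.
- by apply: mes_pairing => //; exact: mes_norm.
- by move=> x _; rewrite abse_EFin lee_fin normrM.
Qed.

Lemma innerE b h : mes b -> mes h -> (pairing (normf b) h < +oo)%E ->
  (\int[mu]_(x in D) (b x * h x)%:E)%E = (inner b h)%:E.
Proof.
move=> mb mh H; rewrite /inner fineK//; apply: integrable_fin_num => //.
exact: integrable_mul.
Qed.

Lemma inner_le b h c : mes b -> mes h -> (pairing (normf b) h <= c%:E)%E ->
  `|inner b h| <= c.
Proof.
move=> mb mh H; have Hfin := le_lt_trans H (ltry c).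
rewrite -lee_fin -abse_EFin -innerE//; apply: le_trans H.
apply: (le_trans (le_abse_integral _ _ _)) => //.
  by apply/measurable_EFinP; exact: measurable_funM.
apply: ge0_le_integral => //.
- by apply: measurableT_comp => //; apply/measurable_EFinP; exact: measurable_funM.
- by apply: mes_pairing => //; exact: mes_norm.
- by move=> x _; rewrite abse_EFin lee_fin normrM.
Qed.

Lemma eq_inner b b' h h' : (forall x, D x -> b x * h x = b' x * h' x) -> inner b h = inner b' h'.
Proof. by move=> E; congr fine; apply: eq_integral => x /set_mem/E ->. Qed.

Lemma innerDr b f h c : mes b -> mes f -> mes h ->
  (pairing (normf b) f < +oo)%E -> (pairing (normf b) h < +oo)%E ->
  inner b (fun x => f x + c * h x) = inner b f + c * inner b h.
Proof.
move=> mb mf mh Hf Hh; apply: EFin_inj; rewrite EFinD EFinM -!innerE//; last first.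
  have mch : mes (fun x => c * h x) by exact: mesZ.
  apply: le_lt_trans (pairingD (weight_norm mb) mf mch) _.
  rewrite pairingZ//; last exact: weight_norm.
  by apply: lte_add_pinfty => //; rewrite lte_mul_pinfty ?lee_fin.
  by apply: measurable_funD => //; exact: mesZ.
have I1 := integrable_mul mb mf Hf; have I2 := integrable_mul mb mh Hh.
rewrite -integralZl// -integralD//; last exact: integrableZl.
by apply: eq_integral => x _; rewrite -EFinM -EFinD mulrDr mulrCA.
Qed.

Lemma innerC b h : inner b h = inner h b.
Proof. by apply: eq_inner => x _; rewrite mulrC. Qed.

Lemma pairing_normC b h : pairing (normf b) h = pairing (normf h) b.
Proof. by apply: eq_integral => x _; rewrite mulrC. Qed.

(** b belongs to the Koethe dual of F, with norm at most c. *)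
Definition admissible b c := [/\ mes b, 0 <= c &
  forall h, F h -> (pairing (normf b) h <= (c * NF h)%:E)%E].

Lemma inner_bound b c : admissible b c -> dual_bound F NF (inner b) c.
Proof. by move=> [mb c0 H]; split => // h Fh; apply: inner_le; [|case: Fh|exact: H]. Qed.

Lemma inner_dual b c : admissible b c -> dual_elt F NF (inner b).
Proof.
move=> ab; have [mb c0 H] := ab; have [_ bc] := inner_bound ab.
split; last by exists c.
move=> f h a Ff Fh; apply: innerDr => //; try by [case: Ff|case: Fh].
  by apply: le_lt_trans (H _ Ff) _; exact: ltry.
by apply: le_lt_trans (H _ Fh) _; exact: ltry.
Qed.

Lemma admissible_exp s c : mes s -> (forall x, `|s x| <= c) ->
  admissible (fun x => exp_weight x * s x) (c * exp_const t d).
Proof.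
move=> ms sc; have c0 : 0 <= c by apply: le_trans (sc 0).
have mws : mes (fun x => exp_weight x * s x).
  by apply: measurable_funM => //; exact: mes_exp_weight.
split => //; first by rewrite mulr_ge0// ltW// exp_const_gt0.
move=> h Fh; have [mh _] := Fh.
apply: (@le_trans _ _ (pairing (fun x => c * exp_weight x) h)).
  apply: pairing_le_weight => //; first exact: mes_norm.
    by apply: mesZ; exact: mes_exp_weight.
  move=> x _; rewrite normr_ge0 normrM (gtr0_norm (exp_weight_gt0 x)) mulrC /=.
  by rewrite ler_wpM2r// ltW// exp_weight_gt0.
rewrite pairing_Zweight//; last exact: weight_exp_weight.
rewrite -mulrA EFinM; apply: lee_wpmul2l; first by rewrite lee_fin.
exact: pairing_exp_weight_le.
Qed.

Lemma admissible_mixed_weight b g : mes b -> mixed_weights t d g ->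
  (forall x, D x -> `|b x| <= g x) -> admissible b 1.
Proof.
move=> mb wg bg; have [mg g0] := mixed_weight_weight d_gt0 wg; split => // h Fh.
have [mh _] := Fh; rewrite mul1r -(enormE t_gt0 d_gt0 Fh).
apply: le_trans (pairing_gauge h wg); apply: pairing_le_weight => //.
  exact: mes_norm.
by move=> x /bg ->; rewrite normr_ge0.
Qed.

(** Convergence in dual norm, not only pointwise on F: after scaling into [0, 1] the densities have
    integrals tending to 0, so they are eventually unit weights of the small mass r given by
    [Kfun_uniform]. *)
Lemma admissible_vanishing (s : nat -> R -> R) c e : 0 < e ->
  (forall k, mes (s k)) -> (forall k x, `|s k x| <= c) ->
  {ae mu, forall x, D x -> s ^~ x @ \oo --> 0} ->
  exists k0, forall k, (k0 <= k)%N -> admissible (fun x => exp_weight x * s k x) e.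
Proof.
move=> e0 ms sc s0; pose c' := `|c| + 1.
have c'0 : 0 < c' by rewrite ltr_wpDl.
have [r r0 rP] := Kfun_uniform t_gt0 d_gt0 d_ge1 (divr_gt0 e0 c'0).
have sc' k x : `|s k x| / c' <= 1.
  by rewrite ler_pdivrMr// mul1r (le_trans (sc k x))// (le_trans (ler_norm c))// lerDl.
pose a k x := exp_weight x * (`|s k x| / c') * \1_D x.
have ma k : mes (a k).
  apply: measurable_funM; last exact: measurable_indic.
  apply: measurable_funM; first exact: mes_exp_weight.
  by apply: measurable_funM; [exact: mes_norm|exact: measurable_cst].
have a01 k x : 0 <= a k x <= 1.
  rewrite /a indicE; case: (boolP (x \in D)); rewrite ?mulr0 ?lexx ?ler01//= mulr1.
  move=> /set_mem; rewrite pos_halfE => x0.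
  have w0 := exp_weight_gt0 x; have w1 := exp_weight_le1 x0.
  have q0 : 0 <= `|s k x| / c' by rewrite divr_ge0// ltW.
  by rewrite mulr_ge0 ?(ltW w0)//= mulr_ile1// ltW.
have iw : mu.-integrable D (EFin \o (@exp_weight R)).
  apply/integrableP; split; first by apply/measurable_EFinP; exact: mes_exp_weight.
  apply: le_lt_trans (ltry 1); apply: le_trans (@integral_exp_weight R).
  by rewrite le_eqVlt; apply/orP; left; apply/eqP; apply: eq_integral => x _ /=;
    rewrite gtr0_norm// exp_weight_gt0.
have A : ((\int[mu]_(x in D) (a k x)%:E)%E @[k --> \oo] --> (\int[mu]_(x in D) (0 : R)%:E)%E).
  apply: (cvg_integral_dominated ma _ iw) => //.
    move: s0; apply: filterS => x /[apply] sx.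
    have -> : (0 : R) = exp_weight x * (`|0 : R| / c') * \1_D x by rewrite normr0 mul0r mulr0 mul0r.
    apply: cvgMl; apply: cvgMr; apply: cvgMl; exact: cvg_norm.
  move=> k; apply: aeW => x Dx; rewrite ger0_norm; last by case/andP: (a01 k x).
  by rewrite /a indicE mem_set// mulr1 ler_piMr// ltW// exp_weight_gt0.
rewrite integral0 in A.
have [k0 k0P] := cvge_eventually_lt A (ltac:(rewrite lte_fin; exact: r0) : (0 < r%:E)%E).
exists k0 => k /k0P ak; have mws : mes (fun x => exp_weight x * s k x).
  by apply: measurable_funM => //; exact: mes_exp_weight.
split => //; first exact: ltW.
move=> h Fh; have [mh _] := Fh.
have ua : unit_weights r (a k) by split => //; exact: ltW.
apply: (@le_trans _ _ (pairing (fun x => c' * a k x) h)).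
  apply: pairing_le_weight => //; [exact: mes_norm|exact: mesZ|].
  move=> x Dx; rewrite normr_ge0 /a indicE mem_set// mulr1 normrM gtr0_norm ?exp_weight_gt0//=.
  by rewrite mulrCA (mulrCA c') divff ?mulr1// gt_eqF.
rewrite pairing_Zweight//; [|exact: ltW|exact: unit_weight_weight ua].
apply: (@le_trans _ _ (c'%:E * (e / c' * NF h)%:E)%E).
  apply: lee_wpmul2l; first by rewrite lee_fin ltW.
  by apply: le_trans (pairing_gauge h ua) _; exact: rP.
by rewrite -EFinM lee_fin mulrA mulrCA divff ?mulr1// gt_eqF.
Qed.

Lemma ler_eps_eq0 (a C : R) : (forall e, 0 < e -> `|a| <= C * e) -> a = 0.
Proof.
move=> H; apply/eqP; rewrite -normr_eq0 -[_ == _]negbK; apply/negP => a0.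
have {}a0 : 0 < `|a| by rewrite lt_def a0 normr_ge0.
have C0 : 0 < `|C| + 1 by rewrite ltr_wpDl.
have e0 : 0 < `|a| / (2 * (`|C| + 1)) by rewrite divr_gt0// mulr_gt0.
have := H _ e0; apply/negP; rewrite -ltNge.
apply: (@le_lt_trans _ _ ((`|C| + 1) * (`|a| / (2 * (`|C| + 1))))).
  by rewrite ler_wpM2r ?(ltW e0)// (le_trans (ler_norm C))// lerDl.
rewrite invfM mulrCA (mulrCA (`|C| + 1)) divff ?gt_eqF// mulr1.
by rewrite ltr_pdivrMr// ltr_pMr// ltr1n.
Qed.

Lemma dualB phi psi : dual_elt F NF phi -> dual_elt F NF psi ->
  dual_elt F NF (fun f => phi f + -1 * psi f).
Proof.
move=> [plin [C CP]] [qlin [C' CP']]; split.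
  by move=> f h a Ff Fh; rewrite plin// qlin// !mulN1r mulrDr mulrN opprD addrACA.
exists (C + C') => f Ff; rewrite mulN1r mulrDl; apply: (le_trans (ler_normB _ _)).
by rewrite lerD ?CP ?CP'.
Qed.

(* Truncations are norm dense in [F]. *)
Lemma dual_ext phi psi : dual_elt F NF phi -> dual_elt F NF psi ->
  (forall f c, F f -> (forall x, `|f x| <= c) -> phi f = psi f) ->
  forall f, F f -> phi f = psi f.
Proof.
move=> dphi dpsi H f Ff; have [mf _] := Ff.
have dq := dualB dphi dpsi; set q := (fun f => _) in dq.
have q0 g c : F g -> (forall x, `|g x| <= c) -> q g = 0.
  by move=> Fg gc; rewrite /q (H g c)// mulN1r subrr.
apply/eqP; rewrite -subr_eq0 -mulN1r; apply/eqP; rewrite -/(q f).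
have [C C0 CP] := dual_const t_gt0 d_gt0 dq.
apply: (@ler_eps_eq0 _ C) => e e0.
pose A k := D `&` [set x | k%:R < `|f x|].
have mA k : measurable (A k) by exact: measurable_levelset.
have [|k0 /(_ k0 (leqnn _)) [FA NA]] := mixed_indic_vanishing t_gt0 d_gt0 d_inf Ff e0 mA.
  move=> x _; exists (Num.truncn `|f x|).+1 => k fk [_ /=]; apply/negP; rewrite -leNgt.
  by rewrite ltW// (lt_le_trans (truncnS_gt _))// ler_nat.
have mDA : measurable (D `&` ~` A k0) by apply: measurableI => //; exact: measurableC.
have [FB _] := mixed_indic t_gt0 d_gt0 Ff mDA.
(* The values of f at x <= 0 are arbitrary and may be unbounded; this part is split off and has norm
   0. *)
have mnD : measurable (~` D) by exact: measurableC.
have [FN NN] := mixed_indic t_gt0 d_gt0 Ff mnD.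
have [qlin _] := dq.
have FAN := (mixed_spaceD t_gt0 d_gt0 FA FN).1.
have -> : q f = q (fun x => f x * \1_(D `&` ~` A k0) x) +
    q ((fun x => f x * \1_(A k0) x) \+ (fun x => f x * \1_(~` D) x)).
  rewrite -[X in _ + X]mul1r -qlin//; congr q; apply/funext => x /=.
  rewrite mul1r !indicE in_setI !in_setC.
  have : x \in A k0 -> x \in D by rewrite !inE => -[].
  case: (x \in A k0) => [->//|_]; rewrite ?mulr0 ?mulr1 ?add0r ?addr0 //=.
  by case: (x \in D); rewrite ?mulr0 ?mulr1 ?add0r ?addr0.
rewrite (q0 _ k0%:R) ?add0r//; last first.
  move=> x; rewrite indicE; case: (boolP (x \in _)) => [/set_mem[Dx nA]|]; last by rewrite mulr0 normr0.
  by rewrite mulr1 leNgt; apply/negP => fx; apply: nA; split.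
have N0 : NF (fun x => f x * \1_(~` D) x) = 0.
  apply/(mixed_norm_zero t_gt0 d_gt0 d_min FN); apply/ae_zeroP; first by case: FN.
  by apply: aeW => x Dx; rewrite indicE memNset ?mulr0//; exact.
apply: le_trans (CP _ FAN) _; rewrite ler_wpM2l ?(ltW C0)//.
by apply: le_trans (mixed_spaceD t_gt0 d_gt0 FA FN).2 _; rewrite N0 addr0.
Qed.

(** * Representation of second-order functionals *)

Section Bidual.
Variable Phi : ((R -> R) -> R) -> R.
Hypothesis bidual_Phi : bidual_elt F NF Phi.

Lemma bidual_const : exists2 C, 0 <= C & forall phi psi M,
  dual_elt F NF phi -> dual_elt F NF psi -> 0 <= M ->
  (forall f, F f -> `|phi f - psi f| <= M * NF f) -> `|Phi phi - Phi psi| <= C * M.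
Proof.
have [lin [C CP]] := bidual_Phi; exists `|C| => // phi psi M dphi dpsi M0 H.
rewrite -mulN1r -lin//; apply: le_trans (CP _ M (dualB dphi dpsi) _) _.
  by split => // f Ff; rewrite mulN1r; exact: H.
by rewrite ler_wpM2r// ler_norm.
Qed.

(** Functionals are defined on all functions, so two that agree on F may still differ; the bound on
    [Phi] with M = 0 identifies them. *)
Lemma bidual_ext phi psi : dual_elt F NF phi -> dual_elt F NF psi ->
  (forall f, F f -> phi f = psi f) -> Phi phi = Phi psi.
Proof.
move=> dphi dpsi H; have [C C0 CP] := bidual_const.
apply/eqP; rewrite -subr_eq0 -normr_le0 -(mulr0 C); apply: CP => // f Ff.
by rewrite H// subrr normr0 mul0r.
Qed.

(** Restricting [Phi] to the functionals with density [exp_weight * s] gives a functional of bounded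
    s, to which the representation by densities applies. *)
Let L s := Phi (inner (fun x => exp_weight x * s x)).

Let dualw s : bounded_mes s -> dual_elt F NF (inner (fun x => exp_weight x * s x)).
Proof. by move=> [ms [c sc]]; exact: inner_dual (admissible_exp ms sc). Qed.

Let pairingw s f : bounded_mes s -> F f ->
  (pairing (normf (fun x => (exp_weight x * s x)%R)) f < +oo)%E.
Proof.
move=> [ms [c sc]] Ff; have [_ _ H] := admissible_exp ms sc.
by apply: le_lt_trans (H _ Ff) _; exact: ltry.
Qed.

Let mesw s : bounded_mes s -> mes (fun x => exp_weight x * s x).
Proof. by move=> [ms _]; apply: measurable_funM => //; exact: mes_exp_weight. Qed.

Let L_linear s s' c : bounded_mes s -> bounded_mes s' ->
  L (fun x => s x + c * s' x) = L s + c * L s'.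
Proof.
move=> bs bs'; have [lin _] := bidual_Phi.
have d1 := dualw bs; have d2 := dualw bs'; have d3 := dualw (bounded_mesD c bs bs').
rewrite /L -lin//; apply: bidual_ext => //.
  have [l1 [C1 CP1]] := d1; have [l2 [C2 CP2]] := d2; split.
    by move=> f h a Ff Fh; rewrite l1// l2// !mulrDr addrACA (mulrCA c).
  exists (C1 + `|c| * C2) => f Ff; apply: (le_trans (ler_normD _ _)); rewrite mulrDl.
  by rewrite lerD ?CP1// normrM -mulrA ler_wpM2l// CP2.
move=> f Ff; have [mf _] := Ff; rewrite 3!(innerC _ f) -innerDr//.
- by apply: eq_inner => x _; rewrite mulrDr mulrCA.
- exact: mesw.
- exact: mesw.
- by rewrite pairing_normC; exact: pairingw.
- by rewrite pairing_normC; exact: pairingw.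
Qed.

Let L_le s c : admissible (fun x => exp_weight x * s x) c ->
  forall C, (forall phi psi M, dual_elt F NF phi -> dual_elt F NF psi -> 0 <= M ->
  (forall f, F f -> `|phi f - psi f| <= M * NF f) -> `|Phi phi - Phi psi| <= C * M) ->
  `|L s| <= C * c.
Proof.
move=> ad C CP; have [_ c0 _] := ad; have dL := inner_dual ad; have [_ bd] := inner_bound ad.
have b0 : bounded_mes (fun=> 0 : R).
  by split; [exact: measurable_cst|exists 0 => x; rewrite normr0].
have E0 f : inner (fun x => exp_weight x * 0) f = 0.
  rewrite /inner; under eq_integral do rewrite mulr0 mul0r.
  by rewrite integral0.
have L0 : L (fun=> 0) = 0.
  have := L_linear 1 b0 b0.
  rewrite (_ : (fun x : R => 0 + 1 * 0) = fun=> 0); first by lra.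
  by apply/funext => x; rewrite mulr0 addr0.
rewrite -[L s]subr0 -L0; apply: CP => // [|f Ff]; first exact: dualw.
by rewrite E0 subr0; exact: bd.
Qed.

Let L_cont (s : nat -> R -> R) c : (forall k, mes (s k)) ->
  (forall k x, `|s k x| <= c) ->
  {ae mu, forall x, D x -> s ^~ x @ \oo --> 0} -> (fun k => L (s k)) @ \oo --> 0.
Proof.
move=> ms sc s0; have [C C0 CP] := bidual_const.
apply/cvgrPdist_lt => e e0; have C1 : 0 < C + 1 by rewrite ltr_wpDl.
have [k0 k0P] := admissible_vanishing (divr_gt0 e0 C1) ms sc s0.
near=> k; rewrite sub0r normrN; apply: (@le_lt_trans _ _ (C * (e / (C + 1)))).
  by apply: L_le CP; apply: k0P; near: k; exact: nbhs_infty_ge.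
by rewrite mulrCA gtr_pMr// ltr_pdivrMr// mul1r ltrDl.
Unshelve. all: by end_near. Qed.

(** If L s is the integral of f0 s, the candidate is f0 divided by the weight. Its norm is tested
    against a mixed weight g: the functional with density sg(f0) g has norm at most 1, so the
    integral of g |fhat| is bounded by the constant of [Phi]. *)
Lemma bidual_repr : exists2 fhat, F fhat &
  forall s, bounded_mes s ->
    Phi (inner (fun x => exp_weight x * s x)) = inner (fun x => exp_weight x * s x) fhat.
Proof.
pose f0 := density L_linear L_cont.
have mf0 : mes f0 by exact: mes_density.
have f0P s : bounded_mes s -> L s = inner f0 s.
  by move=> bs; rewrite /inner -(densityP L_linear L_cont bs).
pose winv (x : R) := expR x.
have winvE x : exp_weight x * winv x = 1 by rewrite /exp_weight /winv expRN mulVf// gt_eqF ?expR_gt0.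
have mwinv : mes winv by apply: measurableT_comp; [exact: measurable_expR|exact: measurable_id].
pose fhat x := f0 x * winv x.
have mfhat : mes fhat by exact: measurable_funM.
have [C C0 CP] := bidual_const.
suff Cf : (enorm t d fhat <= C%:E)%E.
  exists fhat; first exact: (mixed_space_le t_gt0 d_gt0 mfhat Cf).1.
  move=> s bs; rewrite -/(L s) f0P//; apply: eq_inner => x _.
  by rewrite /fhat (mulrC (f0 x) (winv x)) mulrACA winvE mul1r mulrC.
apply/gauge_leP => g Gg; have [mg g0] := mixed_weight_weight d_gt0 Gg.
pose T j := [set` `]-oo, j%:R]] : set R.
have mT j : measurable (T j) by exact: measurable_itv.
pose u j x := fhat x * \1_(T j) x.
have mu' j : mes (u j) by apply: measurable_funM => //; exact: measurable_indic.
apply: (@pairing_fatou _ g u fhat _ 0) => //.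
  apply: aeW => x _; apply/cvgrPdist_lt => e e0; near=> j.
  rewrite /u indicE mem_set ?mulr1 ?subrr ?normr0//.
  by rewrite /T /= in_itv /=; near: j; exact: nbhs_infty_ger.
move=> j _.
have [cg cgP] : exists cg, forall x, g x <= cg.
  have [M [b [v [b0 _ vt ->]]]] := Gg; exists (\sum_(n < M) b n * d n) => x.
  apply: ler_sum => n _; rewrite ler_piMr// ?mulr_ge0 ?(ltW (d_gt0 n))//.
  by have [_ /(_ x) /andP[]] := vt n.
(* [winv] grows exponentially; the cut at j makes s bounded, and Fatou's lemma removes it. *)
pose s x := Num.sg (f0 x) * g x * winv x * \1_(T j) x.
have msg : mes (fun x => Num.sg (f0 x)).
  rewrite (_ : (fun x => _) = fun x => \1_[set y : R | 0 < y] (f0 x) - \1_[set y : R | y < 0] (f0 x)).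
    by apply: measurable_funB; apply: measurableT_comp => //; apply: measurable_indic;
      rewrite -?set_itvoy -?set_itvNyo; exact: measurable_itv.
  apply/funext => x; rewrite !indicE.
  have [h|h|->] := ltgtP (f0 x) 0.
  - by rewrite ltr0_sg// memNset ?mem_set ?sub0r//= => /(lt_trans h); rewrite ltxx.
  - by rewrite gtr0_sg// mem_set// memNset ?subr0//= => /(lt_trans h); rewrite ltxx.
  - by rewrite sgr0 !memNset ?subrr//= ltxx.
have ms : mes s.
  apply: measurable_funM; last exact: measurable_indic.
  by apply: measurable_funM => //; exact: measurable_funM.
have sg1 x : `|Num.sg (f0 x)| <= 1 by rewrite normr_sg; case: (_ != 0).
have bs : bounded_mes s.
  split=> //; exists (`|cg| * expR j%:R) => x.
  rewrite /s indicE; case: (boolP (x \in T j)) => [/set_mem|_]; last first.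
    by rewrite mulr0 normr0 mulr_ge0// ltW// expR_gt0.
  rewrite /T /= in_itv /= => xj; rewrite mulr1 !normrM (ger0_norm (g0 x)) (gtr0_norm (expR_gt0 x)).
  apply: ler_pM; rewrite ?mulr_ge0 ?(ltW (expR_gt0 _)) ?ler_expR//.
  apply: (@le_trans _ _ (1 * g x)); first by rewrite ler_wpM2r.
  by rewrite mul1r (le_trans (cgP x))// ler_norm.
have ad : admissible (fun x => exp_weight x * s x) 1.
  apply: (admissible_mixed_weight (mesw bs) Gg) => x _.
  rewrite /s mulrA (mulrC (_ * g x)) mulrA winvE mul1r !normrM (ger0_norm (g0 x)).
  rewrite indicE; case: (_ \in _); rewrite ?normr1 ?normr0 ?mulr0// mulr1.
  by rewrite -[leRHS]mul1r ler_wpM2r.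
have := L_le ad CP; rewrite mulr1 -lee_fin; apply: le_trans.
have E : (pairing g (u j) = \int[mu]_(x in D) (f0 x * s x)%:E)%E.
  apply: eq_integral => x _; congr (_%:E); rewrite /u /s /fhat !normrM (gtr0_norm (expR_gt0 x)).
  rewrite !mulrA (mulrC (f0 x)) -normrEsg indicE; case: (_ \in _); rewrite ?normr1 ?normr0 ?mulr0// !mulr1.
  by rewrite (mulrC (g x)) -/(winv x).
by rewrite E -(densityP L_linear L_cont bs) lee_fin ler_norm.
Unshelve. all: by end_near. Qed.

End Bidual.

Lemma mixed_exp_le s c : mes s -> (forall x, `|s x| <= c) ->
  F (fun x => exp_weight x * s x).
Proof.
move=> ms sc; have c0 : 0 <= c by apply: le_trans (sc 0).
have mws : mes (fun x => exp_weight x * s x).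
  by apply: measurable_funM => //; exact: mes_exp_weight.
have ws x : `|exp_weight x * s x| <= c * exp_weight x.
  rewrite normrM (gtr0_norm (exp_weight_gt0 x)) mulrC ler_wpM2r//.
  by rewrite ltW// exp_weight_gt0.
apply: (mixed_space_bounded t_gt0 d_gt0 d_min mws c0 _ _).1.
  move=> x x0; apply: le_trans (ws x) _; rewrite ler_piMr//.
  exact: exp_weight_le1.
apply: (@le_trans _ _ (\int[mu]_(x in D) (c%:E * (exp_weight x)%:E))%E).
  apply: ge0_le_integral => //.
  - by apply/measurable_EFinP; exact: mes_norm.
  - apply: measurable_funeM; apply/measurable_EFinP; exact: mes_exp_weight.
  - by move=> x _; rewrite -EFinM lee_fin.
rewrite ge0_integralZl_EFin//.
- by rewrite -[leRHS]mule1; apply: lee_wpmul2l; [rewrite lee_fin|exact: integral_exp_weight].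
- by move=> x _; rewrite lee_fin ltW// exp_weight_gt0.
- by apply/measurable_EFinP; exact: mes_exp_weight.
Qed.

(** * Approximation of functionals by densities *)

Section DualRepr.
Variable phi : (R -> R) -> R.
Hypothesis dual_phi : dual_elt F NF phi.

Let L s := phi (fun x => exp_weight x * s x).

Let L_linear s s' c : bounded_mes s -> bounded_mes s' ->
  L (fun x => s x + c * s' x) = L s + c * L s'.
Proof.
move=> [ms [a sa]] [ms' [a' sa']]; have [lin _] := dual_phi.
rewrite /L -lin; [|exact: mixed_exp_le sa|exact: mixed_exp_le sa'].
by congr phi; apply/funext => x /=; rewrite mulrDr mulrCA.
Qed.

Let L_cont (s : nat -> R -> R) c : (forall k, mes (s k)) ->
  (forall k x, `|s k x| <= c) ->
  {ae mu, forall x, D x -> s ^~ x @ \oo --> 0} -> (fun k => L (s k)) @ \oo --> 0.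
Proof.
move=> ms sc s0; have [C C0 CP] := dual_const t_gt0 d_gt0 dual_phi.
have c0 : 0 <= c by apply: le_trans (sc 0%N 0).
(* Index 0 holds the dominating function, an exponential multiple of c. *)
pose u k := if k is k'.+1 then (fun x => exp_weight x * s k' x) else (fun x => exp_weight x * c).
have Fu k : F (u k).
  case: k => [|k]; first apply: (@mixed_exp_le _ c); last exact: mixed_exp_le (sc k).
    exact: measurable_cst.
  by move=> x; rewrite ger0_norm.
apply/cvgrPdist_lt => e e0.
have [| | | |k0 k0P] := mixed_norm_order_continuous t_gt0 d_gt0 d_inf (u := u) (divr_gt0 e0 (mulr_gt0 C0 (ltr0Sn R 1))).
- by move=> k; case: (Fu k).
- exact: Fu.
- case=> [|k]; apply: aeW => // x _ /=; rewrite !normrM ler_wpM2l//.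
  by rewrite (ger0_norm c0).
- move: s0; apply: filterS => x /[apply] sx.
  have H : (fun k => exp_weight x * s k x) @ \oo --> exp_weight x * 0 by apply: cvgMr.
  by rewrite -(cvg_shiftS (u ^~ x)); rewrite mulr0 in H.
near=> k; rewrite sub0r normrN; apply: (le_lt_trans (CP _ (Fu k.+1))).
apply: (@le_lt_trans _ _ (C * (e / (C * 2)))).
  rewrite ler_wpM2l ?(ltW C0)//; apply: k0P; rewrite leqW//.
  by near: k; exact: nbhs_infty_ge.
by rewrite mulrCA gtr_pMr// ltr_pdivrMr ?mulr_gt0// mul1r ltr_pMr// ltr1n.
Unshelve. all: by end_near. Qed.

(** On a set where the density of phi and x itself are bounded, phi is given by a density of the
    required form; the rest is small by [dual_tail]. *)
Lemma dual_approx e : 0 < e -> exists2 s, bounded_mes s &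
  forall h, F h -> `|phi h - inner (fun x => exp_weight x * s x) h| <= e * NF h.
Proof.
move=> e0; pose g0 := density L_linear L_cont.
have mg0 : mes g0 by exact: mes_density.
pose winv (x : R) := expR x.
have winvE x : exp_weight x * winv x = 1 by rewrite /exp_weight /winv expRN mulVf// gt_eqF ?expR_gt0.
have mwinv : mes winv by apply: measurableT_comp; [exact: measurable_expR|exact: measurable_id].
have winv0 x : 0 < winv x by exact: expR_gt0.
pose ghat x := g0 x * winv x.
have mghat : mes ghat by exact: measurable_funM.
pose T j := [set` `]-oo, j%:R]] : set R.
have mT j : measurable (T j) by exact: measurable_itv.
(* Both conditions are needed for [ghat * winv] to be bounded on B k. *)
pose B k := (D `&` [set x | `|ghat x| <= k%:R]) `&` T k.
have mB k : measurable (B k).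
  apply: measurableI => //; apply: measurable_pos_half_le; first exact: mes_norm.
  exact: measurable_cst.
have ndB m n : (m <= n)%N -> B m `<=` B n.
  move=> mn x [[Dx gx] Tx]; have mn' : m%:R <= n%:R :> R by rewrite ler_nat.
  split; first by split => //=; exact: le_trans mn'.
  by move: Tx; rewrite /T /= !in_itv /= => /le_trans; apply.
have coverB x : D x -> exists k, B k x.
  move=> Dx; exists (maxn (Num.truncn `|ghat x|).+1 (Num.truncn `|x|).+1); split; [split => //=|].
    by rewrite ltW// (lt_le_trans (truncnS_gt _))// ler_nat leq_maxl.
  rewrite /T /= in_itv /= (le_trans (ler_norm x))// ltW// (lt_le_trans (truncnS_gt _))//.
  by rewrite ler_nat leq_maxr.
have [k kP] := dual_tail t_gt0 d_gt0 d_min d_inf d_ge1 dual_phi mB ndB coverB e0.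
have winv_le x : T k x -> winv x <= expR k%:R by rewrite /T /= in_itv /= ler_expR.
pose s x := ghat x * winv x * \1_(B k) x.
have ms : mes s.
  by apply: measurable_funM; [exact: measurable_funM|exact: measurable_indic].
have sb x : `|s x| <= k%:R * expR k%:R.
  rewrite /s indicE; case: (boolP (x \in B k)) => [/set_mem[[_ /= gx] Tx]|_]; last first.
    by rewrite mulr0 normr0 mulr_ge0// ltW// expR_gt0.
  rewrite mulr1 normrM (gtr0_norm (winv0 x)) ler_pM ?(ltW (winv0 x))//.
  exact: winv_le.
have ad := admissible_exp ms sb.
exists s; first by split => //; exists (k%:R * expR k%:R).
have FB h : F h -> F (fun x => h x * \1_(B k) x) by move=> Fh; apply: (mixed_indic t_gt0 d_gt0 Fh _).1.
have NB h : F h -> NF (fun x => h x * \1_(B k) x) <= NF h.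
  by move=> Fh; apply: (mixed_indic t_gt0 d_gt0 Fh _).2.
have dB : dual_elt F NF (fun h => phi (fun x => h x * \1_(B k) x)).
  have [lin [C CP]] := dual_phi; split.
    move=> f h a Ff Fh; rewrite -lin; [|exact: FB|exact: FB].
    by congr phi; apply/funext => x /=; rewrite mulrDl mulrA.
  have [C' C'0 CP'] := dual_const t_gt0 d_gt0 dual_phi.
  exists C' => f Ff; apply: le_trans (CP' _ (FB _ Ff)) _.
  by rewrite ler_wpM2l ?(ltW C'0)// NB.
(* For bounded h the cut function is the exponential weight times a bounded v, where the density is
   known; [dual_ext] then reaches all of F. *)
have E : forall h, F h -> phi (fun x => h x * \1_(B k) x) = inner (fun x => exp_weight x * s x) h.
  apply: dual_ext => //; first exact: inner_dual ad.
  move=> h c Fh hc; have [mh _] := Fh; have c0 : 0 <= c by apply: le_trans (hc 0).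
  pose v x := h x * winv x * \1_(B k) x.
  have bv : bounded_mes v.
    split; first by apply: measurable_funM; [exact: measurable_funM|exact: measurable_indic].
    exists (c * expR k%:R) => x; rewrite /v indicE; case: (boolP (x \in B k)) => [/set_mem[_ Tx]|_]; last first.
      by rewrite mulr0 normr0 mulr_ge0// ltW// expR_gt0.
    rewrite mulr1 normrM (gtr0_norm (winv0 x)) ler_pM ?(ltW (winv0 x))//.
    exact: winv_le.
  have -> : (fun x => h x * \1_(B k) x) = (fun x => exp_weight x * v x).
    by apply/funext => x; rewrite /v !mulrA (mulrAC _ (h x)) winvE mul1r.
  have wsE x : exp_weight x * s x = ghat x * \1_(B k) x.
    by rewrite /s mulrA (mulrC (ghat x) (winv x)) mulrA winvE mul1r.
  apply: EFin_inj; rewrite -/(L v) (densityP L_linear L_cont bv) -innerE//.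
  - apply: eq_integral => x _; rewrite wsE /v /ghat -!mulrA; congr (_ * _)%:E.
    by rewrite mulrC -!mulrA.
  - by case: ad.
  - by case: ad => _ _ H; apply: le_lt_trans (H _ Fh) _; exact: ltry.
move=> h Fh; rewrite -E//; apply: le_trans (kP h Fh).
have FnB : F (fun x => h x * \1_(~` B k) x).
  by apply: (mixed_indic t_gt0 d_gt0 Fh _).1; exact: measurableC.
have H := dualD dual_phi (FB _ Fh) FnB.
suff -> : phi h = phi ((fun x => h x * \1_(B k) x) \+ (fun x => h x * \1_(~` B k) x)).
  by rewrite H addrAC subrr add0r.
congr phi; apply/funext => x /=; rewrite !indicE in_setC.
by case: (_ \in _); rewrite ?mulr1 ?mulr0 ?addr0 ?add0r.
Qed.

End DualRepr.

(** [Phi] and evaluation at fhat are both bounded and agree on the functionals of [dual_approx],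
    which are norm dense in the dual. *)
Lemma mixed_reflexive : reflexive_space F NF.
Proof.
move=> Phi bPhi; have [fhat Fhat fP] := bidual_repr bPhi.
have [C C0 CP] := bidual_const bPhi.
exists fhat; split => // phi dphi; apply/eqP; rewrite -subr_eq0; apply/eqP.
apply: (@ler_eps_eq0 _ (C + NF fhat)) => e e0.
have [s bs sP] := dual_approx dphi e0; have [ms [c sc]] := bs.
have dl := inner_dual (admissible_exp ms sc).
have H1 := CP _ _ e dphi dl (ltW e0) sP.
have H2 := sP _ Fhat; rewrite -fP// in H2.
set q := Phi (inner _) in H1 H2.
have -> : Phi phi - phi fhat = (Phi phi - q) - (phi fhat - q) by lra.
apply: (le_trans (ler_normB _ _)); rewrite mulrDl lerD//.
by rewrite (mulrC (NF fhat)).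
Qed.

End Reflexivity.

(** * Symmetric spaces and their fundamental function *)

Section Symmetric.
Variable R : realType.
Local Notation mu := (@lebesgue_measure R).
Local Notation D := (@pos_half R).
Implicit Types (f g h : R -> R) (A : set R) (s c e t : R).

Lemma distrib_Zindic A a s : 0 <= s ->
  distrib (fun x => a * \1_A x) s = if s < `|a| then mu (A `&` D) else 0%E.
Proof.
move=> s0; rewrite /distrib; case: ifPn => [sa|]; last rewrite -leNgt => sa.
  congr (mu _); apply/seteqP; split => x /=; rewrite pos_halfE indicE.
    case: (boolP (x \in A)) => [/set_mem Ax [x0 _]//|_ [_]].
    by rewrite mulr0 normr0 ltNge s0.
  by move=> [Ax x0]; rewrite mem_set// mulr1.
rewrite (_ : [set _ | _] = set0) ?measure0//; apply/seteqP; split => x //= [_].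
apply/negP; rewrite -leNgt normrM; apply: le_trans sa; rewrite ler_piMr//.
by rewrite indicE; case: (_ \in _); rewrite ?normr1 ?normr0.
Qed.

Lemma mu_setU_le (A B : set R) : measurable A -> measurable B ->
  (mu (A `|` B) <= mu A + mu B)%E.
Proof. by move=> mA mB; apply: measureU2. Qed.

Lemma mu_bigsetU_le (A : nat -> set R) n : (forall i, measurable (A i)) ->
  (mu (\big[setU/set0]_(i < n) A i) <= \sum_(i < n) mu (A i))%E.
Proof. by move=> mA; apply: Boole_inequality => i _; exact: mA. Qed.

Lemma mu_itv_pos a b : 0 <= a -> a <= b -> mu (`]a, b] `&` D) = (b - a)%:E.
Proof.
move=> a0 ab; rewrite setIidl; last first.
  by move=> x; rewrite pos_halfE /= in_itv /= => /andP[/(le_lt_trans a0)].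
rewrite lebesgue_measure_itv /= lte_fin -EFinB; case: ltP => // ba.
by congr (_%:E); apply/esym/eqP; rewrite subr_eq0 eq_le ab ba.
Qed.

Lemma mu_itv0 t : 0 <= t -> mu (`]0, t] `&` D) = t%:E.
Proof. by move=> t0; rewrite mu_itv_pos// subr0. Qed.

(** Turns a count into an index: otherwise all elements would lie below #|A| - 1, too few places for
    them. *)
Lemma ord_set_large n (A : {pred 'I_n}) : (0 < #|A|)%N -> exists2 j, j \in A & (#|A| <= j.+1)%N.
Proof.
move=> A0; apply: contrapT => /forall2NP H.
have : (size [seq val j | j <- enum A] <= size (iota 0 #|A|.-1))%N.
  apply: uniq_leq_size; first by rewrite map_inj_uniq ?enum_uniq//; exact: val_inj.
  move=> _ /mapP[j jA ->]; rewrite mem_enum in jA; rewrite mem_iota /= add0n.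
  case: (H j) => // /negP; rewrite -ltnNge => jA'.
  by rewrite -ltnS prednK.
by rewrite size_map -cardE size_iota -ltnS prednK// ltnn.
Qed.

Lemma ord_set_initial n (A : {pred 'I_n}) k : (k <= n)%N ->
  (forall j : 'I_n, (j < k)%N -> j \in A) -> (k <= #|A|)%N.
Proof.
move=> kn H; rewrite -[k](size_iota 0) cardE -(size_map val); apply: uniq_leq_size.
  exact: iota_uniq.
move=> i; rewrite mem_iota /= add0n => ik.
apply/mapP; exists (Ordinal (leq_trans ik kn)) => //.
by rewrite mem_enum H.
Qed.

(** Discrete layer cake with step a; the leading a pays for the rounding. *)
Lemma min_le_layers (v a : R) L : 0 <= a ->
  Num.min v (L.+1%:R * a) <= a + \sum_(i < L) a * (i.+1%:R * a < v)%R%:R.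
Proof.
move=> a0; elim: L => [|L IH]; first by rewrite big_ord0 addr0 mul1r ge_min lexx orbT.
rewrite big_ord_recr /= addrA; case: ltP => [av|va].
  rewrite mulr1; apply: (@le_trans _ _ (L.+2%:R * a)); first by rewrite ge_min lexx orbT.
  rewrite -natr1 mulrDl mul1r lerD2r; apply: le_trans IH.
  by rewrite le_min lexx andbT ltW.
rewrite mulr0 addr0; apply: le_trans IH.
by rewrite le_min !ge_min lexx va.
Qed.

Lemma layers_le (v a : R) L : 0 <= a -> 0 <= v ->
  \sum_(i < L) a * (i.+1%:R * a < v)%R%:R <= v.
Proof.
move=> a0 v0.
suff : \sum_(i < L) a * (i.+1%:R * a < v)%R%:R <= Num.min v (L%:R * a).
  by rewrite le_min => /andP[].
elim: L => [|L IH]; first by rewrite big_ord0 mul0r le_min v0 lexx.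
rewrite big_ord_recr /=; case: ltP => [av|va]; last first.
  by rewrite mulr0 addr0; apply: le_trans IH _; rewrite ge_min lexx.
by rewrite mulr1 -natr1 mulrDl mul1r lerD2r (le_trans IH)// ge_min lexx orbT.
Qed.

Variables (E : set (R -> R)) (N : (R -> R) -> R).
Hypothesis symE : symmetric_space E N.

Lemma symmetric_mes f : E f -> mes f.
Proof. by case: symE => ES _ _ _ _ /ES[]. Qed.

Lemma symmetric0 : E (fun=> 0).
Proof. by case: symE => _ []. Qed.

Lemma symmetricD f g : E f -> E g -> E (f \+ g).
Proof. by case: symE => _ [_ [+ _]] _ _ _ => /(_ f g). Qed.

Lemma symmetricZ c f : E f -> E (fun x => c * f x).
Proof. by case: symE => _ [_ [_ +]] _ _ _ => /(_ c f). Qed.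

Lemma symmetricB f g : E f -> E g -> E (f \- g).
Proof.
move=> Ef Eg; rewrite (_ : f \- g = f \+ (fun x => -1 * g x)).
  by apply: symmetricD => //; exact: symmetricZ.
by apply/funext => x /=; rewrite mulN1r.
Qed.

Lemma symmetric_norm_ge0 f : E f -> 0 <= N f.
Proof. by case: symE => _ _ [+ _] _ _ Ef => /(_ f Ef)[]. Qed.

Lemma symmetric_norm_eq0 f : E f -> N f = 0 <-> ae_zero f.
Proof. by case: symE => _ _ [+ _] _ _ Ef => /(_ f Ef)[]. Qed.

Lemma symmetric_normD f g : E f -> E g -> N (f \+ g) <= N f + N g.
Proof. by case: symE => _ _ [_ [+ _]] _ _ => /(_ f g). Qed.

Lemma symmetric_normZ c f : E f -> N (fun x => c * f x) = `|c| * N f.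
Proof. by case: symE => _ _ [_ [_ +]] _ _ => /(_ c f). Qed.

Lemma symmetric_ideal f g : mes f -> E g ->
  (forall s, 0 <= s -> (distrib f s <= distrib g s)%E) -> E f /\ N f <= N g.
Proof.
move=> mf Eg fg; case: (symE) => ES _ _ _ ideal; apply: ideal => //.
  have [_ [s [s0 gs]]] := ES _ Eg; split => //; exists s; split => //.
  by apply: le_lt_trans gs; apply: fg; exact: ltW.
exact: distrib_rearr_le.
Qed.

Lemma symmetric_le f g : mes f -> E g -> (forall x, D x -> `|f x| <= `|g x|) ->
  E f /\ N f <= N g.
Proof.
move=> mf Eg fg; have mg := symmetric_mes Eg; apply: symmetric_ideal => // s s0.
rewrite !distribE; apply: le_mu; try exact: measurable_levelset.
by move=> x [Dx /= sf]; split => //=; apply: lt_le_trans sf _; exact: fg.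
Qed.

Lemma symmetric_sum (I : Type) (r : seq I) (g : I -> R -> R) : (forall i, E (g i)) ->
  E (fun x => \sum_(i <- r) g i x) /\ N (fun x => \sum_(i <- r) g i x) <= \sum_(i <- r) N (g i).
Proof.
move=> Eg; elim: r => [|i r [IH1 IH2]].
  rewrite (_ : (fun x => _) = (fun=> 0)); last by apply/funext => x; rewrite big_nil.
  rewrite big_nil; split; first exact: symmetric0.
  rewrite (_ : N _ = 0)//; apply/(symmetric_norm_eq0 symmetric0).
  by apply/ae_zeroP; [exact: measurable_cst|exact: aeW].
rewrite (_ : (fun x => _) = g i \+ (fun x => \sum_(i <- r) g i x)); last first.
  by apply/funext => x; rewrite big_cons.
split; first exact: symmetricD.
by rewrite big_cons; apply: le_trans (symmetric_normD (Eg i) IH1) _; rewrite lerD2l.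
Qed.

Lemma symmetric_indic A B : measurable A -> E (\1_B) -> (mu (A `&` D) <= mu (B `&` D))%E ->
  E (\1_A) /\ N (\1_A) <= N (\1_B).
Proof.
move=> mA EB AB; apply: symmetric_ideal => // s s0.
have one (S : set R) : \1_S = (fun x => 1 * \1_S x) :> (R -> R).
  by apply/funext => x; rewrite mul1r.
by rewrite (one A) (one B) !distrib_Zindic//; case: ifP.
Qed.

(** Chebyshev's inequality in E: s times the indicator has a smaller distribution function than
    f. *)
Lemma indic_le_of_distrib f A s : E f -> measurable A -> 0 < s ->
  (mu (A `&` D) <= distrib f s)%E -> E (\1_A) /\ s * N (\1_A) <= N f.
Proof.
move=> Ef mA s0 Af; have mf := symmetric_mes Ef.
have [Es Ns] : E (fun x => s * \1_A x) /\ N (fun x => s * \1_A x) <= N f.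
  apply: symmetric_ideal => //; first by apply: mesZ; exact: measurable_indic.
  move=> u u0; rewrite distrib_Zindic//; case: ifPn => [|_]; last by rewrite distribE.
  rewrite gtr0_norm// => us; apply: le_trans Af _; apply: le_distrib => //.
  exact: ltW.
have E1 : (\1_A : R -> R) = (fun x => s^-1 * (s * \1_A x)).
  by apply/funext => x; rewrite mulrA mulVf ?mul1r// gt_eqF.
split; first by rewrite E1; exact: symmetricZ.
by rewrite {1}E1 symmetric_normZ// normfV gtr0_norm// mulrA divff ?mul1r// gt_eqF.
Qed.

Definition fundamental t : R := N (\1_(`]0, t])).
Local Notation phi := fundamental.

Lemma fundamental_le_of_distrib f s t : E f -> 0 < s -> 0 <= t -> (t%:E <= distrib f s)%E ->
  E (\1_(`]0, t])) /\ s * phi t <= N f.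
Proof.
move=> Ef s0 t0 tf; apply: indic_le_of_distrib => //.
by rewrite mu_itv0.
Qed.

Definition cells (r : R) (i : nat) : set R := `](i%:R * r), (i.+1%:R * r)].

Lemma sum_cells (r : R) n x : 0 <= r ->
  \sum_(i < n) (\1_(cells r i) x : R) = \1_(`]0, (n%:R * r)]) x.
Proof.
move=> r0; elim: n => [|n IH].
  by rewrite big_ord0 mul0r set_itvoc0// indic0.
rewrite big_ord_recr /= IH /cells !indicE !mem_setE !in_itv /=.
have nr0 : 0 <= n%:R * r by rewrite mulr_ge0.
have nr1 : n%:R * r <= n.+1%:R * r by rewrite ler_wpM2r// ler_nat.
case: (ltP (n%:R * r) x) => [nx|xn]; last by rewrite (le_trans xn nr1) !andbT addr0.
by rewrite (le_lt_trans nr0 nx) /= add0r.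
Qed.

Lemma cells_disjoint r i j x : 0 <= r -> cells r i x -> cells r j x -> i = j.
Proof.
move=> r0; have aux k l : (k < l)%N -> cells r k x -> cells r l x -> False.
  move=> kl; rewrite /cells /= !in_itv /= => /andP[_ xk] /andP[lx _].
  have := lt_le_trans lx xk; apply/negP; rewrite -leNgt ler_wpM2r// ler_nat//.
move=> xi xj; case: (ltngtP i j) => // ij; first by case: (aux i j ij xi xj).
by case: (aux j i ij xj xi).
Qed.

(** The distribution function at s of the decreasing rearrangement of f cut to (0, t); its integral
    over s > 0 is K(t, f). *)
Definition capped_distrib f t s : R := fine (Order.min t%:E (distrib f s)).

Lemma capped_distribE f t s : 0 <= t -> (capped_distrib f t s)%:E = Order.min t%:E (distrib f s).
Proof.
move=> t0; rewrite fineK// ge0_fin_numE; last by rewrite le_min lee_fin t0 distribE measure_ge0.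
by rewrite gt_min ltry.
Qed.

Lemma capped_distrib_ge0 f t s : 0 <= t -> 0 <= capped_distrib f t s.
Proof.
by move=> t0; apply: fine_ge0; rewrite le_min lee_fin t0 distribE measure_ge0.
Qed.

Lemma capped_distrib_le f t s : 0 <= t -> capped_distrib f t s <= t.
Proof. by move=> t0; rewrite -lee_fin capped_distribE// ge_min lexx. Qed.

Lemma capped_distrib_le_distrib f t s : 0 <= t -> ((capped_distrib f t s)%:E <= distrib f s)%E.
Proof. by move=> t0; rewrite capped_distribE// ge_min lexx orbT. Qed.

(** Slice |f| at the multiples of a: on each level set the integral of g is at most both t and the
    measure of the set. *)
Lemma pairing_layers g f t a L : unit_weights t g -> mes f -> 0 < a ->
  (pairing g (fun x => Num.min `|f x| (L.+1%:R * a))%R <=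
   (a * t + a * \sum_(i < L) capped_distrib f t (i.+1%:R * a))%:E)%E.
Proof.
move=> ug mf a0; have wg := unit_weight_weight ug; have [mg g01 gt] := ug.
have t0 : 0 <= t.
  by rewrite -lee_fin; apply: le_trans gt; apply: integral_ge0 => x _; rewrite lee_fin; case/andP: (g01 x).
pose A i := levelset f (i.+1%:R * a); have mA i : measurable (A i) by exact: measurable_levelset.
have wA i : weight (\1_(A i) : R -> R).
  by split => [|x]; [exact: measurable_indic|rewrite indicE].
pose S x : R := \sum_(i < L) a * \1_(A i) x.
have mS : mes S by apply: measurable_sum => i; apply: mesZ; exact: measurable_indic.
have S0 x : 0 <= S x by apply: sumr_ge0 => i _; rewrite mulr_ge0 ?(ltW a0)// indicE.
apply: (@le_trans _ _ (pairing g (cst a \+ S)%R)).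
  apply: pairing_le => //; last (apply: aeW => x Dx).
  - by apply: measurable_minr; [exact: mes_norm|exact: measurable_cst].
  - by apply: measurable_funD => //; exact: measurable_cst.
  have m0 : 0 <= Num.min `|f x| (L.+1%:R * a) by rewrite le_min normr_ge0 mulr_ge0 ?(ltW a0).
  have aS0 : 0 <= (cst a \+ S) x by rewrite /= addr_ge0 ?(ltW a0).
  rewrite (ger0_norm m0) (ger0_norm aS0) /=.
  apply: le_trans (min_le_layers _ _ (ltW a0)) _; rewrite lerD2l; apply: ler_sum => i _.
  rewrite ler_pM2l// indicE; case: (boolP (x \in A i)) => [_|/negP nA]; first by case: (_ < _).
  by case: ltP => // h; case: nA; rewrite inE.
apply: le_trans (pairingD wg _ mS) _; first exact: measurable_cst.
rewrite EFinD; apply: leeD.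
  rewrite EFinM /pairing; under eq_integral do rewrite /cst (gtr0_norm a0) mulrC EFinM.
  rewrite ge0_integralZl_EFin ?(ltW a0)//; last 2 first.
  - by move=> x _; rewrite lee_fin; case/andP: (g01 x).
  - by apply/measurable_EFinP.
  by apply: lee_wpmul2l => //; rewrite lee_fin ltW.
rewrite (_ : pairing g S = pairing S g); last first.
  apply: eq_integral => x _; rewrite (ger0_norm (S0 x)) mulrC ger0_norm//.
  by case/andP: (g01 x).
rewrite pairing_sum ?(ltW a0)// mulr_sumr -sumEFin; apply: lee_sum => i _.
rewrite EFinM; apply: lee_wpmul2l; first by rewrite lee_fin ltW.
rewrite capped_distribE// le_min; apply/andP; split.
  apply: le_trans gt; apply: ge0_le_integral => //.
  - exact: mes_pairing.
  - by apply/measurable_EFinP.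
  - move=> x _; have /andP[g0 _] := g01 x; rewrite lee_fin (ger0_norm g0) indicE.
    by case: (_ \in _); rewrite ?mul1r// mul0r.
rewrite distribE -/(A i) -[in leRHS](_ : A i `&` D = A i); last by apply/setIidl => x [].
rewrite -integral_indicD//; apply: ge0_le_integral => //.
- exact: mes_pairing.
- by apply/measurable_EFinP; exact: (wA i).1.
- move=> x _; have /andP[g0 g1] := g01 x; rewrite lee_fin (ger0_norm g0) indicE.
  by case: (_ \in _); rewrite ?mul1r// mul0r.
Qed.

Lemma distrib_cells (b : nat -> R) n r s : 0 < r -> 0 <= s ->
  (distrib (fun x => \sum_(i < n) b i * \1_(cells r i) x)%R s <=
   (\sum_(i < n) r * (s < `|b i|)%R%:R)%:E)%E.
Proof.
move=> r0 s0; pose A i : set R := if s < `|b i| then cells r i `&` D else set0.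
have mA i : measurable (A i).
  by rewrite /A; case: ifP => // _; apply: measurableI => //; exact: measurable_itv.
have mb : mes (fun x => \sum_(i < n) b i * \1_(cells r i) x).
  by apply: measurable_sum => i; apply: mesZ; apply: measurable_indic; exact: measurable_itv.
rewrite distribE; apply: (@le_trans _ _ (mu (\big[setU/set0]_(i < n) A i))).
  apply: le_mu; [exact: measurable_levelset|exact: bigsetU_measurable|].
  move=> x [Dx /= sx]; rewrite -bigcup_mkord.
  have [[i xi]|nx] := pselect (exists i : 'I_n, cells r i x); last first.
    move: sx; rewrite big1 ?normr0 ?ltNge ?s0// => i _.
    by rewrite indicE memNset ?mulr0// => xi; apply: nx; exists i.
  exists i => //=; move: sx; rewrite (bigD1 i)//= indicE mem_set// mulr1 big1 ?addr0.
    by rewrite /A => ->.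
  move=> j ji; rewrite indicE memNset ?mulr0// => xj; move/eqP: ji; apply.
  by apply/val_inj/(cells_disjoint (ltW r0) xj xi).
apply: (le_trans (mu_bigsetU_le _ mA)).
rewrite -sumEFin; apply: lee_sum => i _; rewrite /A; case: ifP => _; last by rewrite measure0 mulr0.
rewrite mulr1 /cells mu_itv_pos ?mulr_ge0 ?(ltW r0)// ?ler_wpM2r ?(ltW r0) ?ler_nat//.
by rewrite lee_fin -natr1 mulrDl mul1r addrAC subrr add0r.
Qed.

(** * The fundamental function and its bound on the K-functional *)

Section Nontrivial.
Hypothesis indic_mem : forall t, 0 < t -> E (\1_(`]0, t])).

Lemma indic_le_fundamental A t : measurable A -> 0 < t -> (mu (A `&` D) <= t%:E)%E ->
  E (\1_A) /\ N (\1_A) <= phi t.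
Proof.
move=> mA t0 At; apply: symmetric_indic => //; first exact: indic_mem.
by rewrite mu_itv0// ltW.
Qed.

Lemma fundamental_gt0 t : 0 < t -> 0 < phi t.
Proof.
move=> t0; have Et := indic_mem t0; rewrite lt_def symmetric_norm_ge0// andbT.
apply/eqP => /(symmetric_norm_eq0 Et); rewrite ae_zeroE.
rewrite (_ : \1_ _ = fun x => 1 * \1_(`]0, t]) x); last by apply/funext => x; rewrite mul1r.
rewrite distrib_Zindic// normr1 ltr01 mu_itv0 ?(ltW t0)// => -[] t00.
by rewrite t00 ltxx in t0.
Qed.

Lemma fundamental_mono s t : 0 < s -> s <= t -> phi s <= phi t.
Proof.
move=> s0 st; apply: (indic_le_fundamental _ _ _).2 => //; first exact: lt_le_trans st.
by rewrite mu_itv0 ?lee_fin// ltW.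
Qed.

Lemma distrib_le_of_norm_lt f s t : E f -> 0 < s -> 0 < t -> N f < s * phi t ->
  (distrib f s <= t%:E)%E.
Proof.
move=> Ef s0 t0; apply: contraTT; rewrite -ltNge -leNgt => tf.
by apply: (fundamental_le_of_distrib Ef s0 (ltW t0) (ltW tf)).2.
Qed.

(** Norm convergence implies convergence in measure, so the norm limit provided by completeness
    equals g almost everywhere. *)
Lemma symmetric_limit (u : nat -> R -> R) g : (forall n, E (u n)) -> mes g ->
  (forall e, 0 < e -> exists n0, forall m n, (n0 <= m)%N -> (n0 <= n)%N -> N (u m \- u n) < e) ->
  (forall s t, 0 < s -> 0 < t -> exists n0, forall n, (n0 <= n)%N -> (distrib (u n \- g)%R s <= t%:E)%E) ->
  E g.
Proof.
move=> Eu mg cu ug; case: (symE) => _ _ _ complete _.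
have [f [Ef uf]] := complete u Eu cu; have mf := symmetric_mes Ef.
have mfg : mes (f \- g) by exact: measurable_funB.
have key s : 0 < s -> (distrib (f \- g)%R s <= 0)%E.
  move=> s0; apply/lee_addgt0Pr => e e0; rewrite add0e.
  have s2 : 0 < s / 2 by rewrite divr_gt0.
  have e2 : 0 < e / 2 by rewrite divr_gt0.
  have [n1 H1] := ug _ _ s2 e2.
  have [n2 H2] := uf _ (mulr_gt0 s2 (fundamental_gt0 e2)).
  pose n := maxn n1 n2; have Euf := symmetricB (Eu n) Ef.
  have {}H2 := distrib_le_of_norm_lt Euf s2 e2 (H2 n (leq_maxr _ _)).
  have {}H1 := H1 n (leq_maxl _ _); have mu' := symmetric_mes (Eu n).
  have mS1 : measurable (levelset (u n \- f) (s / 2)).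
    by apply: measurable_levelset; exact: symmetric_mes.
  have mS2 : measurable (levelset (u n \- g) (s / 2)).
    by apply: measurable_levelset; exact: measurable_funB.
  apply: (@le_trans _ _ (mu (levelset (u n \- f) (s / 2) `|` levelset (u n \- g) (s / 2)))).
    rewrite distribE; apply: le_mu; [exact: measurable_levelset|exact: measurableU|].
    move=> x [Dx /= sx]; have [h|h] := ltP (s / 2) `|u n x - f x|; first by left.
    right; split => //=; have := ler_distD (u n x) (f x) (g x).
    move: h sx; rewrite (distrC (u n x) (f x)); lra.
  apply: (le_trans (mu_setU_le mS1 mS2)).
  have -> : e%:E = ((e / 2)%:E + (e / 2)%:E)%E by rewrite -EFinD; congr (_%:E); lra.
  by rewrite distribE in H1; rewrite distribE in H2; exact: leeD.
have fg0 : ae_zero (f \- g).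
  rewrite ae_zeroE; apply/eqP; rewrite eq_le distribE measure_ge0 andbT -distribE.
  apply: distrib_right_continuous => // n; rewrite add0r; apply: key.
  by rewrite invr_gt0.
apply: (symmetric_ideal mg Ef _).1 => s s0; rewrite !distribE.
have /(ae_zeroP mfg) H := fg0.
have mE : measurable (levelset (f \- g) 0) by exact: measurable_levelset.
apply: (@le_trans _ _ (mu (levelset f s `|` levelset (f \- g) 0))).
  apply: le_mu; [exact: measurable_levelset|apply: measurableU => //; exact: measurable_levelset|].
  move=> x [Dx /= sx]; have [fx|fx] := eqVneq (f x) (g x); first by left; split => //=; rewrite fx.
  by right; split => //=; rewrite normr_gt0 subr_eq0.
apply: (le_trans (mu_setU_le (measurable_levelset s mf) mE)).
by move: fg0; rewrite ae_zeroE distribE => ->; rewrite adde0.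
Qed.

(* Averaging [f] over cyclic permutations of the cells produces a multiple of an indicator. *)
Lemma fundamental_cells n f r (c : 'I_n.+1 -> R) : E f -> 0 < r -> (forall j, 0 <= c j) ->
  (forall s, 0 <= s -> ((r * #|[pred j | s < c j]|%:R)%:E <= distrib f s)%E) ->
  (\sum_j c j) * phi (n.+1%:R * r) <= n.+1%:R * N f.
Proof.
move=> Ef r0 c0 cf; have nr0 : 0 < n.+1%:R * r by rewrite mulr_gt0.
(* Addition in ['I_n.+1] is modulo n.+1: G k carries the values of c shifted cyclically by k. *)
pose G (k : 'I_n.+1) x := \sum_(i < n.+1) c (inord i + k) * \1_(cells r i) x.
have EG k : E (G k) /\ N (G k) <= N f.
  apply: symmetric_ideal => // [|s s0].
    by apply: measurable_sum => i; apply: mesZ; apply: measurable_indic; exact: measurable_itv.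
  apply: le_trans (distrib_cells (fun i => c (inord i + k)) _ r0 s0) _.
  apply: le_trans (cf s s0); rewrite lee_fin -mulr_sumr ler_pM2l//.
  rewrite -sum1_card natr_sum [leRHS]big_mkcond /=.
  rewrite [leRHS](reindex_inj (addIr k)) /=; apply: ler_sum => i _.
  by rewrite inE inord_val ger0_norm//; case: ifP.
have [Esum Nsum] := symmetric_sum (index_enum 'I_n.+1) (fun k => (EG k).1).
have En := indic_mem nr0.
have sumE : (fun x => \sum_k G k x) = (fun x => (\sum_j c j) * \1_(`]0, (n.+1%:R * r)]) x).
  apply/funext => x; rewrite -(sum_cells _ _ (ltW r0)) /G exchange_big /= mulr_sumr.
  apply: eq_bigr => i _; rewrite -mulr_suml; congr (_ * _).
  by rewrite [RHS](reindex_inj (addrI (inord i))).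
have S0 : 0 <= \sum_j c j by apply: sumr_ge0.
rewrite sumE symmetric_normZ// ger0_norm// in Nsum; apply: le_trans Nsum _.
apply: (@le_trans _ _ (\sum_(k : 'I_n.+1) N f)); first by apply: ler_sum => k _; exact: (EG k).2.
by rewrite sumr_const card_ord -[_ *+ _]mulr_natl.
Qed.

(** With cells of length r = t/(n+1), c j counts in units of a the levels at which f exceeds on a
    set of measure at least (j+1) r: a step function below the rearrangement of f on (0, t). The
    last term is the loss from rounding to whole cells. *)
Lemma fundamental_layers f t a L n : E f -> 0 < t -> 0 < a ->
  a * (\sum_(i < L) capped_distrib f t (i.+1%:R * a)) * phi t <=
  t * N f + a * L%:R * t / n.+1%:R * phi t.
Proof.
move=> Ef t0 a0; have mf := symmetric_mes Ef.
pose r := t / n.+1%:R; have r0 : 0 < r by rewrite divr_gt0.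
have tE : t = n.+1%:R * r by rewrite mulrC divfK.
pose P (j : 'I_n.+1) (i : 'I_L) := ((j.+1%:R * r)%:E <= distrib f (i.+1%:R * a))%E.
pose c (j : 'I_n.+1) : R := a * #|[pred i | P j i]|%:R.
have c0 j : 0 <= c j by rewrite mulr_ge0// ltW.
(* The largest j with s < c j, and for it the largest level i, give {|f| > s} measure at least (j+1)
   r. *)
have cf s : 0 <= s -> ((r * #|[pred j | s < c j]|%:R)%:E <= distrib f s)%E.
  move=> s0; have [->|] := posnP #|[pred j | s < c j]|.
    by rewrite mulr0 distribE measure_ge0.
  move=> J0; have [j] := ord_set_large J0; rewrite inE => sc jn.
  have I0 : (0 < #|[pred i | P j i]|)%N.
    rewrite lt0n; apply/eqP => c00; move: sc.
    by rewrite /c c00 mulr0 ltNge s0.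
  have [i] := ord_set_large I0; rewrite inE => Pji ci.
  apply: (@le_trans _ _ (j.+1%:R * r)%:E); first by rewrite lee_fin mulrC ler_wpM2r ?(ltW r0)// ler_nat.
  apply: le_trans Pji _; apply: le_distrib => //; apply: ltW; apply: lt_le_trans sc _.
  by rewrite /c mulrC ler_wpM2r ?(ltW a0)// ler_nat.
have := fundamental_cells Ef r0 c0 cf; rewrite -tE => H.
(* Counting the pairs (j, i) by levels: level i meets at least floor(m / r) cells, losing at most
   1. *)
have low : a * \sum_(i < L) (capped_distrib f t (i.+1%:R * a) / r - 1) <= \sum_j c j.
  rewrite -mulr_sumr ler_pM2l//.
  under [leRHS]eq_bigr do rewrite -sum1_card natr_sum big_mkcond /=.
  rewrite exchange_big /=; apply: ler_sum => i _.
  under eq_bigr do rewrite inE.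
  rewrite -big_mkcond /= -natr_sum sum1_card.
  set m := capped_distrib _ _ _; pose k := Num.truncn (m / r).
  have m0 : 0 <= m by exact: capped_distrib_ge0 (ltW t0).
  have mt : m <= t by exact: capped_distrib_le (ltW t0).
  have mr0 : 0 <= m / r by rewrite divr_ge0// ltW.
  have kr : k%:R <= m / r by rewrite truncn_le.
  apply: (@le_trans _ _ k%:R).
    by rewrite lerBlDr natr1 ltW// truncnS_gt.
  rewrite ler_nat; apply: ord_set_initial.
    rewrite -(ler_nat R); apply: le_trans kr _.
    by rewrite ler_pdivrMr// -tE.
  move=> j jk; rewrite unfold_in; apply: le_trans (capped_distrib_le_distrib _ _ (ltW t0)).
  rewrite lee_fin -/m -ler_pdivlMr//; apply: le_trans kr; by rewrite ler_nat.
have phi0 := fundamental_gt0 t0.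
have {}H : r * (\sum_j c j) * phi t <= t * N f.
  by have := ler_wpM2l (ltW r0) H; rewrite mulrA mulrA (mulrC r n.+1%:R) -tE.
have {}low : a * \sum_(i < L) capped_distrib f t (i.+1%:R * a) - a * L%:R * r <= r * \sum_j c j.
  rewrite -ler_pdivrMl//; apply: le_trans low; rewrite sumrB -mulr_suml sumr_const card_ord.
  rewrite -[1 *+ L]mulr_natl mulr1 mulrBr; rewrite mulrBr (mulrC r^-1 (a * L%:R * r)) mulfK ?gt_eqF//.
  by rewrite mulrC mulrA.
have := ler_wpM2r (ltW phi0) low; rewrite mulrBl => /le_trans /(_ H).
by rewrite lerBlDr /r (mulrA (a * L%:R)).
Qed.

(** The discrete estimates [pairing_layers] and [fundamental_layers] for |f| truncated at m+1, with
    Fatou's lemma as m grows. *)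
Lemma Kfun_fundamental f t : E f -> 0 < t -> (Kfun t f <= (t * N f / phi t)%:E)%E.
Proof.
move=> Ef t0; have mf := symmetric_mes Ef; have phi0 := fundamental_gt0 t0.
apply/gauge_leP => g ug; have wg := unit_weight_weight ug.
apply/lee_addgt0Pr => e e0; rewrite -EFinD.
pose u m x := Num.min `|f x| (m.+1%:R).
have mu' m : mes (u m).
  by apply: measurable_minr; [exact: mes_norm|exact: measurable_cst].
rewrite -[pairing g f]/(pairing g f) -(_ : pairing g (fun x => `|f x|) = pairing g f); last first.
  by apply: eq_integral => x _; rewrite normr_id.
have T0 : 0 < 2 * t / e by rewrite divr_gt0// mulr_gt0.
apply: (@pairing_fatou _ g u _ _ (Num.truncn (2 * t / e)).+1) => //; first exact: mes_norm.
  apply: aeW => x _; apply/cvgrPdist_lt => d d0; near=> m.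
  rewrite /u (_ : Num.min _ _ = `|f x|) ?subrr ?normr0//; apply/min_idPl.
  near: m; apply: filterS (nbhs_infty_ger `|f x|) => m; move=> /le_trans; apply.
  by rewrite ler_nat.
(* With step a = 1/(m+1), L = (m+1)^2 levels reach height m+1. Using L cells as well, each of the
   two rounding errors is a t, and 2 a t <= e for these m. *)
move=> m Tm; pose a : R := m.+1%:R^-1; have a0 : 0 < a by rewrite invr_gt0.
pose L := (m.+1 * m.+1)%N.
have La : L%:R * a = m.+1%:R by rewrite natrM mulfK.
apply: (@le_trans _ _ (a * t + a * \sum_(i < L) capped_distrib f t (i.+1%:R * a))%:E).
  apply: le_trans (pairing_layers L ug mf a0); apply: pairing_le => //.
    by apply: measurable_minr; [exact: mes_norm|exact: measurable_cst].
  apply: aeW => x _; have u0 : 0 <= u m x by rewrite le_min normr_ge0 ler0n.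
  have v0 : 0 <= Num.min `|f x| (L.+1%:R * a) by rewrite le_min normr_ge0 mulr_ge0 ?(ltW a0).
  rewrite (ger0_norm u0) (ger0_norm v0) le_min /u !ge_min lexx /=.
  by apply/orP; right; rewrite -La ler_wpM2r ?(ltW a0)// ler_nat.
have L0 : L%:R != 0 :> R by rewrite pnatr_eq0.
have := fundamental_layers L L.-1 Ef t0 a0; rewrite prednK// => H.
have {}H : a * \sum_(i < L) capped_distrib f t (i.+1%:R * a) <= t * N f / phi t + a * t.
  rewrite -(ler_pM2r phi0) mulrDl divfK ?gt_eqF//; apply: le_trans H _.
  by rewrite lerD2l [a * _ * t]mulrAC mulfK.
have at2 : 2 * (a * t) <= e.
  rewrite mulrCA -ler_pdivlMl// invrK -ler_pdivrMr//.
  by rewrite ltW// (lt_le_trans (truncnS_gt _))// ler_nat ltnW.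
by rewrite lee_fin; move: H at2; lra.
Unshelve. all: by end_near. Qed.

(* A function in [C0] is the uniform limit of its truncations, which have supports of finite
   measure; their norms are controlled by the bound on the fundamental function. *)
Lemma C0_sub_of_bounded_fundamental B : (forall t, 0 < t -> phi t <= B) -> @C0 R `<=` E.
Proof.
move=> phiB g [[mg [M gM]] g0]; have B0 : 0 <= B.
  by apply: le_trans (phiB 1 ltr01); apply/ltW/fundamental_gt0.
have gfin s : 0 < s -> (distrib g s < +oo)%E.
  move=> s0; have [T HT] := g0 _ (divr_gt0 s0 (ltr0Sn R 1)).
  have := HT _ (lexx T); rewrite /rearr => H.
  have /ereal_inf_lt[_ [s' [_ gs'] <-] s's] : (ereal_inf [set s0%:E | s0 in
      [set s1 | (0 <= s1)%R /\ (distrib g s1 <= T%:E)%E]] < s%:E)%E.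
    by apply: le_lt_trans H _; rewrite lte_fin ltr_pdivrMr// ltr_pMr// ltr1n.
  apply: le_lt_trans (ltry T); apply: le_trans gs'; apply: le_distrib => //.
  by rewrite lte_fin in s's; exact: ltW.
(* Such h is dominated by c times the indicator of {|g| > s}, a set of finite measure; the bound c B
   does not depend on this measure. *)
have small h c s : mes h -> 0 < c -> 0 < s -> (forall x, D x -> h x != 0 -> s < `|g x|) ->
    (distrib h c = 0)%E -> E h /\ N h <= c * B.
  move=> mh c0 s0 hs hc; pose S := levelset g s.
  have mS : measurable S by exact: measurable_levelset.
  have [tS tS0 StS] : exists2 t, 0 < t & (mu (S `&` D) <= t%:E)%E.
    have Sfin : (mu (S `&` D) < +oo)%E.
      by rewrite (_ : S `&` D = S) -?distribE ?gfin//; apply/setIidl => x [].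
    exists (fine (mu (S `&` D)) + 1); first by rewrite ltr_wpDl// fine_ge0.
    by rewrite EFinD fineK ?ge0_fin_numE// leeDl// lee_fin.
  have [ES NS] := indic_le_fundamental mS tS0 StS.
  have [] := @symmetric_ideal h (fun x => c * \1_S x) mh (symmetricZ c ES) _.
    move=> u u0; rewrite distrib_Zindic// gtr0_norm//; case: ifPn => [_|]; last first.
      by rewrite -leNgt => cu; rewrite -hc; exact: le_distrib.
    rewrite distribE; apply: le_mu; [exact: measurable_levelset|exact: measurableI|].
    move=> x [Dx /= ux]; split => //; split => //=; apply: hs => //.
    by rewrite -normr_gt0; exact: le_lt_trans ux.
  move=> Eh Nh; split => //; apply: le_trans Nh _.
  rewrite symmetric_normZ// gtr0_norm// ler_pM2l//; exact: le_trans NS (phiB _ tS0).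
pose lv k : R := k.+1%:R^-1; have lv0 k : 0 < lv k by rewrite invr_gt0.
pose u k x := g x * \1_(levelset g (lv k)) x.
have mu' k : mes (u k).
  by apply: measurable_funM => //; apply: measurable_indic; exact: measurable_levelset.
have un0 k x : D x -> u k x != 0 -> lv k < `|g x|.
  move=> Dx; rewrite /u indicE; case: (boolP (x \in _)); last by rewrite mulr0 eqxx.
  by move=> /set_mem[].
have uout k x : D x -> `|g x - u k x| <= lv k.
  move=> Dx; rewrite /u indicE; case: (boolP (x \in _)) => [_|/negP nS].
    by rewrite mulr1 subrr normr0 ltW.
  by rewrite mulr0 subr0 leNgt; apply/negP => gx; apply: nS; rewrite inE.
have distrib0 h c : (forall x, D x -> `|h x| <= c) -> distrib h c = 0%E.
  move=> hc; rewrite distribE (_ : levelset h c = set0) ?measure0//.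
  by apply/seteqP; split => x //= [Dx] /=; rewrite ltNge hc.
apply: (@symmetric_limit u g) => // [k|e e0|s t s0 t0].
- have M0 : 0 < `|M| + 1 by rewrite ltr_wpDl.
  apply: (small _ _ _ (mu' k) M0 (lv0 k) (un0 k) _).1.
  apply/eqP; rewrite eq_le !distribE measure_ge0 andbT -gM distribE.
  apply: le_mu; [exact: measurable_levelset|exact: measurable_levelset|].
  move=> x [Dx /= xM]; split => //=; apply: (@le_lt_trans _ _ (`|M| + 1)).
    by rewrite (le_trans (ler_norm M))// lerDl.
  apply: lt_le_trans xM _; rewrite /u normrM ler_piMr// indicE.
  by case: (_ \in _); rewrite ?normr1 ?normr0.
- pose c := e / (2 * (B + 1)); have B1 : 0 < B + 1 by rewrite ltr_wpDl.
  have c0 : 0 < c by rewrite divr_gt0// mulr_gt0.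
  exists (Num.truncn (2 / c)) => m n Hm Hn.
  have lvc k : (Num.truncn (2 / c) <= k)%N -> lv k <= c / 2.
    move=> ck; have : 2 / c < k.+1%:R.
      by rewrite (lt_le_trans (truncnS_gt _))// ler_nat ltnS.
    by rewrite ltr_pdivrMr// -[lv k]mul1r ler_pdivrMr ?ltr0n//; lra.
  apply: (@le_lt_trans _ _ (c * B)).
    apply: (small _ c (Num.min (lv m) (lv n)) _ _ _ _ _).2 => //.
    + by apply: measurable_funB.
    + by rewrite lt_min !lv0.
    + move=> x Dx; rewrite gt_min; have [u0|u0 _] := eqVneq (u m x) 0.
        by rewrite /= u0 sub0r oppr_eq0 => /(un0 _ _ Dx) ->; rewrite orbT.
      by rewrite (un0 _ _ Dx u0).
    + apply: distrib0 => x Dx /=.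
      have -> : u m x - u n x = (g x - u n x) - (g x - u m x) by lra.
      apply: le_trans (ler_normB _ _) _.
      have := uout m x Dx; have := uout n x Dx; have := lvc _ Hm; have := lvc _ Hn; lra.
  rewrite /c mulrAC ltr_pdivrMr ?mulr_gt0// ltr_pM2l//; lra.
- exists (Num.truncn s^-1) => n sn; rewrite (_ : distrib _ s = 0%E) ?lee_fin ?ltW//.
  apply: distrib0 => x Dx /=; rewrite distrC; apply: le_trans (uout n x Dx) _.
  rewrite invf_ple ?posrE//.
  by rewrite ltW// (lt_le_trans (truncnS_gt _))// ler_nat ltnS.
Qed.

(** * A linear bound on the fundamental function near 0 puts L_1(0,1) into E *)

Section LinearFundamental.
Variable C : R.
Hypothesis phi_le : forall t, 0 < t -> t <= 1 -> phi t <= C * t.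

Let C_ge0 : 0 <= C.
Proof. by have := phi_le ltr01 (lexx 1); rewrite mulr1; apply: le_trans; exact/ltW/fundamental_gt0. Qed.

Lemma indic_norm_le A : measurable A -> (mu (A `&` D) <= 1)%E ->
  E (\1_A) /\ N (\1_A) <= C * fine (mu (A `&` D)).
Proof.
move=> mA A1.
have Afin : mu (A `&` D) \is a fin_num.
  by rewrite ge0_fin_numE ?measure_ge0//; apply: le_lt_trans A1 (ltry 1).
have AE := fineK Afin.
have [EA _] := indic_le_fundamental mA ltr01 A1; split => //.
have A1' : fine (mu (A `&` D)) <= 1 by rewrite -lee_fin AE.
have : 0 <= fine (mu (A `&` D)) by apply: fine_ge0; exact: measure_ge0.
(* Null sets are treated apart, since [phi_le] is only assumed for t > 0. *)
rewrite le_eqVlt => /orP[/eqP A0|A0]; last first.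
  apply: le_trans (phi_le A0 A1'); apply: (indic_le_fundamental mA A0 _).2.
  by rewrite AE.
rewrite -A0 mulr0 (_ : N _ = 0)//; apply/(symmetric_norm_eq0 EA); rewrite ae_zeroE.
rewrite (_ : \1_A = fun x => 1 * \1_A x); last by apply/funext => x; rewrite mul1r.
by rewrite distrib_Zindic// normr1 ltr01 -AE -A0.
Qed.

(** Slice |h| in steps of a: each layer has norm at most C times its measure, and the layers sum to
    at most |h|. The rounding term a phi(1) disappears as a tends to 0. *)
Lemma norm_le_integral h M : mes h -> (forall x, D x -> `|h x| <= M) ->
  (forall x, 1 < x -> h x = 0) ->
  E h /\ ((N h)%:E <= C%:E * \int[mu]_(x in D) `|h x|%:E)%E.
Proof.
move=> mh hM h1; have M0 : 0 <= M.
  by apply: le_trans (hM 1 _); [exact: normr_ge0|rewrite pos_halfE].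
have E1 := indic_mem ltr01.
pose I1 : set R := [set` `]0, 1%R]].
have layer a : 0 < a -> E h /\ ((N h)%:E <= (a * phi 1)%:E + C%:E * \int[mu]_(x in D) `|h x|%:E)%E.
  move=> a0; pose L := (Num.truncn (M / a)).+1; pose A i := levelset h (i.+1%:R * a).
  have mA i : measurable (A i) by exact: measurable_levelset.
  have mI i : mes (\1_(A i) : R -> R) by exact: measurable_indic.
  have A1 i : (mu (A i `&` D) <= 1)%E.
    rewrite -(mu_itv0 (ler01 : 0 <= 1 :> R)); apply: le_mu; [exact: measurableI|exact: measurableI|].
    move=> x [[Dx /= hx] _]; split => //; rewrite /= in_itv /=.
    have := Dx; rewrite pos_halfE => -> /=; rewrite leNgt; apply/negP => /h1 hx0.
    by move: hx; rewrite hx0 normr0 ltNge mulr_ge0// ltW.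
  have EA i := (indic_norm_le (mA i) (A1 i)).
  pose S x : R := a * \1_I1 x + \sum_(i < L) a * \1_(A i) x.
  have [ES NS] := symmetric_sum (index_enum 'I_L) (fun i : 'I_L => symmetricZ a (EA i).1).
  have Ea := symmetricZ a E1.
  have [Eh Nh] : E h /\ N h <= N S.
    apply: symmetric_le => //; first exact: symmetricD.
    move=> x Dx; have S0 : 0 <= S x.
      by rewrite addr_ge0 ?mulr_ge0 ?(ltW a0) ?indicE//; apply: sumr_ge0 => i _; rewrite mulr_ge0 ?(ltW a0) ?indicE.
    rewrite (ger0_norm S0); have [/h1 ->|x1] := ltP 1 x; first by rewrite normr0.
    have := min_le_layers `|h x| L (ltW a0); rewrite (_ : Num.min _ _ = `|h x|); last first.
      apply/min_idPl; apply: le_trans (hM x Dx) _; rewrite -ler_pdivrMr//.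
      by rewrite ltW// (lt_le_trans (truncnS_gt _))// ler_nat.
    move=> /le_trans; apply; rewrite /S indicE mem_set ?mulr1; last first.
      by rewrite /I1 /= in_itv /= x1 andbT -pos_halfE.
    rewrite lerD2l; apply: ler_sum => i _; rewrite ler_pM2l// indicE.
    case: (boolP (x \in A i)) => [_|/negP nA]; first by case: (_ < _).
    by case: ltP => // hx; case: nA; rewrite inE.
  split => //; apply: (@le_trans _ _ (N S)%:E) => //.
  apply: (@le_trans _ _ (a * phi 1 + \sum_(i < L) a * (C * fine (mu (A i `&` D))))%:E).
    rewrite lee_fin; apply: le_trans (symmetric_normD Ea ES) _; apply: lerD.
      by rewrite symmetric_normZ// gtr0_norm.
    apply: le_trans NS _; apply: ler_sum => i _; rewrite symmetric_normZ ?gtr0_norm//; last by case: (EA i).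
    by rewrite ler_pM2l//; case: (EA i).
  rewrite EFinD leeD2l//; under eq_bigr do rewrite mulrCA.
  rewrite -mulr_sumr EFinM; apply: lee_wpmul2l; first by rewrite lee_fin.
  rewrite -sumEFin.
  apply: (@le_trans _ _ (\sum_(i < L) \int[mu]_(x in D) (a * \1_(A i) x)%:E)%E).
    apply: lee_sum => i _; rewrite EFinM fineK; last first.
      by rewrite ge0_fin_numE ?measure_ge0//; apply: le_lt_trans (A1 i) (ltry 1).
    rewrite -integral_indicD// -ge0_integralZl_EFin ?(ltW a0)//.
    by apply/measurable_EFinP; exact: mI.
  rewrite -ge0_integral_sum//; last 2 first.
  - by move=> i; apply/measurable_EFinP; apply: mesZ; exact: measurable_indic.
  - by move=> i x _; rewrite lee_fin mulr_ge0 ?(ltW a0)// indicE.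
  apply: ge0_le_integral => //.
  - by move=> x _; apply: sume_ge0 => i _; rewrite lee_fin mulr_ge0 ?(ltW a0)// indicE.
  - by apply: emeasurable_sum => i; apply/measurable_EFinP; apply: mesZ; exact: measurable_indic.
  - by apply/measurable_EFinP; exact: mes_norm.
  - move=> x Dx; rewrite sumEFin lee_fin; apply: le_trans (layers_le L (ltW a0) (normr_ge0 (h x))).
    apply: ler_sum => i _; rewrite ler_pM2l// indicE.
    by case: (boolP (x \in A i)) => [/set_mem[_ /= ->]|_]//; case: (_ < _).
split; first exact: (layer 1 ltr01).1.
apply/lee_addgt0Pr => e e0; have p1 := fundamental_gt0 ltr01.
have [_] := layer (e / phi 1) (divr_gt0 e0 p1).
by rewrite divfK ?gt_eqF// addeC.
Qed.

(** Truncations of g are Cauchy in L_1, hence in E by [norm_le_integral], and they converge to g in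
    measure. *)
Lemma L1_01_sub : @L1_01 R `<=` E01 E.
Proof.
move=> f If; split => //; set g := extend01 f.
have mU : measurable (@unit_itv R) by exact: measurable_itv.
have gE x : g x = if (0 < x) && (x < 1) then f x else 0 by [].
have Ig : mu.-integrable D (EFin \o g).
  move: If; rewrite /L1_01 /= integrable_mkcond//; rewrite [X in _ -> X]integrable_mkcond//.
  congr (is_true (mu.-integrable _ _)).
  apply/funext => x; rewrite !patchE !mem_setE !in_itv /= gE andbT.
  by case: (0 < x) => //=; case: (x < 1).
have mg : mes g by apply/measurable_EFinP; exact: measurable_int Ig.
have g1 x : 1 < x -> g x = 0.
  by move=> x1; rewrite gE [x < 1]ltNge (ltW x1) andbF.
pose T k := levelset g k%:R; have mT k : measurable (T k) by exact: measurable_levelset.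
pose w k x := g x * \1_(T k) x.
pose u k x := g x * \1_(~` T k) x.
have muk k : mes (u k).
  by apply: measurable_funM => //; apply: measurable_indic; exact: measurableC.
have mw k : mes (w k) by apply: measurable_funM => //; exact: measurable_indic.
have uE k x : u k x = g x - w k x.
  by rewrite /u /w !indicE in_setC; case: (_ \in _); rewrite ?mulr1 ?mulr0 ?subrr ?subr0.
have ub k x : D x -> `|u k x| <= k%:R.
  move=> Dx; rewrite /u indicE; case: (boolP (x \in _)) => [/set_mem nT|_].
    by rewrite mulr1 leNgt; apply/negP => gx; apply: nT.
  by rewrite mulr0 normr0.
have u1 k x : 1 < x -> u k x = 0 by move=> x1; rewrite /u g1// mul0r.
have wle m n x : (m <= n)%N -> `|u m x - u n x| <= `|w m x|.
  move=> mn; rewrite /u /w !indicE !in_setC.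
  case: (boolP (x \in T n)) => [/set_mem[Dx /= gx]|_].
    have -> : x \in T m by rewrite mem_set//; split => //=; apply: le_lt_trans gx; rewrite ler_nat.
    by rewrite !mulr0 subrr normr0.
  by case: (x \in T m); rewrite /= ?mulr0 ?mulr1 ?sub0r ?subrr ?normrN ?normr0.
have w0 : ((\int[mu]_(x in D) `|w k x|%:E)%E @[k --> \oo] --> (\int[mu]_(x in D) (0 : R)%:E)%E).
  apply: (@cvg_integral_dominated _ (fun k x => `|w k x|) _ (fun x => `|g x|)).
  - by move=> k; exact: mes_norm.
  - exact: measurable_cst.
  - exact: (integrable_norm Ig).
  - apply: aeW => x Dx; apply/cvgrPdist_lt => e e0; near=> k.
    rewrite /w indicE memNset ?mulr0 ?normr0 ?subrr ?normr0// => -[_ /=]; apply/negP.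
    by rewrite -leNgt; near: k; exact: nbhs_infty_ger.
  - move=> k; apply: aeW => x _; rewrite normr_id /w normrM ler_piMr// indicE.
    by case: (_ \in _); rewrite ?normr1 ?normr0.
rewrite integral0 in w0.
have Eu k : E (u k) by exact: (norm_le_integral (muk k) (ub k) (u1 k)).1.
apply: (symmetric_limit Eu mg) => [e e0|s t s0 t0].
  have C1 : 0 < C + 1 by rewrite ltr_wpDl.
  have [n0 n0P] := cvge_eventually_lt w0 (ltac:(rewrite lte_fin; exact: divr_gt0 e0 C1) : (0 < (e / (C + 1))%:E)%E).
  have main m n : (n0 <= m)%N -> (m <= n)%N -> N (u m \- u n) < e.
    move=> n0m mn.
    have mumn : mes (u m \- u n) by exact: measurable_funB.
    have bmn x : D x -> `|(u m \- u n) x| <= m%:R + n%:R.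
      by move=> Dx; rewrite (le_trans (ler_normB _ _))// lerD// ub.
    have zmn x : 1 < x -> (u m \- u n) x = 0 by move=> x1; rewrite /= !u1// subrr.
    have [_ H] := norm_le_integral mumn bmn zmn.
    rewrite -lte_fin; apply: (le_lt_trans H).
    apply: (@le_lt_trans _ _ (C%:E * (e / (C + 1))%:E)%E).
      apply: lee_wpmul2l; first by rewrite lee_fin.
      apply: le_trans (ltW (n0P m n0m)); apply: ge0_le_integral => //.
      - by apply/measurable_EFinP; exact: mes_norm.
      - by apply/measurable_EFinP; exact: mes_norm.
      - by move=> x _; rewrite lee_fin wle.
    by rewrite -EFinM lte_fin mulrCA gtr_pMr// ltr_pdivrMr// mul1r ltrDl.
  exists n0 => m n n0m n0n; have [mn|/ltnW nm] := leqP m n; first exact: main.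
  rewrite (_ : N _ = N (u n \- u m)); first exact: main.
  have -> : u m \- u n = (fun x => -1 * (u n \- u m) x).
    by apply/funext => x /=; rewrite mulN1r opprB.
  by rewrite symmetric_normZ ?normrN1 ?mul1r//; exact: symmetricB.
have g1fin : (distrib g 1 < +oo)%E.
  apply: (@le_lt_trans _ _ 1%E); last exact: ltry.
  rewrite distribE -(mu_itv0 (ler01 : 0 <= 1 :> R)); apply: le_mu; [exact: measurable_levelset|exact: measurableI|].
  move=> x [Dx /= gx]; split => //=; rewrite in_itv /=; have := Dx; rewrite pos_halfE => -> /=.
  by rewrite leNgt; apply/negP => /g1 g0; move: gx; rewrite g0 normr0 ltr10.
have [r r0 rt] := distrib_cvg0 mg t0 g1fin.
exists (Num.truncn r).+1 => n rn; apply: le_trans rt; rewrite !distribE.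
apply: le_mu; [by apply: measurable_levelset; exact: measurable_funB|exact: measurable_levelset|].
move=> x [Dx /=]; rewrite uE (_ : g x - w n x - g x = - w n x); last lra.
rewrite normrN /w indicE; case: (boolP (x \in T n)) => [/set_mem[_ /= gx] _|_]; last first.
  by rewrite mulr0 normr0 ltNge (ltW s0).
split => //=; apply: le_lt_trans gx.
by rewrite ltW// (lt_le_trans (truncnS_gt _))// ler_nat.
Unshelve. all: by end_near. Qed.

End LinearFundamental.
End Nontrivial.

(** A level set of f gives one short interval; sums of its translates give every longer one. *)
Lemma indic_itv_mem f : E f -> ~ ae_zero f -> forall t, 0 < t -> E (\1_(`]0, t])).
Proof.
move=> Ef; rewrite ae_zeroE => f0 t t0; have mf := symmetric_mes Ef.
have [s s0 fs] : exists2 s, 0 < s & (0 < distrib f s)%E.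
  apply: contrapT => /forall2NP H; apply: f0; apply/eqP; rewrite eq_le distribE measure_ge0 andbT -distribE.
  apply: distrib_right_continuous => // n; rewrite add0r leNgt; apply/negP => fn.
  by case: (H n.+1%:R^-1) => //; apply; rewrite invr_gt0.
have [r r0 rf] : exists2 r, 0 < r & (r%:E <= distrib f s)%E.
  move: fs; case: (distrib f s) => [r r0||//]; first by exists r.
  by exists 1 => //; rewrite leey.
have [E0 _] := fundamental_le_of_distrib Ef s0 (ltW r0) rf.
pose n := (Num.truncn (t / r)).+1.
have Ecell i : E (\1_(cells r i)).
  apply: (symmetric_indic _ E0 _).1; first exact: measurable_itv.
  rewrite mu_itv0 ?(ltW r0)// mu_itv_pos ?mulr_ge0 ?(ltW r0)// ?ler_wpM2r ?(ltW r0) ?ler_nat//.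
  by rewrite lee_fin -natr1 mulrDl mul1r addrAC subrr add0r.
have [+ _] := symmetric_sum (index_enum 'I_n) (fun i : 'I_n => Ecell i).
rewrite (_ : (fun x => _) = \1_(`]0, (n%:R * r)])) => [En|]; last first.
  by apply/funext => x; rewrite sum_cells// ltW.
have tn : t <= n%:R * r by rewrite -ler_pdivrMr// ltW// truncnS_gt.
apply: (symmetric_indic _ En _).1 => //.
by rewrite !mu_itv0 ?lee_fin ?(ltW t0)//; apply: le_trans tn; exact: ltW.
Qed.

Lemma Kfun_ae_zero f t : mes f -> ae_zero f -> (Kfun t f <= 0)%E.
Proof.
move=> mf /(ae_zeroP mf) f0; apply/gauge_leP => g ug; have wg := unit_weight_weight ug.
apply: (@le_trans _ _ (pairing g (fun=> 0))).
  apply: pairing_le => //.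
  by move: f0; apply: filterS => x /[apply] ->; rewrite normr0.
by rewrite /pairing; under eq_integral do rewrite normr0 mulr0; rewrite integral0.
Qed.

(** A bound on the fundamental function would put C_0 into E. If E has only null functions, then K
    vanishes on E and any t will do. *)
Lemma Kfun_large : @C0 R `\` E !=set0 -> forall B, 0 < B ->
  exists t, B <= t /\ forall f, E f -> (Kfun t f <= (t * N f / B)%:E)%E.
Proof.
move=> [g [C0g nEg]] B B0.
have [[f [Ef f0]]|triv] := pselect (exists f, E f /\ ~ ae_zero f); last first.
  exists B; split => // f Ef; apply: le_trans (Kfun_ae_zero _ _ _) _.
  - exact: symmetric_mes.
  - by apply: contrapT => f0; apply: triv; exists f.
  - by rewrite lee_fin divr_ge0 ?mulr_ge0 ?(ltW B0)//; exact: symmetric_norm_ge0.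
have ind := indic_itv_mem Ef f0.
have [t0 [t00 Bt0]] : exists t, 0 < t /\ B < phi t.
  apply: contrapT => H; apply: nEg; apply: (C0_sub_of_bounded_fundamental ind (B := B)) => //.
  by move=> t t0; rewrite leNgt; apply/negP => tB; apply: H; exists t.
(* Enlarging t to reach B keeps phi(t) above B, by monotonicity. *)
pose t := Num.max t0 B; have t_gt0 : 0 < t by rewrite lt_max t00.
exists t; split; first by rewrite le_max lexx orbT.
move=> h Eh; apply: le_trans (Kfun_fundamental ind Eh t_gt0) _.
rewrite lee_fin ler_wpM2l ?mulr_ge0 ?(ltW t_gt0) ?symmetric_norm_ge0//.
rewrite lef_pV2 ?posrE ?fundamental_gt0//; apply: le_trans (ltW Bt0) _.
by apply: fundamental_mono => //; rewrite le_max lexx.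
Qed.

Lemma Kfun_small : E01 E <> @L1_01 R -> forall B, 0 < B ->
  exists t, [/\ 0 < t, t <= B^-1 & forall f, E f -> (Kfun t f <= (N f / B)%:E)%E].
Proof.
move=> E01L B B0.
have [[f [Ef f0]]|triv] := pselect (exists f, E f /\ ~ ae_zero f); last first.
  exists B^-1; split => // [|f Ef]; first by rewrite invr_gt0.
  apply: le_trans (Kfun_ae_zero _ _ _) _.
  - exact: symmetric_mes.
  - by apply: contrapT => f0; apply: triv; exists f.
  - by rewrite lee_fin divr_ge0 ?(ltW B0)//; exact: symmetric_norm_ge0.
have ind := indic_itv_mem Ef f0; have p1 := fundamental_gt0 ind ltr01.
(* One constant for two goals: phi(t) >= B t bounds K, and phi(1) >= phi(t) >= phi(1) B t gives t <=
   1/B. *)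
pose C := B + phi 1 * B.
have C0 : 0 < C by rewrite addr_gt0// mulr_gt0.
have [t [t0 t1 tC]] : exists t, [/\ 0 < t, t <= 1 & C * t < phi t].
  apply: contrapT => H; apply: E01L; apply/seteqP; split; first by move=> h [].
  apply: (L1_01_sub ind (C := C)) => t t0 t1; rewrite leNgt; apply/negP => tC.
  by apply: H; exists t.
have pt := fundamental_gt0 ind t0.
have pt1 := fundamental_mono ind t0 t1.
exists t; split => // [|h Eh].
  rewrite -[B^-1]mul1r ler_pdivlMr//.
  suff : phi 1 * (t * B) <= phi 1 by rewrite ger_pMr// mul1r.
  rewrite mulrCA mulrC; apply: le_trans pt1; apply: ltW; apply: le_lt_trans tC.
  by rewrite ler_pM2r// lerDr ltW.
apply: le_trans (Kfun_fundamental ind Eh t0) _; rewrite lee_fin.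
have Nh := symmetric_norm_ge0 Eh.
rewrite (mulrC t) -mulrA ler_wpM2l// ler_pdivrMr// mulrC ler_pdivlMr//.
apply: ltW; apply: le_lt_trans tC; rewrite mulrC ler_pM2r// lerDl.
by rewrite mulr_ge0 ?ltW.
Qed.

End Symmetric.

Theorem theorem3p3 (R : realType) (E : set (R -> R)) (N : (R -> R) -> R) :
  symmetric_space E N ->
  (E `&` @Linf R `<=` @C0 R) -> (@C0 R `\` E !=set0) ->
  (exists (F : set (R -> R)) (NF : (R -> R) -> R), KB_space F NF /\ E `<=` F) /\
  (E01 E <> @L1_01 R ->
   exists (F : set (R -> R)) (NF : (R -> R) -> R),
     [/\ KB_space F NF, reflexive_space F NF & E `<=` F]).
Proof.
move=> symE _ C0E; pose B (n : nat) : R := 2 ^+ n.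
have B0 n : 0 < B n by rewrite exprn_gt0.
have BV n : (B n)^-1 = 2^-1 ^+ n by rewrite /B exprVn.
have /choice[l lP] : forall n, exists t, B n <= t /\
    forall f, E f -> (Kfun t f <= (t * N f / B n)%:E)%E by move=> n; exact: Kfun_large.
have l0 n : 0 < l n by apply: lt_le_trans (B0 n) _; case: (lP n).
have l_min n : (l n)^-1 * Num.min (l n) 1 <= 2^-1 ^+ n.
  apply: (@le_trans _ _ (l n)^-1); first by rewrite ler_piMr ?invr_ge0 ?(ltW (l0 n))// ge_min lexx orbT.
  by rewrite -BV lef_pV2 ?posrE//; case: (lP n).
have l_K f n : E f -> (((l n)^-1)%:E * Kfun (l n) f <= (N f * 2^-1 ^+ n)%:E)%E.
  move=> Ef; have [_ /(_ f Ef) H] := lP n.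
  apply: (@le_trans _ _ (((l n)^-1)%:E * (l n * N f / B n)%:E)%E).
    by apply: lee_wpmul2l => //; rewrite lee_fin invr_ge0 ltW.
  by rewrite -EFinM lee_fin -!mulrA mulKf ?gt_eqF// BV.
have embed (t d : nat -> R) : (forall n, 0 < t n) -> (forall n, 0 < d n) ->
    (forall f n, E f -> ((d n)%:E * Kfun (t n) f <= (N f * 2^-1 ^+ n)%:E)%E) ->
    E `<=` mixed_space t d.
  move=> t0 d0 H f Ef.
  apply: (mixed_space_geometric t0 d0 (symmetric_mes symE Ef) (symmetric_norm_ge0 symE Ef) _).1.
  by move=> n; exact: H.
split.
  exists (mixed_space l (fun n => (l n)^-1)), (mixed_norm l (fun n => (l n)^-1)).
  have d0 n : 0 < (l n)^-1 by rewrite invr_gt0.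
  split; last exact: embed.
  apply: mixed_KB => // m; exists m => //.
  by rewrite mulVf// gt_eqF.
move=> E01L.
have /choice[r rP] : forall n, exists t, [/\ 0 < t, t <= (B n)^-1 &
    forall f, E f -> (Kfun t f <= (N f / B n)%:E)%E] by move=> n; exact: Kfun_small.
(* Odd indices carry the large t_n with d_n t_n = 1, even ones the small t_n with d_n = 1;
   interleaving makes both kinds occur infinitely often. *)
pose t n := if odd n then l n else r n; pose d n : R := if odd n then (l n)^-1 else 1.
have t0 n : 0 < t n by rewrite /t; case: ifP => // _; case: (rP n).
have d0 n : 0 < d n by rewrite /d; case: ifP => // _; rewrite invr_gt0.
have d_min n : d n * Num.min (t n) 1 <= 2^-1 ^+ n.
  rewrite /t /d; case: ifP => // _; rewrite mul1r -BV; case: (rP n) => _ rn _.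
  by apply: le_trans rn; rewrite ge_min lexx.
have d_inf m : exists2 n, (m <= n)%N & 1 <= d n * t n.
  exists m.*2.+1; first by rewrite leqW// -addnn leq_addr.
  by rewrite /d /t /= odd_double /= mulVf// gt_eqF.
have d_ge1 m : exists2 n, (m <= n)%N & 1 <= d n.
  exists m.*2; first by rewrite -addnn leq_addr.
  by rewrite /d odd_double.
exists (mixed_space t d), (mixed_norm t d); split.
- exact: mixed_KB.
- exact: mixed_reflexive.
- apply: embed => // f n Ef; rewrite /t /d; case: ifP => _; first exact: l_K.
  by rewrite mul1e -BV; case: (rP n) => _ _; exact.
Qed.
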